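(* Let $j\in\mathbb N_0$, $\beta\in\{1,\dots,d\}$, and let $(X,Y,v_0,w_0)$, depending on the time variable $t_{mj,\beta}$, represent points of $\mathcal C^{sph}_{\alpha,\lambda}$ and satisfy the equations $$\dot X=-\sum_{a=0}^{mj-1}Y^av_0E_\beta w_0Y^{mj-a-1},\qquad\dot Y=0,\qquad\dot w_0=E_\beta w_0Y^{mj},\qquad\dot v_0=-Y^{mj}v_0E_\beta$$ (dot $=\partial/\partial t_{mj,\beta}$). Then the elements $$L=MyM^{-1},\qquad R_\gamma=ME_\gamma M^{-1}\ (\gamma=1,\dots,d),\qquad M=1-\epsilon_0w_0(X-x)^{-1}(Y-y)^{-1}v_0\epsilon_0$$ of $\mathrm{Mat}(d,\mathbb C)\otimes\mathcal P$ satisfy the equations of the multicomponent spherical sub-hierarchy $$\frac{\partial L}{\partial t_{mj,\beta}}=\big[(L^{mj}R_\beta)_+,L\big],\qquad\frac{\partial R_\gamma}{\partial t_{mj,\beta}}=\big[(L^{mj}R_\beta)_+,R_\gamma\big].$$ Therefore solutions of the sub-hierarchy (for all $j\in\mathbb N_0$, $\beta=1,\dots,d$) can be found by integrating these flows with an arbitrary initial point in $\mathcal C^{sph}_{\alpha,\lambda}$.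
   Context: **Ring $\mathcal P$.** Fix $m,d\ge1$, $I=\mathbb Z/m\mathbb Z=\{0,\dots,m-1\}$ (indices mod $m$), the cyclic group $\Gamma=\{e,s,\dots,s^{m-1}\}$ and a primitive $m$-th root of unity $\mu$. $\Gamma$ acts on $\mathbb C(x)$ by $s(f)(x)=f(\mu^{-1}x)$; $\mathbb C(x)*\Gamma$ is the crossed product ($\gamma a=\gamma(a)\gamma$). Put $\epsilon_i=\frac1m\sum_{r=0}^{m-1}\mu^{-ir}s^r$. Fix $\tau\in\mathbb C\setminus\{0\}$, $\varkappa_0,\dots,\varkappa_{m-1}\in\mathbb C$, and define $c_\gamma$ by $\sum_i m\varkappa_i\epsilon_i=\sum_{\gamma\in\Gamma}c_\gamma\gamma$. Let $\theta$ be the automorphism of $\mathbb C(x)*\Gamma$ with $\theta(x)=x$, $\theta(s)=\mu s$, and $D(f)=\tau\partial(f)-\sum_{\gamma\ne e}c_\gamma x^{-1}(\gamma f-f\gamma)$, where $\partial(\sum a_\gamma\gamma)=\sum\frac{da_\gamma}{dx}\gamma$. $\mathcal P$ is the associative ring of formal series $\sum_{j\ge0}f_jy^{N-j}$ ($N\in\mathbb Z$, $f_j\in\mathbb C(x)*\Gamma$), with multiplication extending that of $\mathbb C(x)*\Gamma$ and determined by $yf=\theta^{-1}(f)y+D(f)$, $y^{-1}f=\sum_{p\ge0}(-1)^p(\theta D)^p\theta(f)y^{-1-p}$. ($y$ plays the role of the Dunkl operator $\tau\frac d{dx}-\frac1x\sum_im\varkappa_i\epsilon_i$.) One has $xy-yx=\sum_i\lambda_i\epsilon_i$,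 $\lambda_i=m(\varkappa_{i-1}-\varkappa_i)-\tau$. For $S=\sum_jf_jy^{N-j}$, $S_+$ is the part with non-negative powers of $y$; this is applied entrywise on $\mathrm{Mat}(d,\mathbb C)\otimes\mathcal P$. $E_\gamma$ is the diagonal $d\times d$ matrix with $(E_\gamma)_{\beta\beta}=\delta_{\gamma\beta}$. Time derivatives are taken coefficientwise. **Sub-hierarchy.** In the multicomponent spherical sub-hierarchy the elements $L=y+\sum_{l\ge0}f_ly^{-l}$, $R_\gamma=E_\gamma+\sum_{l\ge1}r_{l\gamma}y^{-l}$ are assumed to satisfy $[L,R_\gamma]=0$, $R_\gamma R_\beta=\delta_{\gamma\beta}R_\gamma$, $\sum_\gamma R_\gamma=1$ and the symmetry $\epsilon_iL=L\epsilon_{i-1}$, $\epsilon_iR_\gamma=R_\gamma\epsilon_i$ ($i\in I$); all of these hold for the $L,R_\gamma$ in the claim, since $M$ commutes with each $\epsilon_i$. **Regularity.** With $|\lambda|=\sum_i\lambda_i$, $\lambda$ is assumed regular: $|\lambda|\neq0$ and $\lambda_i+\dots+\lambda_{j-1}\ne n|\lambda|$ for all $n\in\mathbb Z$, $1\le i<j\le m$. **Space $\mathcal C^{sph}_{\alpha,\lambda}$.** For $\alpha\in\mathbb N_0^m$ let $V_i=\mathbb C^{\alpha_i}$, $V=\bigoplus_iV_i$. Consider collections of linear maps $X_i:V_i\to V_{i+1}$, $Y_i:V_{i+1}\to V_i$ ($i\in I$), $v_0:\mathbb C^d\to V_0$, $w_0:V_0\to\mathbb C^d$ with $Y_iX_i-X_{i-1}Y_{i-1}-\delta_{i0}v_0w_0=\lambda_i1_{V_i}$.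 All maps are extended by zero to $V$; $X=\sum X_i$, $Y=\sum Y_i$. In the claim's equation for $\dot X$ the right-hand side is a sum of maps $V_{-a-1}\to V_{-a}$. $\mathcal C^{sph}_{\alpha,\lambda}$ is the quotient of the variety of such collections by $\prod_i\mathrm{GL}(\alpha_i,\mathbb C)$ acting by $(X,Y,v_0,w_0)\mapsto(gXg^{-1},gYg^{-1},gv_0,w_0g^{-1})$. **Interpretation.** Elements of $\mathcal P$ commute with linear maps between $V$ and $\mathbb C^d$; $(X-x)^{-1}=(X-x1_V)^{-1}\in\mathbb C(x)\otimes\mathrm{End}\,V$, $(Y-y)^{-1}:=-\sum_{k\ge0}Y^ky^{-k-1}$. Thus $M=1+\sum_{k\ge0}\epsilon_0\big(w_0(X-x)^{-1}Y^kv_0\big)y^{-k-1}\epsilon_0$, which is invertible in $\mathrm{Mat}(d,\mathbb C)\otimes\mathcal P$. *)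

(* Defs.v *)
From HB Require Import structures.
From mathcomp Require Import all_boot all_order all_algebra.
From mathcomp Require Import finmap complex generic_quotient.
From mathcomp Require Import all_classical all_reals all_analysis.
From mathcomp Require Import ring zify.

Set Implicit Arguments.
Unset Strict Implicit.
Unset Printing Implicit Defensive.

Import Order.TTheory GRing.Theory Num.Theory numFieldNormedType.Exports.
Local Open Scope ring_scope.

Section FracRepr.
Variable R : idomainType.
Implicit Types (f : {fraction R}) (p q : R).
Local Notation tof := (@FracField.tofrac R).

Definition fracnum f : R := (frac (repr f)).1.
Definition fracden f : R := (frac (repr f)).2.

Lemma fracden_neq0 f : fracden f != 0.
Proof. exact: denom_ratioP. Qed.

Lemma fracE f : f = tof (fracnum f) / tof (fracden f).
Proof.
have d0 : tof (fracden f) != 0 by rewrite tofrac_eq0 fracden_neq0.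
apply: (mulIf d0); rewrite divfK // /fracnum /fracden.
rewrite -[X in X * _](@reprK _ (FracField.type R) f).
move: (repr f) => r.
unlock FracField.tofrac; rewrite -[LHS]FracField.pi_mul /FracField.mulf.
apply/eqmodP => /=; rewrite FracField.equivfE.
rewrite !numden_Ratio ?mulf_neq0 ?oner_neq0 ?denom_ratioP //.
by rewrite !mulr1 mulrC.
Qed.

Lemma eq_frac p q p' q' : q != 0 -> q' != 0 ->
  (tof p / tof q == tof p' / tof q') = (p * q' == p' * q).
Proof.
by move=> q0 q0'; rewrite eqr_div ?tofrac_eq0 // -!tofracM tofrac_eq.
Qed.

Lemma add_frac p q p' q' : q != 0 -> q' != 0 ->
  tof p / tof q + tof p' / tof q' = tof (p * q' + p' * q) / tof (q * q').
Proof.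
by move=> q0 q0'; rewrite addf_div ?tofrac_eq0 // tofracD !tofracM.
Qed.

Lemma mul_frac p q p' q' :
  tof p / tof q * (tof p' / tof q') = tof (p * p') / tof (q * q').
Proof. by rewrite mulf_div !tofracM. Qed.

Lemma opp_frac p q : - (tof p / tof q) = tof (- p) / tof q.
Proof. by rewrite tofracN mulNr. Qed.

Lemma tofrac_div1 p : tof p = tof p / tof 1.
Proof. by rewrite tofrac1 divr1. Qed.

Lemma fracnum_cross p q : q != 0 ->
  fracnum (tof p / tof q) * q = p * fracden (tof p / tof q).
Proof.
move=> q0; apply/eqP.
by rewrite -eq_frac ?fracden_neq0 // -fracE.
Qed.

Lemma frac_ind (P : {fraction R} -> Prop) :
  (forall p q, q != 0 -> P (tof p / tof q)) -> forall f, P f.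
Proof. by move=> h f; rewrite [f]fracE; apply/h/fracden_neq0. Qed.

End FracRepr.

Section RatFun.
Variable F : fieldType.
Local Notation ratfun := {fraction {poly F}}.
Local Notation tof := (@FracField.tofrac {poly F}).
Implicit Types (f g : ratfun) (p q : {poly F}) (c : F).

Definition ratX : ratfun := tof 'X.
Definition ratC c : ratfun := tof c%:P.

Definition scalevar c f : ratfun :=
  tof (fracnum f \Po (c *: 'X)) / tof (fracden f \Po (c *: 'X)).

Definition ratderiv f : ratfun :=
  tof ((fracnum f)^`() * fracden f - fracnum f * (fracden f)^`())
  / tof (fracden f ^+ 2).

Lemma comp_scaleX_eq0 c p : c != 0 -> (p \Po (c *: 'X) == 0) = (p == 0).
Proof.
move=> c0; rewrite -!size_poly_eq0 size_comp_poly2 //.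
by rewrite size_scale // size_polyX.
Qed.

Lemma scalevarE c p q : c != 0 -> q != 0 ->
  scalevar c (tof p / tof q) = tof (p \Po (c *: 'X)) / tof (q \Po (c *: 'X)).
Proof.
move=> c0 q0; apply/eqP.
rewrite /scalevar eq_frac ?comp_scaleX_eq0 ?fracden_neq0 //.
by rewrite -!comp_polyM fracnum_cross.
Qed.

Lemma scalevarD c : c != 0 -> {morph scalevar c : f g / f + g}.
Proof.
move=> c0; elim/frac_ind=> p q q0; elim/frac_ind=> p' q' q0'.
rewrite add_frac // !scalevarE ?mulf_neq0 // add_frac ?comp_scaleX_eq0 //.
by rewrite comp_polyD !comp_polyM.
Qed.

Lemma scalevarM c : c != 0 -> {morph scalevar c : f g / f * g}.
Proof.
move=> c0; elim/frac_ind=> p q q0; elim/frac_ind=> p' q' q0'.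
by rewrite mul_frac !scalevarE ?mulf_neq0 // mul_frac !comp_polyM.
Qed.

Lemma scalevarC c a : c != 0 -> scalevar c (ratC a) = ratC a.
Proof.
move=> c0; rewrite /ratC tofrac_div1 scalevarE ?oner_neq0 //.
by rewrite comp_polyC -polyC1 comp_polyC.
Qed.

Lemma scalevar_id f : scalevar 1 f = f.
Proof. by rewrite /scalevar scale1r !comp_polyXr -fracE. Qed.

Lemma scalevar_comp a b f : a != 0 -> b != 0 ->
  scalevar a (scalevar b f) = scalevar (a * b) f.
Proof.
move=> a0 b0; elim/frac_ind: f => p q q0.
rewrite !scalevarE ?mulf_neq0 ?comp_scaleX_eq0 // -!comp_polyA.
by rewrite !comp_polyZ !comp_polyX !scalerA [b * a]mulrC.
Qed.

Lemma ratderivE p q : q != 0 ->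
  ratderiv (tof p / tof q) = tof (p^`() * q - p * q^`()) / tof (q ^+ 2).
Proof.
move=> q0; rewrite /ratderiv; set f := tof p / tof q.
have e := fracnum_cross p q0; rewrite -/f in e.
have := congr1 (@deriv _) e; rewrite !derivM => e'.
have d0 := fracden_neq0 f.
apply/eqP; rewrite eq_frac ?expf_neq0 //; apply/eqP.
move: (fracnum f) (fracden f) d0 e e' => n d d0 e e'.
have -> : (n^`() * d - n * d^`()) * q ^+ 2
  = (n^`() * q + n * q^`()) * (d * q) - (n * q) * (d * q^`() + d^`() * q).
  by ring.
by rewrite e' e; ring.
Qed.

Lemma ratderivD : {morph ratderiv : f g / f + g}.
Proof.
elim/frac_ind=> p q q0; elim/frac_ind=> p' q' q0'.
rewrite add_frac // !ratderivE ?mulf_neq0 // add_frac ?expf_neq0 // exprMn.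
by congr (tof _ / _); rewrite derivD !derivM; ring.
Qed.

Lemma ratderivM f g : ratderiv (f * g) = ratderiv f * g + f * ratderiv g.
Proof.
elim/frac_ind: f => p q q0; elim/frac_ind: g => p' q' q0'.
rewrite mul_frac !ratderivE ?mulf_neq0 // !mul_frac.
rewrite add_frac ?mulf_neq0 ?expf_neq0 //.
apply/eqP; rewrite eq_frac ?mulf_neq0 ?expf_neq0 // !derivM.
by apply/eqP; ring.
Qed.

Lemma ratderivC a : ratderiv (ratC a) = 0.
Proof.
rewrite /ratC tofrac_div1 ratderivE ?oner_neq0 //.
by rewrite derivC -polyC1 derivC mulr0 mul0r subr0 tofrac0 mul0r.
Qed.

Lemma ratderiv_scalevar c f : c != 0 ->
  ratderiv (scalevar c f) = ratC c * scalevar c (ratderiv f).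
Proof.
move=> c0; elim/frac_ind: f => p q q0.
rewrite ratderivE // !scalevarE ?expf_neq0 // ratderivE ?comp_scaleX_eq0 //.
rewrite mulrA -tofracM; congr (tof _ / tof _); last by rewrite rmorphXn.
by rewrite !deriv_comp derivZ derivX comp_polyB !comp_polyM -mul_polyC mulr1; ring.
Qed.

End RatFun.
Lemma fsum_seqE (V : nmodType) (T : choiceType) (F : T -> V) (r : seq T) :
  uniq r -> (forall a, a \notin r -> F a = 0) ->
  \sum_(a \in [set: T]%classic) F a = \sum_(a <- r) F a.
Proof.
move=> ur F0; rewrite (@fsbigE _ _ _ _ _ r) //; last by move=> a _; apply: F0.
by apply: eq_bigl => a; rewrite in_setT.
Qed.

Lemma fsum_nat (V : nmodType) (F : nat -> V) (n : nat) :
  (forall p, (n <= p)%N -> F p = 0) ->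
  \sum_(p \in [set: nat]%classic) F p = \sum_(p < n) F p.
Proof.
move=> F0; rewrite (@fsum_seqE _ _ _ (index_iota 0 n)) ?iota_uniq ?big_mkord //.
by move=> a; rewrite mem_index_iota /= -leqNgt; apply: F0.
Qed.

Lemma fsum_int (V : nmodType) (F : int -> V) (lo : int) (n : nat) :
  (forall a, a < lo -> F a = 0) -> (forall a, lo + n%:Z <= a -> F a = 0) ->
  \sum_(a \in [set: int]%classic) F a = \sum_(i < n) F (lo + i%:Z).
Proof.
move=> Fl Fu; rewrite (@fsum_seqE _ _ _ [seq lo + i%:Z | i <- index_iota 0 n]).
- by rewrite big_map big_mkord.
- by rewrite map_inj_uniq ?iota_uniq // => i j /addrI [].
move=> a anr; have [/Fl //|lea] := ltP a lo; have [/Fu //|lta] := leP (lo + n%:Z) a.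
case/negP: anr; apply/mapP; exists `|a - lo|%N; last by lia.
by rewrite mem_index_iota; lia.
Qed.

Record twisted_derivation (A : nzRingType) := TwistedDerivation {
  td_theta : {rmorphism A -> A};
  td_thetaV : {rmorphism A -> A};
  td_D : {additive A -> A};
  td_thetaK : cancel td_theta td_thetaV;
  td_thetaVK : cancel td_thetaV td_theta;
  td_leibniz : forall f g, td_D (f * g) = td_thetaV f * td_D g + td_D f * g }.

Definition bounded_above (A : nzRingType) (c : int -> A) : bool :=
  `[< exists N : int, forall k, N < k -> c k = 0 >].

(* A sequence c represents sum_k c_k y^k; td, a phantom here, fixes the product. *)
Record pseries (A : nzRingType) (td : twisted_derivation A) := PSeries {
  pcoef :> int -> A;
  _ : bounded_above pcoef }.

Section PSeries.
Variables (A : nzRingType) (td : twisted_derivation A).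
Local Notation theta := (td_theta td).
Local Notation thetaV := (td_thetaV td).
Local Notation D := (td_D td).
Local Notation pseries := (pseries td).
Local Notation PSeries := (@PSeries A td _).

HB.instance Definition _ := [isSub for @pcoef A td].
HB.instance Definition _ := [Choice of pseries by <:].

Implicit Types (u v w : pseries) (f g : A).

Lemma pseriesP u v : (forall k, u k = v k) -> u = v.
Proof. by move=> uv; apply/val_inj/funext. Qed.

Lemma pseries_bound u : exists N : int, forall k, N < k -> u k = 0.
Proof. by case: u => u /= /asboolP. Qed.

Lemma bounded_zero : bounded_above (fun _ : int => 0 : A).
Proof. by apply/asboolP; exists 0. Qed.

Lemma bounded_opp u : bounded_above (fun k => - u k).
Proof.
by have [N h] := pseries_bound u; apply/asboolP; exists N => k /h ->; rewrite oppr0.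
Qed.

Lemma bounded_add u v : bounded_above (fun k => u k + v k).
Proof.
have [N h] := pseries_bound u; have [M h'] := pseries_bound v.
by apply/asboolP; exists (Num.max N M) => k; rewrite gt_max => /andP[/h -> /h' ->]; rewrite addr0.
Qed.

Lemma bounded_lscale f u : bounded_above (fun k => f * u k).
Proof.
by have [N h] := pseries_bound u; apply/asboolP; exists N => k /h ->; rewrite mulr0.
Qed.

Definition pzero := PSeries bounded_zero.
Definition popp u := PSeries (bounded_opp u).
Definition padd u v := PSeries (bounded_add u v).

Lemma paddA : associative padd.
Proof. by move=> u v w; apply: pseriesP => k /=; rewrite addrA. Qed.
Lemma paddC : commutative padd.
Proof. by move=> u v; apply: pseriesP => k /=; rewrite addrC. Qed.
Lemma padd0 : left_id pzero padd.
Proof. by move=> u; apply: pseriesP => k /=; rewrite add0r. Qed.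
Lemma paddN : left_inverse pzero popp padd.
Proof. by move=> u; apply: pseriesP => k /=; rewrite addNr. Qed.

HB.instance Definition _ := GRing.isZmodule.Build pseries paddA paddC padd0 paddN.

Lemma pcoefD u v k : (u + v) k = u k + v k. Proof. by []. Qed.
Lemma pcoef0 k : (0 : pseries) k = 0. Proof. by []. Qed.

Definition lscale f u : pseries := PSeries (bounded_lscale f u).

Lemma bounded_yop u : bounded_above (fun k => thetaV (u (k - 1)) + D (u k)).
Proof.
have [N h] := pseries_bound u; apply/asboolP; exists (N + 1) => k Nk.
by rewrite !h ?raddf0 ?addr0 //; lia.
Qed.

(* y (sum_k u_k y^k), by the rule y f = theta^-1(f) y + D f *)
Definition yop u : pseries := PSeries (bounded_yop u).

Definition yV_term u (k : int) (p : nat) : A :=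
  (-1) ^+ p * iter p (theta \o D) (theta (u (k + 1 + p%:Z))).

Lemma yV_term0 u k p : u (k + 1 + p%:Z) = 0 -> yV_term u k p = 0.
Proof.
rewrite /yV_term => ->; rewrite raddf0.
have -> : iter p (theta \o D) 0 = 0 by elim: p => //= p ->; rewrite !raddf0.
by rewrite mulr0.
Qed.

Lemma bounded_yVop u :
  bounded_above (fun k => \sum_(p \in [set: nat]%classic) yV_term u k p).
Proof.
have [N h] := pseries_bound u; apply/asboolP; exists N => k Nk.
by rewrite (@fsum_nat _ _ 0) ?big_ord0 // => p _; apply/yV_term0/h; lia.
Qed.

(* y^-1 (sum_k u_k y^k), by the rule
   y^-1 f = sum_(p >= 0) (-1)^p (theta D)^p theta(f) y^(-1-p) *)
Definition yVop u : pseries := PSeries (bounded_yVop u).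

Definition ypow (a : int) u : pseries :=
  match a with Posz n => iter n yop u | Negz n => iter n.+1 yVop u end.

Lemma yopD u v : yop (u + v) = yop u + yop v.
Proof. by apply: pseriesP => k /=; rewrite !raddfD /= addrACA. Qed.

Lemma yVopE u N n k : (forall k, N < k -> u k = 0) -> N - k - 1 < n%:Z ->
  yVop u k = \sum_(p < n) yV_term u k p.
Proof.
move=> h nN; rewrite /= (@fsum_nat _ _ n) // => p np.
by apply/yV_term0/h; lia.
Qed.

Lemma yVopK : cancel yVop yop.
Proof.
move=> u; apply: pseriesP => k; have [N h] := pseries_bound u.
pose n := `|N - k|%N.
have e1 := @yVopE u N n.+1 (k - 1) h; have e2 := @yVopE u N n k h.
rewrite [LHS]/= -[X in thetaV X]/(yVop u (k - 1)) -[X in D X]/(yVop u k).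
rewrite e1 ?e2; try by rewrite /n; lia.
rewrite big_ord_recl raddfD /= {1}/yV_term expr0 mul1r /= subrK addr0 td_thetaK.
rewrite -addrA !raddf_sum /= -big_split /= big1 ?addr0 // => p _.
rewrite /yV_term /bump /= add1n exprS mulN1r mulNr rmorphN rmorphM /= td_thetaK.
have -> : k - 1 + 1 + p.+1%:Z = k + 1 + p%:Z by lia.
rewrite add0n rmorph_sign; move: (iter _ _ _) => z.
rewrite -signr_odd; case: (odd p); last by rewrite expr0 !mul1r addNr.
by rewrite expr1 !mulN1r opprK raddfN subrr.
Qed.

Lemma yopK : cancel yop yVop.
Proof.
move=> u; apply: pseriesP => k; have [N h] := pseries_bound u.
pose n := absz (N + 1 - k)%R.
have h' j : N + 1 < j -> yop u j = 0 by move=> Nj; rewrite /= !h ?raddf0 ?addr0 //; lia.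
rewrite (@yVopE _ _ n.+1 k h'); last by rewrite /n; lia.
pose T p := (-1) ^+ p * iter p (theta \o D) (u (k + p%:Z)).
have -> : \sum_(p < n.+1) yV_term (yop u) k p = \sum_(p < n.+1) (T p - T p.+1).
  apply: eq_bigr => p _; rewrite /yV_term /T /= raddfD /= td_thetaVK.
  have -> : k + 1 + p%:Z - 1 = k + p%:Z by lia.
  have -> : k + p.+1%:Z = k + 1 + p%:Z by lia.
  have iD (x y : A) : iter p (theta \o D) (x + y) =
      iter p (theta \o D) x + iter p (theta \o D) y.
    by elim: (p : nat) => //= q ->; rewrite !raddfD.
  rewrite iD mulrDr; congr (_ + _).
  rewrite exprS mulN1r mulNr opprK; congr (_ * _); set z := u _.
  by rewrite -[RHS]/(iter p.+1 (theta \o D) z) iterSr.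
rewrite -(big_mkord xpredT (fun p => T p - T p.+1)).
rewrite (eq_bigr (fun p => - (T p.+1 - T p))); last by move=> p _; rewrite opprB.
rewrite sumrN telescope_sumr // opprB /T expr0 mul1r addr0.
rewrite (h (k + n.+1%:Z)); last by rewrite /n; lia.
rewrite (_ : iter _ _ 0 = 0) ?mulr0 ?subr0 //.
by elim: n.+1 => //= q ->; rewrite !raddf0.
Qed.

Lemma yVopD u v : yVop (u + v) = yVop u + yVop v.
Proof. by apply: (can_inj yopK); rewrite yopD !yVopK. Qed.

Lemma ypowD a u v : ypow a (u + v) = ypow a u + ypow a v.
Proof.
case: a => n; rewrite /ypow.
  by elim: n => //= n ->; rewrite yopD.
by elim: n => [|n /= ->] /=; rewrite yVopD.
Qed.

Lemma ypow0 a : ypow a 0 = 0.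
Proof. by apply: (addrI (ypow a 0)); rewrite -ypowD !addr0. Qed.

Lemma yop_ypow a u : yop (ypow a u) = ypow (a + 1) u.
Proof.
case: a => n; first by rewrite -PoszD addn1.
case: n => [|n]; first exact: yVopK.
by rewrite (_ : Negz n.+1 + 1 = Negz n); [exact: yVopK | lia].
Qed.

Lemma yVop_ypow a u : yVop (ypow a u) = ypow (a - 1) u.
Proof. by rewrite -{1}[a](subrK 1) -yop_ypow yopK. Qed.

Lemma yop_bound u M :
  (forall k, M < k -> u k = 0) -> forall k, M + 1 < k -> yop u k = 0.
Proof. by move=> h k Mk; rewrite /= !h ?raddf0 ?addr0 //; lia. Qed.

Lemma yVop_bound u M :
  (forall k, M < k -> u k = 0) -> forall k, M - 1 < k -> yVop u k = 0.
Proof.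
move=> h k Mk; rewrite (@yVopE _ _ 0 _ h) ?big_ord0 //; lia.
Qed.

Lemma int_indS (P : int -> Prop) :
  P 0 -> (forall a, P a -> P (a + 1)) -> (forall a, P a -> P (a - 1)) ->
  forall a, P a.
Proof.
move=> P0 PS PP [] n.
  by elim: n => // n /PS; rewrite -PoszD addn1.
elim: n => [|n /PP]; first exact: (PP 0 P0).
by congr P; lia.
Qed.

Lemma ypow_bound a u M :
  (forall k, M < k -> u k = 0) -> forall k, M + a < k -> ypow a u k = 0.
Proof.
move=> h; elim/int_indS: a => [k|a IH k|a IH k].
- by rewrite addr0; apply: h.
- by rewrite -yop_ypow addrA; apply: yop_bound.
by rewrite -yVop_ypow addrA; apply: yVop_bound.
Qed.

Lemma pmul_finite u v N M k : (forall j, N < j -> u j = 0) ->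
  (forall j, M < j -> v j = 0) ->
  forall lo n, lo <= k - M -> N < lo + n%:Z ->
  \sum_(a \in [set: int]%classic) u a * ypow a v k =
  \sum_(i < n) u (lo + i%:Z) * ypow (lo + i%:Z) v k.
Proof.
move=> hu hv lo n hlo hn; apply: fsum_int => a ha.
  by rewrite (ypow_bound hv) ?mulr0 //; lia.
by rewrite hu ?mul0r //; lia.
Qed.

Lemma bounded_mul u v :
  bounded_above (fun k => \sum_(a \in [set: int]%classic) u a * ypow a v k).
Proof.
have [N hu] := pseries_bound u; have [M hv] := pseries_bound v.
apply/asboolP; exists (N + M) => k hk.
by rewrite (pmul_finite hu hv (lo := N + 1) (n := 0)) ?big_ord0 //; lia.
Qed.

(* (sum_a u_a y^a) v = sum_a u_a (y^a v) *)
Definition pmul u v : pseries := PSeries (bounded_mul u v).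

Lemma pmulE u v N M k lo n : (forall j, N < j -> u j = 0) ->
  (forall j, M < j -> v j = 0) -> lo <= k - M -> N < lo + n%:Z ->
  pmul u v k = \sum_(i < n) u (lo + i%:Z) * ypow (lo + i%:Z) v k.
Proof. by move=> hu hv ? ?; apply: (pmul_finite hu hv). Qed.

Lemma bounded_mono (c : int -> A) N N' : N <= N' ->
  (forall j, N < j -> c j = 0) -> forall j, N' < j -> c j = 0.
Proof. by move=> NN' h j hj; apply: h; lia. Qed.

Lemma pmulDl : left_distributive pmul +%R.
Proof.
move=> u v w; apply: pseriesP => k; rewrite pcoefD.
have [N hu] := pseries_bound u; have [M hv] := pseries_bound v.
have [K hw] := pseries_bound w.
pose B := Num.max N M.
have {}hu := bounded_mono (_ : N <= B) hu; have {}hv := bounded_mono (_ : M <= B) hv.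
have {}hu := hu ltac:(by rewrite /B; lia).
have {}hv := hv ltac:(by rewrite /B; lia).
have huv j : B < j -> (u + v) j = 0 by move=> hj; rewrite pcoefD hu ?hv ?addr0.
pose lo := k - K; pose n := (`|B - lo|.+1)%N.
have hlo : lo <= k - K by [].
have hn : B < lo + n%:Z by rewrite /n; lia.
rewrite (pmulE huv hw hlo hn) (pmulE hu hw hlo hn) (pmulE hv hw hlo hn) -big_split /=.
by apply: eq_bigr => i _; rewrite mulrDl.
Qed.

Lemma pmulDr : right_distributive pmul +%R.
Proof.
move=> w u v; apply: pseriesP => k; rewrite pcoefD.
have [N hu] := pseries_bound u; have [M hv] := pseries_bound v.
have [K hw] := pseries_bound w.
pose B := Num.max N M.
have {}hu := bounded_mono (_ : N <= B) hu; have {}hv := bounded_mono (_ : M <= B) hv.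
have {}hu := hu ltac:(by rewrite /B; lia).
have {}hv := hv ltac:(by rewrite /B; lia).
have huv j : B < j -> (u + v) j = 0 by move=> hj; rewrite pcoefD hu ?hv ?addr0.
pose lo := k - B; pose n := (`|K - lo|.+1)%N.
have hlo : lo <= k - B by [].
have hn : K < lo + n%:Z by rewrite /n; lia.
rewrite (pmulE hw huv hlo hn) (pmulE hw hu hlo hn) (pmulE hw hv hlo hn) -big_split /=.
by apply: eq_bigr => i _; rewrite ypowD pcoefD mulrDr.
Qed.

Lemma pmul0r u : pmul 0 u = 0.
Proof. by apply: (addrI (pmul 0 u)); rewrite -pmulDl !addr0. Qed.

Lemma yop_pmul u v : yop (pmul u v) = pmul (yop u) v.
Proof.
apply: pseriesP => k.
have [N hu] := pseries_bound u; have [M hv] := pseries_bound v.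
have hyu := yop_bound hu.
pose lo := k - M - 1; pose n := (`|N - lo|.+1)%N.
have hn : N < lo + n%:Z by rewrite /n; lia.
rewrite [LHS]/= -[X in thetaV X]/(pmul u v (k - 1)) -[X in D X]/(pmul u v k).
rewrite (pmulE (lo := lo) (n := n.+1) (k := k - 1) hu hv) ?/lo; try by lia.
rewrite (pmulE (lo := lo) (n := n.+1) (k := k) hu hv) ?/lo; try by lia.
rewrite (pmulE (lo := lo) (n := n.+2) (k := k) hyu hv) ?/lo; try by lia.
rewrite -/lo !raddf_sum /=.
under eq_bigr do rewrite rmorphM /=.
under [X in _ + X = _]eq_bigr do rewrite td_leibniz.
rewrite big_split /= addrA -big_split /=.
under [X in X + _ = _]eq_bigr do rewrite -mulrDr -[X in _ * X]/(yop (ypow _ v) k) yop_ypow.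
under [RHS]eq_bigr do rewrite mulrDl.
rewrite [RHS]big_split /=; congr (_ + _).
  rewrite [RHS]big_ord_recl /= (_ : ypow (lo + 0) v k = 0) ?mulr0 ?add0r.
    apply: eq_bigr => i _; rewrite /bump /= add1n.
    by congr (thetaV (u _) * ypow _ v k); lia.
  by apply: (ypow_bound hv); rewrite addr0 /lo; lia.
rewrite [RHS]big_ord_recr /= hu ?raddf0 ?mul0r ?addr0 //.
by rewrite /n /lo; lia.
Qed.

Lemma yVop_pmul u v : yVop (pmul u v) = pmul (yVop u) v.
Proof. by apply: (can_inj yopK); rewrite yop_pmul !yVopK. Qed.

Lemma ypow_pmul a u v : ypow a (pmul u v) = pmul (ypow a u) v.
Proof.
elim/int_indS: a => // a IH; first by rewrite -!yop_ypow IH yop_pmul.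
by rewrite -!yVop_ypow IH yVop_pmul.
Qed.

Lemma pmul_bound u v N M : (forall j, N < j -> u j = 0) ->
  (forall j, M < j -> v j = 0) -> forall k, N + M < k -> pmul u v k = 0.
Proof.
move=> hu hv k hk.
by rewrite (pmulE hu hv (lo := N + 1) (n := 0)) ?big_ord0 //; lia.
Qed.

Lemma pmulA : associative pmul.
Proof.
move=> u v w; apply: pseriesP => k.
have [U hu] := pseries_bound u; have [V hv] := pseries_bound v.
have [W hw] := pseries_bound w.
pose lo' : int := k - W; pose lo : int := lo' - V; pose n := (absz (U - lo)%R).+1.
pose m := (absz (V + lo + n%:Z - lo')%R + absz (U + V - lo')%R).+1.
have hn : U < lo + n%:Z by rewrite /n; lia.
rewrite (pmulE (lo := lo) (n := n) hu (pmul_bound hv hw)) //; last by rewrite /lo /lo'; lia.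
rewrite (pmulE (lo := lo') (n := m) (pmul_bound hu hv) hw) //; last by rewrite /m; lia.
under [RHS]eq_bigr => j _.
  rewrite (pmulE (lo := lo) (n := n) hu hv) //; last by rewrite /lo; lia.
  rewrite big_distrl /=; over.
rewrite [RHS]exchange_big /=; apply: eq_bigr => i _.
rewrite ypow_pmul (pmulE (lo := lo') (n := m) (ypow_bound hv) hw) //; last first.
  by have := ltn_ord i; rewrite /m; lia.
by rewrite big_distrr /=; apply: eq_bigr => j _; rewrite mulrA.
Qed.

Lemma bounded_mono1 (f : A) (a : int) : bounded_above (fun k => if k == a then f else 0).
Proof. by apply/asboolP; exists a => k; case: eqP => // ->; rewrite ltxx. Qed.

(* f y^a *)
Definition pmono f (a : int) : pseries := PSeries (bounded_mono1 f a).

Lemma pmonoE f a k : pmono f a k = if k == a then f else 0. Proof. by []. Qed.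

Lemma td_D1 : D 1 = 0.
Proof.
have := td_leibniz td 1 1; rewrite rmorph1 !mul1r mulr1 => /esym /(canRL (addrK _)).
by rewrite subrr.
Qed.

Lemma yop_mono1 a : yop (pmono 1 a) = pmono 1 (a + 1).
Proof.
apply: pseriesP => k; rewrite /= subr_eq.
by do 2?case: ifP => _; rewrite ?rmorph1 ?raddf0 ?td_D1 ?addr0.
Qed.

Lemma ypow_mono1 a b : ypow a (pmono 1 b) = pmono 1 (a + b).
Proof.
elim/int_indS: a => [|a IH|a IH]; first by rewrite add0r.
  by rewrite -yop_ypow IH yop_mono1; congr pmono; lia.
rewrite -yVop_ypow IH; apply: (can_inj yopK); rewrite yVopK yop_mono1.
by congr pmono; lia.
Qed.

Lemma pmul_mono f a u k : pmul (pmono f a) u k = f * ypow a u k.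
Proof.
have [N h] := pseries_bound u.
rewrite /= (@fsum_seqE _ _ _ [:: a]) //; first by rewrite big_seq1 eqxx.
by move=> b; rewrite inE => /negbTE ->; rewrite mul0r.
Qed.

Lemma pmul1 : left_id (pmono 1 0) pmul.
Proof. by move=> u; apply: pseriesP => k; rewrite pmul_mono mul1r. Qed.

Lemma pmulr1 : right_id (pmono 1 0) pmul.
Proof.
move=> u; apply: pseriesP => k /=.
rewrite (@fsum_seqE _ _ _ [:: k]) //.
  by rewrite big_seq1 ypow_mono1 pmonoE addr0 eqxx mulr1.
move=> b; rewrite inE => kb; rewrite ypow_mono1 pmonoE addr0 eq_sym (negbTE kb).
by rewrite mulr0.
Qed.

Lemma pone_neq0 : pmono 1 0 != 0.
Proof.
apply/eqP => /(congr1 (fun u : pseries => u 0)); rewrite pmonoE pcoef0 eqxx => /eqP.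
by rewrite oner_eq0.
Qed.

HB.instance Definition _ := GRing.Zmodule_isNzRing.Build pseries
  pmulA pmul1 pmulr1 pmulDl pmulDr pone_neq0.

End PSeries.

Section Crossed.
Variables (F : fieldType) (n : nat) (mu : F).

Definition crossed (hmu : n.+1.-primitive_root mu) :=
  {ffun 'I_n.+1 -> {fraction {poly F}}}.

Variable hmu : n.+1.-primitive_root mu.
Local Notation A := (crossed hmu).
Local Notation K := {fraction {poly F}}.
Implicit Types (f g h : A) (r p q : 'I_n.+1) (a b : K).

HB.instance Definition _ := GRing.Zmodule.on A.

Definition rat_act r a := scalevar (mu ^- r) a.

Lemma mu_neq0 : mu != 0.
Proof.
apply/eqP => mu0; have := prim_expr_order hmu; rewrite mu0 expr0n /= => /eqP.
by rewrite eq_sym oner_eq0.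
Qed.

Lemma muV_neq0 r : mu ^- r != 0.
Proof. by rewrite invr_neq0 // expf_neq0 // mu_neq0. Qed.

Lemma muD p q : mu ^+ (p + q)%R = mu ^+ p * mu ^+ q.
Proof. by rewrite /= (prim_expr_mod hmu) exprD. Qed.

Lemma rat_actD r : {morph rat_act r : a b / a + b}.
Proof. exact/scalevarD/muV_neq0. Qed.

Lemma rat_actM r : {morph rat_act r : a b / a * b}.
Proof. exact/scalevarM/muV_neq0. Qed.

Lemma rat_act_ratC r c : rat_act r (ratC c) = ratC c.
Proof. exact/scalevarC/muV_neq0. Qed.

Lemma ratC1 : ratC 1 = 1 :> {fraction {poly F}}.
Proof. by rewrite /ratC polyC1 tofrac1. Qed.

Lemma ratC0 : ratC 0 = 0 :> {fraction {poly F}}.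
Proof. by rewrite /ratC polyC0 tofrac0. Qed.

Lemma ratCM (c d : F) : ratC (c * d) = ratC c * ratC d.
Proof. by rewrite /ratC polyCM tofracM. Qed.

Lemma rat_act1 r : rat_act r 1 = 1.
Proof. by rewrite -ratC1 rat_act_ratC. Qed.

Lemma rat_act0 r : rat_act r 0 = 0.
Proof. by rewrite -ratC0 rat_act_ratC. Qed.

Lemma rat_act_sum r (I : Type) (s : seq I) (P : pred I) (G : I -> K) :
  rat_act r (\sum_(i <- s | P i) G i) = \sum_(i <- s | P i) rat_act r (G i).
Proof. exact: (big_morph _ (rat_actD r) (rat_act0 r)). Qed.

Lemma rat_act_id a : rat_act 0 a = a.
Proof. by rewrite /rat_act expr0 invr1 scalevar_id. Qed.

Lemma rat_act_comp p q a : rat_act p (rat_act q a) = rat_act (p + q) a.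
Proof. by rewrite /rat_act scalevar_comp ?muV_neq0 // muD invfM. Qed.

(* f r is the coefficient of s^r; (a s^p) (b s^q) = a s^p(b) s^(p+q) *)
Definition cmul f g : A := [ffun r => \sum_p f p * rat_act p (g (r - p))].

Definition crossedC a : A := [ffun r => if r == 0 then a else 0].
Definition crossedG p : A := [ffun r => if r == p then 1 else 0].

Lemma cmulE f g r : cmul f g r = \sum_p f p * rat_act p (g (r - p)).
Proof. by rewrite ffunE. Qed.

Lemma cmulA : associative cmul.
Proof.
move=> f g h; apply/ffunP => r; rewrite !cmulE.
under eq_bigr do rewrite cmulE rat_act_sum big_distrr /=.
under [RHS]eq_bigr do rewrite cmulE big_distrl /=.
rewrite [RHS]exchange_big /=; apply: eq_bigr => p _.
rewrite [RHS](reindex_inj (addrI p)) /=; apply: eq_bigr => q _.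
rewrite rat_actM rat_act_comp mulrA [p + q]addrC addrK.
by rewrite opprD addrA [_ - p - _]addrAC.
Qed.

Lemma cmulDl : left_distributive cmul +%R.
Proof.
move=> f g h; apply/ffunP => r; rewrite [RHS]ffunE !cmulE -big_split /=.
by apply: eq_bigr => p _; rewrite ffunE mulrDl.
Qed.

Lemma cmulDr : right_distributive cmul +%R.
Proof.
move=> f g h; apply/ffunP => r; rewrite [RHS]ffunE !cmulE -big_split /=.
by apply: eq_bigr => p _; rewrite ffunE rat_actD mulrDr.
Qed.

Lemma cmulCl a f r : cmul (crossedC a) f r = a * f r.
Proof.
rewrite cmulE (bigD1 0) //= big1 ?addr0; last first.
  by move=> p /negbTE p0; rewrite ffunE p0 mul0r.
by rewrite ffunE eqxx rat_act_id subr0.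
Qed.

Lemma cmulCr a f r : cmul f (crossedC a) r = f r * rat_act r a.
Proof.
rewrite cmulE (bigD1 r) //= big1 ?addr0; last first.
  move=> p pr; rewrite ffunE subr_eq0 eq_sym (negbTE pr).
  by rewrite rat_act0 mulr0.
by rewrite ffunE subrr eqxx.
Qed.

Lemma cmul1 : left_id (crossedC 1) cmul.
Proof. by move=> f; apply/ffunP => r; rewrite cmulCl mul1r. Qed.

Lemma cmulr1 : right_id (crossedC 1) cmul.
Proof. by move=> f; apply/ffunP => r; rewrite cmulCr rat_act1 mulr1. Qed.

Lemma crossedC1_neq0 : crossedC 1 != 0.
Proof.
apply/eqP => /ffunP /(_ 0); rewrite !ffunE eqxx => /eqP.
by rewrite oner_eq0.
Qed.

HB.instance Definition _ := GRing.Zmodule_isNzRing.Build A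
  cmulA cmul1 cmulr1 cmulDl cmulDr crossedC1_neq0.

Lemma crossedME f g r : (f * g) r = \sum_p f p * rat_act p (g (r - p)).
Proof. exact: cmulE. Qed.

Lemma crossedC_mulE a f r : (crossedC a * f) r = a * f r.
Proof. exact: cmulCl. Qed.

Lemma mul_crossedCE a f r : (f * crossedC a) r = f r * rat_act r a.
Proof. exact: cmulCr. Qed.

Definition grade (z : F) f : A := [ffun r : 'I_n.+1 => ratC (z ^+ r) * f r].

Lemma grade_zmod z : zmod_morphism (grade z).
Proof. by move=> f g; apply/ffunP => r; rewrite !ffunE mulrBr. Qed.

Lemma grade_monoid z : z ^+ n.+1 = 1 -> monoid_morphism (grade z).
Proof.
move=> z1; split=> [|f g].
  apply/ffunP => r; rewrite !ffunE; case: eqP => [->|_]; last by rewrite mulr0.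
  by rewrite expr0 ratC1 mulr1.
apply/ffunP => r; rewrite ffunE !crossedME big_distrr /=; apply: eq_bigr => p _.
rewrite !ffunE rat_actM rat_act_ratC [RHS]mulrACA -ratCM -exprD; congr (ratC _ * _).
by rewrite -[in LHS](subrK p r) addrC /= expr_mod.
Qed.

Lemma muX1 : mu ^+ n.+1 = 1. Proof. exact: prim_expr_order. Qed.
Lemma muVX1 : mu^-1 ^+ n.+1 = 1. Proof. by rewrite exprVn muX1 invr1. Qed.

Definition theta := grade mu.
Definition thetaV := grade mu^-1.

HB.instance Definition _ := GRing.isZmodMorphism.Build A A theta (grade_zmod mu).
HB.instance Definition _ := GRing.isMonoidMorphism.Build A A theta (grade_monoid muX1).
HB.instance Definition _ := GRing.isZmodMorphism.Build A A thetaV (grade_zmod mu^-1).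
HB.instance Definition _ := GRing.isMonoidMorphism.Build A A thetaV (grade_monoid muVX1).

Lemma thetaK : cancel theta thetaV.
Proof.
move=> f; apply/ffunP => r; rewrite !ffunE mulrA -ratCM -exprMn mulVf ?mu_neq0 //.
by rewrite expr1n ratC1 mul1r.
Qed.

Lemma thetaVK : cancel thetaV theta.
Proof.
move=> f; apply/ffunP => r; rewrite !ffunE mulrA -ratCM -exprMn mulfV ?mu_neq0 //.
by rewrite expr1n ratC1 mul1r.
Qed.

Definition eps (i : 'I_n.+1) : A :=
  [ffun r : 'I_n.+1 => ratC (n.+1%:R^-1 * mu ^- (i * r))].

Section Dunkl.
Variables (tau : F) (kappa : 'I_n.+1 -> F).

Definition cparam : A := \sum_i crossedC (ratC (n.+1%:R * kappa i)) * eps i.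

Definition ddx f : A := [ffun r => ratderiv (f r)].

Definition dunklD f : A :=
  crossedC (ratC tau) * ddx f
  - \sum_(r | r != 0) crossedC (cparam r / ratX F) * (crossedG r * f - f * crossedG r).

Lemma ratC_sum (I : finType) (G : I -> F) : ratC (\sum_i G i) = \sum_i ratC (G i).
Proof.
apply: (big_morph _ _ ratC0) => c d.
by rewrite /ratC polyCD tofracD.
Qed.

Lemma cparamE r : cparam r = ratC (\sum_i kappa i * mu ^- (i * r)).
Proof.
have m0 : n.+1%:R != 0 :> F by apply: prim_root_natf_neq0 hmu.
rewrite /cparam sum_ffunE ratC_sum; apply: eq_bigr => i _.
rewrite crossedC_mulE ffunE -ratCM; congr ratC.
by rewrite mulrACA divff // mul1r.
Qed.

Lemma ddxD : {morph ddx : f g / f + g}.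
Proof. by move=> f g; apply/ffunP => r; rewrite !ffunE ratderivD. Qed.

Lemma ddxM f g : ddx (f * g) = thetaV f * ddx g + ddx f * g.
Proof.
have dsum (I : finType) (G : I -> K) :
    ratderiv (\sum_i G i) = \sum_i ratderiv (G i).
  by apply: (big_morph _ (@ratderivD F)); rewrite -ratC0 ratderivC.
apply/ffunP => r; rewrite ffunE crossedME dsum [RHS]ffunE !crossedME.
rewrite -big_split /=; apply: eq_bigr => p _.
rewrite ratderivM !ffunE ratderiv_scalevar ?muV_neq0 // exprVn [RHS]addrC.
by congr (_ + _); rewrite mulrA [f p * _]mulrC.
Qed.

Lemma dunklD_zmod : zmod_morphism dunklD.
Proof.
have ddxB f g : ddx (f - g) = ddx f - ddx g.
  by apply: (addIr (ddx g)); rewrite -ddxD !subrK.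
move=> f g; rewrite /dunklD ddxB mulrBr.
have -> (P : pred 'I_n.+1) (c x : 'I_n.+1 -> A) :
    \sum_(r | P r) c r * (x r * (f - g) - (f - g) * x r)
  = \sum_(r | P r) c r * (x r * f - f * x r)
    - \sum_(r | P r) c r * (x r * g - g * x r).
  rewrite -sumrB; apply: eq_bigr => r _.
  rewrite -mulrBr; congr (_ * _); rewrite mulrBr mulrBl !opprB.
  by rewrite [LHS]addrACA [RHS]addrACA; congr (_ + _); rewrite addrC.
rewrite !opprB [LHS]addrACA [RHS]addrACA; congr (_ + _).
by rewrite addrC.
Qed.

Lemma rat_act_ratX r : rat_act r (ratX F) = ratC (mu ^- r) * ratX F.
Proof.
rewrite /rat_act /ratX [X in scalevar _ X]tofrac_div1.
rewrite scalevarE ?oner_neq0 ?muV_neq0 // comp_polyX -polyC1 comp_polyC polyC1.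
by rewrite tofrac1 divr1 -mul_polyC tofracM.
Qed.

Lemma rat_act_ratXV r : rat_act r (ratX F)^-1 = ratC (mu ^+ r) / ratX F.
Proof.
have X0 : ratX F != 0 by rewrite tofrac_eq0 polyX_eq0.
apply: (mulIf X0); rewrite divfK //.
have e : ratX F = ratC (mu ^+ r) * rat_act r (ratX F).
  by rewrite rat_act_ratX mulrA -ratCM mulfV ?ratC1 ?mul1r // expf_neq0 ?mu_neq0.
by rewrite [X in _ * X]e mulrCA -rat_actM mulVf // rat_act1 mulr1.
Qed.

Lemma crossedC_ratC_comm c f : crossedC (ratC c) * f = f * crossedC (ratC c).
Proof. by apply/ffunP => r; rewrite crossedC_mulE mul_crossedCE rat_act_ratC mulrC. Qed.

Lemma crossedC_ratXV_comm c f :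
  crossedC (ratC c / ratX F) * f = thetaV f * crossedC (ratC c / ratX F).
Proof.
apply/ffunP => r; rewrite crossedC_mulE mul_crossedCE rat_actM rat_act_ratC rat_act_ratXV ffunE.
have e : ratC (mu^-1 ^+ r) * ratC (mu ^+ r) = 1 :> K.
  by rewrite -ratCM exprVn mulVf ?ratC1 // expf_neq0 ?mu_neq0.
move: e; set u := ratC (mu^-1 ^+ r); set v := ratC (mu ^+ r) => e.
rewrite -[LHS]mul1r -e; move: (ratC c) (ratX F)^-1 (f r) => z w t.
by rewrite /= !mulrA; ring.
Qed.

Lemma dunklDM f g : dunklD (f * g) = thetaV f * dunklD g + dunklD f * g.
Proof.
rewrite /dunklD ddxM mulrDr !mulrA crossedC_ratC_comm mulrBr mulrBl !mulrA addrACA.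
congr (_ + _); rewrite -opprD; congr (- _).
rewrite big_distrr big_distrl -big_split /=; apply: eq_bigr => r _.
rewrite cparamE !mulrA -crossedC_ratXV_comm -!mulrA -mulrDr; congr (_ * _).
by rewrite mulrBr mulrBl !mulrA [RHS]addrC addrA subrK.
Qed.

HB.instance Definition _ := GRing.isZmodMorphism.Build A A dunklD dunklD_zmod.

Definition dunkl_td : twisted_derivation A :=
  @TwistedDerivation A theta thetaV dunklD thetaK thetaVK dunklDM.
End Dunkl.
End Crossed.

Section SeriesExtra.
Variables (A : nzRingType) (td : twisted_derivation A).

Lemma bounded_series (N : int) (f : nat -> A) :
  bounded_above (fun k : int => if k <= N then f (absz (N - k)%R) else 0).
Proof. by apply/asboolP; exists N => k Nk; rewrite leNgt Nk. Qed.

(* sum_(j >= 0) f_j y^(N - j) *)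
Definition pser (N : int) (f : nat -> A) : pseries td :=
  @PSeries A td _ (bounded_series N f).

Lemma bounded_pos (u : pseries td) :
  bounded_above (fun k : int => if 0 <= k then u k else 0).
Proof.
have [N h] := pseries_bound u.
by apply/asboolP; exists N => k /h ->; rewrite if_same.
Qed.

Definition ppos (u : pseries td) : pseries td := @PSeries A td _ (bounded_pos u).

Definition mxser (a b : nat) (N : int) (f : nat -> 'M[A]_(a, b)) :
    'M[pseries td]_(a, b) :=
  \matrix_(i, j) pser N (fun k => f k i j).

End SeriesExtra.

Section Derivatives.
Variable C : numClosedFieldType.

Definition mx_is_derive (a b : nat) (f : C -> 'M[C]_(a, b)) (t : C)
    (df : 'M[C]_(a, b)) : Prop :=
  forall i j, is_derive t 1 (fun s => f s i j) (df i j).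

Definition poly_is_derive (p : C -> {poly C}) (t : C) (dp : {poly C}) : Prop :=
  (exists N : nat, \forall s \near t, (size (p s) <= N)%N) /\
  forall k : nat, is_derive t 1 (fun s => (p s)`_k) dp`_k.

Definition rat_is_derive (f : C -> {fraction {poly C}}) (t : C)
    (df : {fraction {poly C}}) : Prop :=
  exists p q dp dq,
    [/\ poly_is_derive p t dp, poly_is_derive q t dq, q t != 0,
        \forall s \near t, f s = FracField.tofrac (p s) / FracField.tofrac (q s)
      & df = FracField.tofrac (dp * q t - p t * dq) / FracField.tofrac (q t ^+ 2)].

End Derivatives.

Section Spherical.
Variables (C : numClosedFieldType) (n d : nat) (mu : C).
Variable hmu : n.+1.-primitive_root mu.
Variables (tau : C) (kappa : 'I_n.+1 -> C) (alpha : 'I_n.+1 -> nat).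

Local Notation A := (crossed hmu).
Local Notation K := {fraction {poly C}}.

Local Notation P := (pseries (dunkl_td hmu tau kappa)).
Local Notation V := (\sum_(i < n.+1) alpha i)%N.

Definition lambda (i : 'I_n.+1) : C :=
  n.+1%:R * (kappa (ord_pred i) - kappa i) - tau.

Definition regular (l : 'I_n.+1 -> C) : Prop :=
  \sum_i l i != 0 /\
  forall (k : int) (i j : nat), (1 <= i < j)%N -> (j <= n.+1)%N ->
    \sum_(i <= r < j) l (inord r) != k%:~R * \sum_i l i.

Definition crossedP (f : A) : P := pmono _ f 0.
Definition ratP (f : K) : P := crossedP (crossedC hmu f).
Definition constP (c : C) : P := ratP (ratC c).
Definition yP : P := pmono _ 1 1.
Definition epsP (i : 'I_n.+1) : P := crossedP (eps hmu i).

Record sph_data := SphData {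
  sphX : forall i : 'I_n.+1, 'M[C]_(alpha (ordS i), alpha i);
  sphY : forall i : 'I_n.+1, 'M[C]_(alpha i, alpha (ordS i));
  sphv : 'M[C]_(alpha 0, d);
  sphw : 'M[C]_(d, alpha 0) }.

Definition sph_variety (q : sph_data) : Prop :=
  forall i : 'I_n.+1,
    sphY q i *m sphX q i
    - conform_mx 0 (sphX q (ord_pred i) *m sphY q (ord_pred i))
    - (if i == 0 then conform_mx 0 (sphv q *m sphw q) else 0)
    = (lambda i)%:M.

Definition gauge (g : forall i : 'I_n.+1, 'M[C]_(alpha i)) (q : sph_data) :=
  SphData (fun i => g (ordS i) *m sphX q i *m invmx (g i))
          (fun i => g i *m sphY q i *m invmx (g (ordS i)))
          (g 0 *m sphv q) (sphw q *m invmx (g 0)).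

Definition gauge_orbit (q : sph_data) : set sph_data :=
  [set q' | exists2 g, (forall i, g i \in unitmx) & q' = gauge g q]%classic.

Definition Csph : set (set sph_data) :=
  [set p | exists2 q, sph_variety q & p = gauge_orbit q]%classic.

Definition totX (q : sph_data) : 'M[C]_V :=
  \mxblock_(i, j) (if i == ordS j then conform_mx 0 (sphX q j) else 0).
Definition totY (q : sph_data) : 'M[C]_V :=
  \mxblock_(i, j) (if j == ordS i then conform_mx 0 (sphY q i) else 0).
Definition totv (q : sph_data) : 'M[C]_(V, d) :=
  \mxcol_i (if i == 0 then conform_mx 0 (sphv q) else 0).
Definition totw (q : sph_data) : 'M[C]_(d, V) :=
  \mxrow_i (if i == 0 then conform_mx 0 (sphw q) else 0).

Definition sph_flow (j : nat) (beta : 'I_d) (q : C -> sph_data) (t : C) : Prop :=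
  let N := (n.+1 * j)%N in
  let E := delta_mx beta beta : 'M[C]_d in
  let Y := totY (q t) in let v := totv (q t) in let w := totw (q t) in
  [/\ mx_is_derive (fun s => totX (q s)) t
        (- \sum_(a < N) Y ^+ a *m v *m E *m w *m Y ^+ (N - a - 1)),
      mx_is_derive (fun s => totY (q s)) t 0,
      mx_is_derive (fun s => totw (q s)) t (E *m w *m Y ^+ N)
    & mx_is_derive (fun s => totv (q s)) t (- (Y ^+ N *m v *m E))].

(* (X - x)^-1, over C(x) *)
Definition invXx (q : sph_data) : 'M[K]_V :=
  invmx (map_mx (@ratC C) (totX q) - (ratX C)%:M).

(* (Y - y)^-1 = - sum_(k >= 0) Y^k y^(-k-1) *)
Definition invYy (q : sph_data) : 'M[P]_V :=
  - mxser _ (-1) (fun k => map_mx (fun c => crossedC hmu (ratC c)) (totY q ^+ k)).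

Definition dressing (q : sph_data) : 'M[P]_d :=
  1%:M - (epsP 0)%:M *m map_mx constP (totw q) *m map_mx ratP (invXx q)
         *m invYy q *m map_mx constP (totv q) *m (epsP 0)%:M.

Definition mx_inverse (M N : 'M[P]_d) : Prop := M *m N = 1%:M /\ N *m M = 1%:M.

Definition dressingV (q : sph_data) : 'M[P]_d :=
  xget 0 [set N | mx_inverse (dressing q) N]%classic.

Definition laxL (q : sph_data) : 'M[P]_d :=
  dressing q *m yP%:M *m dressingV q.

Definition laxR (q : sph_data) (gamma : 'I_d) : 'M[P]_d :=
  dressing q *m delta_mx gamma gamma *m dressingV q.

Definition series_is_derive (S : C -> 'M[P]_d) (t : C) (dS : 'M[P]_d) : Prop :=
  forall a b (k : int) (r : 'I_n.+1),
    rat_is_derive (fun s => pcoef (S s a b) k r) t (pcoef (dS a b) k r).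

Definition mxbracket (S T : 'M[P]_d) := S *m T - T *m S.

Definition sph_lax_pair (L : 'M[P]_d) (R : 'I_d -> 'M[P]_d) : Prop :=
  [/\ exists f, L = yP%:M + mxser _ 0 f,
      forall gamma, exists r, R gamma = delta_mx gamma gamma + mxser _ (-1) r,
      [/\ forall gamma, mxbracket L (R gamma) = 0,
          forall gamma beta, R gamma *m R beta = if gamma == beta then R gamma else 0
        & \sum_gamma R gamma = 1%:M],
      forall i, (epsP i)%:M *m L = L *m (epsP (ord_pred i))%:M
    & forall i gamma, (epsP i)%:M *m R gamma = R gamma *m (epsP i)%:M].

Definition lax_eqs (j : nat) (beta : 'I_d) (L : C -> 'M[P]_d)
    (R : C -> 'I_d -> 'M[P]_d) (t : C) : Prop :=
  let B := map_mx (@ppos _ _) (L t ^+ (n.+1 * j) *m R t beta) in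
  series_is_derive L t (mxbracket B (L t)) /\
  forall gamma,
    series_is_derive (fun s => R s gamma) t (mxbracket B (R t gamma)).

End Spherical.

(* Main.v *)
Require Import Defs.
From HB Require Import structures.
From mathcomp Require Import all_boot all_order all_algebra finmap complex.
From mathcomp Require Import all_classical all_reals all_analysis.
From mathcomp Require Import ring zify.

Set Implicit Arguments.
Unset Strict Implicit.
Unset Printing Implicit Defensive.

Import Order.TTheory GRing.Theory Num.Theory numFieldNormedType.Exports.
Local Open Scope ring_scope.

(* Put A = X - x and B = Y - y, and let Pi = sum_i eps_i (x) 1_(V_i). The moment map equation and
   [x, y] = sum_i lambda_i eps_i give (B A - A B) Pi = (v eps_0) (eps_0 w); hence
   M = 1 - eps_0 w A^-1 B^-1 v eps_0 has inverse 1 + eps_0 w B^-1 A^-1 v eps_0. Along the flow,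
   trading powers of Y for powers of y modulo B shows that dM M^-1 + M y^N E_beta M^-1 (N = m j)
   has no negative powers of y. As dM M^-1 has only negative ones, that element is
   (L^N R_beta)_+, and it differs from dM M^-1 by something commuting with L and R_gamma, which
   are conjugates by M of constants in time.

   The flows are integrated explicitly. With T_beta = sum_j t_(j,beta) Y^(m j),
     w = sum_beta E_beta w_0 e^(T_beta),    v = sum_beta e^(-T_beta) v_0 E_beta,
     X = X_0 - sum_beta e^(-T_beta) Psi_beta,
   where Psi_beta is the upper right block of the exponential of T_beta with Y replaced by
   [[Y, v_0 E_beta w_0], [0, Y]]. The exponential of a polynomial in a matrix is evaluated through
   the polynomial interpolating it modulo the characteristic polynomial, so that only the scalar
   complex exponential is needed. *)

(** * Time derivatives of polynomials, rational functions and series *)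

(** The commutator of A and B is not scalar: [x, y] acts as lambda_i only on eps_i, so the moment
    map equation becomes usable only next to the factor Pi. Each of A and B shifts the index of the
    eps_i by one and fails to commute with Pi, but AB and BA do commute with it, and Pi fixes v
    eps_0; this suffices to insert Pi wherever it is needed. The exponents are multiples of m so
    that y^N commutes with eps_0. P is not commutative, so determinants over P are of no use: (X -
    x)^-1 is differentiated over C(x) by Cramer's rule, (Y - y)^-1 coefficient by coefficient, and
    M^-1 through its explicit formula. A matrix exponential obtained by interpolation must also be
    differentiated in time. The interpolating polynomial is therefore chosen as a function of the
    whole exponent, differentiable along every line f + s g, with the derivative prescribed only
    modulo the characteristic polynomial. *)

Section ScalarDerive.
Variable C : numFieldType.
Implicit Types (f g : C -> C) (t : C).

Lemma is_derive_add f g t df dg :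
  is_derive t 1 f df -> is_derive t 1 g dg ->
  is_derive t 1 (fun s => f s + g s) (df + dg).
Proof. exact: is_deriveD. Qed.

Lemma is_derive_mul f g t df dg :
  is_derive t 1 f df -> is_derive t 1 g dg ->
  is_derive t 1 (fun s => f s * g s) (df * g t + f t * dg).
Proof.
move=> hf hg; have := is_deriveM hf hg.
by rewrite /GRing.scale /= addrC [g t * _]mulrC.
Qed.

Lemma is_derive_const c t : is_derive t 1 (fun=> c) (0 : C).
Proof. exact: is_derive_cst. Qed.

Lemma is_derive_bigsum (I : Type) (r : seq I) (P : pred I) (f : I -> C -> C) t df :
  (forall i, P i -> is_derive t 1 (f i) (df i)) ->
  is_derive t 1 (fun s => \sum_(i <- r | P i) f i s) (\sum_(i <- r | P i) df i).
Proof.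
move=> h; elim: r => [|i r IH].
  rewrite big_nil (_ : (fun _ => _) = fun=> 0); first exact: is_derive_const.
  by apply/funext => s; rewrite big_nil.
rewrite big_cons (_ : (fun _ => _) = fun s => (if P i then f i s + \sum_(i <- r | P i) f i s
  else \sum_(i <- r | P i) f i s)); last by apply/funext => s; rewrite big_cons.
by case: ifP => // /h hi; apply: is_derive_add.
Qed.

Lemma is_derive_near f g t df : (\forall s \near t, f s = g s) ->
  is_derive t 1 f df -> is_derive t 1 g df.
Proof. by move=> fg; apply: near_eq_is_derive => //; exact: oner_neq0. Qed.

Lemma is_derive_unique f t df df' :
  is_derive t 1 f df -> is_derive t 1 f df' -> df = df'.
Proof. by move=> h h'; rewrite -(@derive_val _ _ _ _ _ _ _ h) -(@derive_val _ _ _ _ _ _ _ h'). Qed.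

Lemma is_derive_near_neq0 f t df : is_derive t 1 f df -> f t != 0 ->
  \forall s \near t, f s != 0.
Proof.
move=> h ft0; have := @ex_derive _ _ _ _ _ _ _ h => /derivable1_diffP.
move=> /differentiable_continuous cf.
have : (f @ t --> f t)%classic by exact: cf.
move/cvgr_neq0; exact.
Qed.

End ScalarDerive.

Section PolyDerive.
Variable C : numClosedFieldType.
Implicit Types (p q : C -> {poly C}) (t : C).

Lemma poly_is_derive_near p q t dp : (\forall s \near t, p s = q s) ->
  poly_is_derive p t dp -> poly_is_derive q t dp.
Proof.
move=> pq [[N hN] hd]; split; first by exists N; near=> s; rewrite -(near pq s) //; near: s.
by move=> k; apply: is_derive_near (hd k); near=> s; rewrite (near pq s).
Unshelve. all: by end_near. Qed.

Lemma poly_is_derive_unique p t dp dp' :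
  poly_is_derive p t dp -> poly_is_derive p t dp' -> dp = dp'.
Proof. by move=> [_ h] [_ h']; apply/polyP => k; exact: is_derive_unique (h k) (h' k). Qed.

Lemma poly_is_derive_cst (c : {poly C}) t : poly_is_derive (fun=> c) t 0.
Proof.
split; first by exists (size c); near=> s.
by move=> k; rewrite coef0; exact: is_derive_const.
Unshelve. all: by end_near. Qed.

Lemma poly_is_deriveC (c : C -> C) t dc :
  is_derive t 1 c dc -> poly_is_derive (fun s => (c s)%:P) t dc%:P.
Proof.
move=> h; split; first by exists 1%N; near=> s; exact: size_polyC_leq1.
move=> k; rewrite coefC.
rewrite (_ : (fun _ => _) = fun s => if k == 0%N then c s else 0); last first.
  by apply/funext => s; rewrite coefC.
by case: ifP => // _; exact: is_derive_const.
Unshelve. all: by end_near. Qed.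

Lemma poly_is_deriveD p q t dp dq :
  poly_is_derive p t dp -> poly_is_derive q t dq ->
  poly_is_derive (fun s => p s + q s) t (dp + dq).
Proof.
move=> [[N hN] hp] [[M hM] hq]; split.
  exists (maxn N M); near=> s; apply: leq_trans (size_polyD _ _) _.
  by rewrite geq_max !leq_max (near hN s) // (near hM s) // orbT.
move=> k; rewrite coefD (_ : (fun _ => _) = fun s => (p s)`_k + (q s)`_k).
  exact: is_derive_add.
by apply/funext => s; rewrite coefD.
Unshelve. all: by end_near. Qed.

Lemma poly_is_deriveM p q t dp dq :
  poly_is_derive p t dp -> poly_is_derive q t dq ->
  poly_is_derive (fun s => p s * q s) t (dp * q t + p t * dq).
Proof.
move=> [[N hN] hp] [[M hM] hq]; split.
  exists (N + M)%N; near=> s; apply: leq_trans (size_polyMleq _ _) _.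
  rewrite -subn1 leq_subLR; apply: leq_trans (_ : (N + M <= _)%N); last by rewrite leq_addl.
  by rewrite leq_add // ?(near hN s) // (near hM s).
move=> k; rewrite coefD !coefM -big_split /=.
rewrite (_ : (fun _ => _) = fun s => \sum_(i < k.+1) (p s)`_i * (q s)`_(k - i)).
  by apply: is_derive_bigsum => i _; exact: is_derive_mul.
by apply/funext => s; rewrite coefM.
Unshelve. all: by end_near. Qed.

Lemma poly_is_deriveZ (c : {poly C}) p t dp : poly_is_derive p t dp ->
  poly_is_derive (fun s => c * p s) t (c * dp).
Proof.
by move=> hp; have := poly_is_deriveM (poly_is_derive_cst c t) hp; rewrite mul0r add0r.
Qed.

Lemma poly_is_deriveN p t dp : poly_is_derive p t dp ->
  poly_is_derive (fun s => - p s) t (- dp).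
Proof.
move=> /(poly_is_deriveZ (-1)); rewrite mulN1r.
by rewrite (_ : (fun _ => _) = fun s => - p s) //; apply/funext => s; rewrite mulN1r.
Qed.

Lemma poly_is_derive_deriv p t dp : poly_is_derive p t dp ->
  poly_is_derive (fun s => (p s)^`()) t dp^`().
Proof.
move=> [[N hN] hp]; split.
  exists N; near=> s; apply: leq_trans (near hN s _) => //.
  by apply/leq_sizeP => k hk; rewrite coef_deriv nth_default ?mul0rn // ltnW.
move=> k; rewrite coef_deriv (_ : (fun _ => _) = fun s => k.+1%:R * (p s)`_k.+1).
  have := is_derive_mul (is_derive_const k.+1%:R t) (hp k.+1).
  by rewrite mul0r add0r mulr_natl.
by apply/funext => s; rewrite coef_deriv mulr_natl.
Unshelve. all: by end_near. Qed.

Lemma coef_comp_scaleX (c : C) (p : {poly C}) k : (p \Po (c *: 'X))`_k = c ^+ k * p`_k.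
Proof.
rewrite comp_polyE coef_sum.
rewrite (eq_bigr (fun i : 'I_(size p) => if i == k :> nat then p`_k * c ^+ k else 0)); last first.
  move=> i _; rewrite exprZn !coefZ coefXn eq_sym.
  by case: eqP => [->|_]; rewrite ?mulr1 // !mulr0.
rewrite -big_mkcond /=; have [kp|kp] := ltnP k (size p).
  by rewrite (@big_pred1 _ _ _ _ (Ordinal kp)) 1?mulrC.
rewrite big_pred0 ?nth_default ?mulr0 // => i; apply/negbTE.
by rewrite neq_ltn (leq_trans (ltn_ord i) kp).
Qed.

Lemma poly_is_derive_scaleX (c : C) p t dp : poly_is_derive p t dp ->
  poly_is_derive (fun s => p s \Po (c *: 'X)) t (dp \Po (c *: 'X)).
Proof.
move=> [[N hN] hp]; split.
  exists N; near=> s; apply: leq_trans (near hN s _) => //.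
  apply/leq_sizeP => k; rewrite coef_comp_scaleX => hk.
  by rewrite nth_default ?mulr0.
move=> k; rewrite coef_comp_scaleX (_ : (fun _ => _) = fun s => c ^+ k * (p s)`_k).
  have := is_derive_mul (is_derive_const (c ^+ k) t) (hp k).
  by rewrite mul0r add0r.
by apply/funext => s; rewrite coef_comp_scaleX.
Unshelve. all: by end_near. Qed.

(** The coefficient that leads at time t stays nonzero nearby, whatever the degrees of the nearby
    polynomials. *)
Lemma poly_near_neq0 p t dp : poly_is_derive p t dp -> p t != 0 ->
  \forall s \near t, p s != 0.
Proof.
move=> [_ h] pt0; have := is_derive_near_neq0 (h (size (p t)).-1).
rewrite -[(p t)`_ _]/(lead_coef (p t)) lead_coef_eq0 => /(_ pt0).
by apply: filterS => s; apply: contra_neq => ->; rewrite coef0.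
Qed.

End PolyDerive.

Section RatDerive.
Variable C : numClosedFieldType.
Local Notation K := {fraction {poly C}}.
Local Notation tof := (@FracField.tofrac {poly C}).
Implicit Types (f g : C -> K) (t : C).

Lemma rat_is_derive_near f g t df : (\forall s \near t, f s = g s) ->
  rat_is_derive f t df -> rat_is_derive g t df.
Proof.
move=> fg [p [q [dp [dq [hp hq q0 hf ->]]]]]; exists p, q, dp, dq; split=> //.
by near=> s; rewrite -(near fg s) // (near hf s).
Unshelve. all: by end_near. Qed.

Lemma rat_is_derive_frac (p q : C -> {poly C}) t dp dq :
  poly_is_derive p t dp -> poly_is_derive q t dq -> q t != 0 ->
  rat_is_derive (fun s => tof (p s) / tof (q s)) t
    (tof (dp * q t - p t * dq) / tof (q t ^+ 2)).
Proof. by move=> hp hq q0; exists p, q, dp, dq; split=> //; near=> s. 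
Unshelve. all: by end_near. Qed.

(** Two local representations satisfy p q' = p' q near t. Differentiating this polynomial identity,
    together with its value at t, equates the two quotient rules. *)
Lemma rat_is_derive_unique f t df df' :
  rat_is_derive f t df -> rat_is_derive f t df' -> df = df'.
Proof.
move=> [p [q [dp [dq [hp hq q0 hf ->]]]]] [p' [q' [dp' [dq' [hp' hq' q0' hf' ->]]]]].
have nq := poly_near_neq0 hq q0; have nq' := poly_near_neq0 hq' q0'.
have e : \forall s \near t, p s * q' s = p' s * q s.
  near=> s; have qs0 : q s != 0 by near: s.
  have qs0' : q' s != 0 by near: s.
  by apply/eqP; rewrite -eq_frac // -(near hf s) // -(near hf' s).
have et : p t * q' t = p' t * q t by exact: (nbhs_singleton e).
have := poly_is_derive_unique (poly_is_derive_near e (poly_is_deriveM hp hq'))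
  (poly_is_deriveM hp' hq) => de.
apply/eqP; rewrite eq_frac ?expf_neq0 //; apply/eqP.
(* The numerator is expressed through p q' and its derivative, which [et] and [de] then exchange for
   those of p' q. *)
have -> : (dp * q t - p t * dq) * q' t ^+ 2
  = (dp * q' t + p t * dq') * (q t * q' t) - (p t * q' t) * (q t * dq' + q' t * dq).
  by ring.
by rewrite de et; ring.
Unshelve. all: by end_near. Qed.

Lemma rat_is_derive_cst (c : K) t : rat_is_derive (fun=> c) t 0.
Proof.
rewrite [c]fracE; have q0 := fracden_neq0 c.
have := rat_is_derive_frac (poly_is_derive_cst (fracnum c) t)
  (poly_is_derive_cst (fracden c) t) q0.
by rewrite mulr0 mul0r subr0 tofrac0 mul0r.
Qed.

Lemma rat_is_derive_ratC (c : C -> C) t dc :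
  is_derive t 1 c dc -> rat_is_derive (fun s => ratC (c s)) t (ratC dc).
Proof.
move=> h; have := rat_is_derive_frac (poly_is_deriveC h) (poly_is_derive_cst 1 t) (oner_neq0 _).
rewrite mulr0 subr0 mulr1 expr1n tofrac1 divr1; apply: rat_is_derive_near.
by near=> s; rewrite divr1.
Unshelve. all: by end_near. Qed.

Lemma rat_is_deriveD f g t df dg : rat_is_derive f t df -> rat_is_derive g t dg ->
  rat_is_derive (fun s => f s + g s) t (df + dg).
Proof.
move=> [p [q [dp [dq [hp hq q0 hf ->]]]]] [p' [q' [dp' [dq' [hp' hq' q0' hf' ->]]]]].
have nq := poly_near_neq0 hq q0; have nq' := poly_near_neq0 hq' q0'.
have hn := poly_is_deriveD (poly_is_deriveM hp hq') (poly_is_deriveM hp' hq).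
have := rat_is_derive_frac hn (poly_is_deriveM hq hq') (mulf_neq0 q0 q0').
rewrite add_frac ?expf_neq0 // => h.
have -> : tof ((dp * q t - p t * dq) * q' t ^+ 2 + (dp' * q' t - p' t * dq') * q t ^+ 2)
   / tof (q t ^+ 2 * q' t ^+ 2) = tof ((dp * q' t + p t * dq' + (dp' * q t + p' t * dq)) * (q t *
     q' t) -
      (p t * q' t + p' t * q t) * (dq * q' t + q t * dq')) /
      tof ((q t * q' t) ^+ 2).
  by rewrite exprMn; congr (tof _ / _); ring.
apply: rat_is_derive_near h; near=> s.
have qs0 : q s != 0 by near: s.
have qs0' : q' s != 0 by near: s.
by rewrite (near hf s) // (near hf' s) // add_frac.
Unshelve. all: by end_near. Qed.

Lemma rat_is_deriveM f g t df dg : rat_is_derive f t df -> rat_is_derive g t dg ->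
  rat_is_derive (fun s => f s * g s) t (df * g t + f t * dg).
Proof.
move=> [p [q [dp [dq [hp hq q0 hf ->]]]]] [p' [q' [dp' [dq' [hp' hq' q0' hf' ->]]]]].
have := rat_is_derive_frac (poly_is_deriveM hp hp') (poly_is_deriveM hq hq') (mulf_neq0 q0 q0').
rewrite (nbhs_singleton hf) (nbhs_singleton hf') !mul_frac add_frac ?mulf_neq0 ?expf_neq0 // => h.
rewrite [X in rat_is_derive _ _ X](_ : _ = tof ((dp * p' t + p t * dp') * (q t * q' t) -
      p t * p' t * (dq * q' t + q t * dq')) / tof ((q t * q' t) ^+ 2)).
  by apply: rat_is_derive_near h; near=> s; rewrite (near hf s) // (near hf' s) // mul_frac.
apply/eqP; rewrite eq_frac ?mulf_neq0 ?expf_neq0 ?mulf_neq0 //; apply/eqP; ring.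
Unshelve. all: by end_near. Qed.

Lemma rat_is_deriveN f t df : rat_is_derive f t df ->
  rat_is_derive (fun s => - f s) t (- df).
Proof.
move=> /(rat_is_deriveM (rat_is_derive_cst (-1) t)); rewrite mul0r add0r mulN1r.
by apply: rat_is_derive_near; near=> s; rewrite mulN1r.
Unshelve. all: by end_near. Qed.

Lemma rat_is_deriveZ (c : K) f t df : rat_is_derive f t df ->
  rat_is_derive (fun s => c * f s) t (c * df).
Proof. by move=> /(rat_is_deriveM (rat_is_derive_cst c t)); rewrite mul0r add0r. Qed.

Lemma rat_is_derive_sum (I : Type) (r : seq I) (P : pred I) (f : I -> C -> K) t df :
  (forall i, P i -> rat_is_derive (f i) t (df i)) ->
  rat_is_derive (fun s => \sum_(i <- r | P i) f i s) t (\sum_(i <- r | P i) df i).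
Proof.
move=> h; elim: r => [|i r IH].
  rewrite big_nil (_ : (fun _ => _) = fun=> 0); first exact: rat_is_derive_cst.
  by apply/funext => s; rewrite big_nil.
rewrite big_cons (_ : (fun _ => _) = fun s => (if P i then f i s + \sum_(i <- r | P i) f i s
  else \sum_(i <- r | P i) f i s)); last by apply/funext => s; rewrite big_cons.
by case: ifP => // /h hi; apply: rat_is_deriveD.
Qed.

(** Existence is enough here: the product enters determinants, and the derivative of an inverse
    matrix is identified afterwards from the product with the matrix itself. *)
Lemma rat_is_derive_prod (I : Type) (r : seq I) (f : I -> C -> K) t :
  (forall i, exists df, rat_is_derive (f i) t df) ->
  exists df, rat_is_derive (fun s => \prod_(i <- r) f i s) t df.
Proof.
move=> h; elim: r => [|i r [dg IH]].
  exists 0; rewrite (_ : (fun _ => _) = fun=> 1); first exact: rat_is_derive_cst.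
  by apply/funext => s; rewrite big_nil.
have [df hf] := h i; exists (df * \prod_(j <- r) f j t + f i t * dg).
rewrite (_ : (fun _ => _) = fun s => f i s * \prod_(i <- r) f i s).
  exact: rat_is_deriveM.
by apply/funext => s; rewrite big_cons.
Qed.

Lemma ex_rat_is_deriveV f t df : rat_is_derive f t df -> f t != 0 ->
  exists dg, rat_is_derive (fun s => (f s)^-1) t dg.
Proof.
move=> [p [q [dp [dq [hp hq q0 hf _]]]]] ft0.
have pt0 : p t != 0.
  by apply: contra_neq ft0 => e; rewrite (nbhs_singleton hf) e tofrac0 mul0r.
eexists; apply: rat_is_derive_near (rat_is_derive_frac hq hp pt0).
by near=> s; rewrite (near hf s) // invf_div.
Unshelve. all: by end_near. Qed.

Lemma rat_is_derive_scalevar (c : C) f t df : c != 0 -> rat_is_derive f t df ->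
  rat_is_derive (fun s => scalevar c (f s)) t (scalevar c df).
Proof.
move=> c0 [p [q [dp [dq [hp hq q0 hf ->]]]]].
have nq := poly_near_neq0 hq q0.
have := rat_is_derive_frac (poly_is_derive_scaleX c hp) (poly_is_derive_scaleX c hq).
rewrite comp_scaleX_eq0 // => /(_ q0) h.
rewrite scalevarE ?expf_neq0 // comp_polyB !comp_polyM -expr2.
apply: rat_is_derive_near h; near=> s; have qs0 : q s != 0 by near: s.
by rewrite (near hf s) // scalevarE.
Unshelve. all: by end_near. Qed.

(** Time derivative and d/dx commute, as seen on numerators and denominators. The product of P needs
    this, since y differentiates coefficients in x. *)
Lemma rat_is_derive_ratderiv f t df : rat_is_derive f t df ->
  rat_is_derive (fun s => ratderiv (f s)) t (ratderiv df).
Proof.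
move=> [p [q [dp [dq [hp hq q0 hf ->]]]]].
have nq := poly_near_neq0 hq q0.
have hn := poly_is_deriveD (poly_is_deriveM (poly_is_derive_deriv hp) hq)
  (poly_is_deriveN (poly_is_deriveM hp (poly_is_derive_deriv hq))).
have := rat_is_derive_frac hn (poly_is_deriveM hq hq) (mulf_neq0 q0 q0).
rewrite ratderivE ?expf_neq0 // => h.
rewrite (_ : tof _ / tof _ = tof ((dp^`() * q t + (p t)^`() * dq + - (dp * (q t)^`() + p t *
  dq^`())) *
      (q t * q t) - ((p t)^`() * q t + - (p t * (q t)^`())) * (dq * q t + q t * dq)) /
      tof ((q t * q t) ^+ 2)).
  apply: rat_is_derive_near h; near=> s; have qs0 : q s != 0 by near: s.
  by rewrite (near hf s) // ratderivE // derivM.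
have -> : (q t ^+ 2) ^+ 2 = (q t * q t) ^+ 2 by rewrite expr2.
congr (tof _ / _).
by rewrite derivB !derivM; ring.
Unshelve. all: by end_near. Qed.

End RatDerive.

Section CrossedDerive.
Variables (C : numClosedFieldType) (n : nat) (mu : C).
Variable hmu : n.+1.-primitive_root mu.
Variables (tau : C) (kappa : 'I_n.+1 -> C).
Local Notation A := (crossed hmu).
Local Notation K := {fraction {poly C}}.
Local Notation td := (dunkl_td hmu tau kappa).
Local Notation P := (Defs.pseries td).
Implicit Types (t : C).

Definition crossed_is_derive (f : C -> A) t (df : A) : Prop :=
  forall r, rat_is_derive (fun s => f s r) t (df r).

Lemma crossed_is_derive_cst (c : A) t : crossed_is_derive (fun=> c) t 0.
Proof. by move=> r; rewrite ffunE; exact: rat_is_derive_cst. Qed.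

Lemma crossed_is_deriveC (f : C -> K) t df : rat_is_derive f t df ->
  crossed_is_derive (fun s => crossedC hmu (f s)) t (crossedC hmu df).
Proof.
move=> h r; rewrite ffunE (_ : (fun _ => _) = fun s => if r == 0 then f s else 0).
  by case: ifP => // _; exact: rat_is_derive_cst.
by apply/funext => s; rewrite ffunE.
Qed.

Lemma crossed_is_deriveD (f g : C -> A) t df dg :
  crossed_is_derive f t df -> crossed_is_derive g t dg ->
  crossed_is_derive (fun s => f s + g s) t (df + dg).
Proof.
move=> hf hg r; rewrite ffunE (_ : (fun _ => _) = fun s => f s r + g s r).
  exact: rat_is_deriveD.
by apply/funext => s; rewrite ffunE.
Qed.

Lemma crossed_is_deriveN (f : C -> A) t df :
  crossed_is_derive f t df -> crossed_is_derive (fun s => - f s) t (- df).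
Proof.
move=> hf r; rewrite ffunE (_ : (fun _ => _) = fun s => - f s r).
  exact: rat_is_deriveN.
by apply/funext => s; rewrite ffunE.
Qed.

Lemma crossed_is_derive_sum (I : Type) (r : seq I) (Q : pred I) (f : I -> C -> A) t df :
  (forall i, Q i -> crossed_is_derive (f i) t (df i)) ->
  crossed_is_derive (fun s => \sum_(i <- r | Q i) f i s) t (\sum_(i <- r | Q i) df i).
Proof.
move=> h p; rewrite sum_ffunE (_ : (fun _ => _) = fun s => \sum_(i <- r | Q i) f i s p).
  by apply: rat_is_derive_sum => i Qi; exact: h.
by apply/funext => s; rewrite sum_ffunE.
Qed.

Lemma crossed_is_deriveM (f g : C -> A) t df dg :
  crossed_is_derive f t df -> crossed_is_derive g t dg ->
  crossed_is_derive (fun s => f s * g s) t (df * g t + f t * dg).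
Proof.
move=> hf hg r; rewrite ffunE !crossedME -big_split /=.
rewrite (_ : (fun _ => _) = fun s => \sum_p f s p * rat_act mu p (g s (r - p))).
  apply: rat_is_derive_sum => p _; apply: rat_is_deriveM => //.
  apply: rat_is_derive_scalevar => //; exact: muV_neq0.
by apply/funext => s; rewrite crossedME.
Qed.

Lemma crossed_is_deriveZ (c : A) (f : C -> A) t df : crossed_is_derive f t df ->
  crossed_is_derive (fun s => c * f s) t (c * df).
Proof. by move=> /(crossed_is_deriveM (crossed_is_derive_cst c t)); rewrite mul0r add0r. Qed.

Lemma crossed_is_deriveZr (c : A) (f : C -> A) t df : crossed_is_derive f t df ->
  crossed_is_derive (fun s => f s * c) t (df * c).
Proof. by move=> /crossed_is_deriveM /(_ (crossed_is_derive_cst c t)); rewrite mulr0 addr0. Qed.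

Lemma crossed_is_derive_grade z (f : C -> A) t df : crossed_is_derive f t df ->
  crossed_is_derive (fun s => grade z (f s)) t (grade z df).
Proof.
move=> hf r; rewrite ffunE (_ : (fun _ => _) = fun s => ratC (z ^+ r) * f s r).
  exact: rat_is_deriveZ.
by apply/funext => s; rewrite ffunE.
Qed.

Lemma crossed_is_derive_ddx (f : C -> A) t df : crossed_is_derive f t df ->
  crossed_is_derive (fun s => ddx (f s)) t (ddx df).
Proof.
move=> hf r; rewrite ffunE (_ : (fun _ => _) = fun s => ratderiv (f s r)).
  exact: rat_is_derive_ratderiv.
by apply/funext => s; rewrite ffunE.
Qed.

Lemma crossed_is_derive_dunklD (f : C -> A) t df : crossed_is_derive f t df ->
  crossed_is_derive (fun s => td_D td (f s)) t (td_D td df).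
Proof.
move=> hf; apply: crossed_is_deriveD; first exact/crossed_is_deriveZ/crossed_is_derive_ddx.
apply: crossed_is_deriveN; apply: crossed_is_derive_sum => r _.
apply: crossed_is_deriveZ; apply: crossed_is_deriveD; first exact: crossed_is_deriveZ.
by apply: crossed_is_deriveN; exact: crossed_is_deriveZr.
Qed.

(** The bound on the order is uniform in s, so that a given coefficient of a product is, for all s
    at once, a finite sum over one range of indices. *)
Definition pseries_is_derive (u : C -> P) t (du : P) : Prop :=
  (exists N : int, forall s k, N < k -> u s k = 0) /\
  forall k, crossed_is_derive (fun s => u s k) t (du k).

Lemma pseries_is_derive_cst (c : P) t : pseries_is_derive (fun=> c) t 0.
Proof.
split; first by have [N h] := pseries_bound c; exists N.
by move=> k; exact: crossed_is_derive_cst.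
Qed.

Lemma pseries_is_deriveD (u v : C -> P) t du dv :
  pseries_is_derive u t du -> pseries_is_derive v t dv ->
  pseries_is_derive (fun s => u s + v s) t (du + dv).
Proof.
move=> [[N hN] hu] [[M hM] hv]; split; last by move=> k; exact: crossed_is_deriveD.
by exists (Num.max N M) => s k; rewrite gt_max pcoefD => /andP[/hN -> /hM ->]; rewrite addr0.
Qed.

Lemma pseries_is_deriveN (u : C -> P) t du :
  pseries_is_derive u t du -> pseries_is_derive (fun s => - u s) t (- du).
Proof.
move=> [[N hN] hu]; split; last by move=> k; exact: crossed_is_deriveN.
by exists N => s k /hN /= ->; rewrite oppr0.
Qed.

Lemma pseries_is_derive_sum (I : Type) (r : seq I) (Q : pred I) (u : I -> C -> P) t du :
  (forall i, Q i -> pseries_is_derive (u i) t (du i)) ->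
  pseries_is_derive (fun s => \sum_(i <- r | Q i) u i s) t (\sum_(i <- r | Q i) du i).
Proof.
move=> h; elim: r => [|i r IH].
  rewrite big_nil (_ : (fun _ => _) = fun=> 0); first exact: pseries_is_derive_cst.
  by apply/funext => s; rewrite big_nil.
rewrite big_cons (_ : (fun _ => _) = fun s => (if Q i then u i s + \sum_(i <- r | Q i) u i s
  else \sum_(i <- r | Q i) u i s)); last by apply/funext => s; rewrite big_cons.
by case: ifP => // /h hi; apply: pseries_is_deriveD.
Qed.

Lemma pseries_is_derive_yop (u : C -> P) t du : pseries_is_derive u t du ->
  pseries_is_derive (fun s => yop (u s)) t (yop du).
Proof.
move=> [[N hN] hu]; split.
  by exists (N + 1) => s k; apply: yop_bound; exact: hN.
move=> k; apply: crossed_is_deriveD; last exact: crossed_is_derive_dunklD.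
exact: crossed_is_derive_grade.
Qed.

Lemma pseries_is_derive_yVop (u : C -> P) t du : pseries_is_derive u t du ->
  pseries_is_derive (fun s => yVop (u s)) t (yVop du).
Proof.
move=> [[N hN] hu]; split.
  by exists (N - 1) => s k; apply: yVop_bound; exact: hN.
move=> k; have [M hM] := pseries_bound du.
pose B := Num.max N M; pose q := absz (B - k)%R.
have hB s j : B < j -> u s j = 0 by move=> hj; apply: hN; rewrite /B in hj; lia.
have hB' j : B < j -> du j = 0 by move=> hj; apply: hM; rewrite /B in hj; lia.
have hq : B - k - 1 < q%:Z by rewrite /q; lia.
rewrite (yVopE hB' hq) (_ : (fun _ => _) = fun s => \sum_(p < q) yV_term (u s) k p); last first.
  by apply/funext => s; rewrite (yVopE (hB s) hq).
apply: crossed_is_derive_sum => p _; apply: crossed_is_deriveZ.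
elim: (p : nat) (k + 1 + _) => [|j IH] l /=; first exact: crossed_is_derive_grade.
exact/crossed_is_derive_grade/crossed_is_derive_dunklD/IH.
Qed.

Lemma pseries_is_derive_ypow a (u : C -> P) t du : pseries_is_derive u t du ->
  pseries_is_derive (fun s => ypow a (u s)) t (ypow a du).
Proof.
move=> hu; elim/int_indS: a => // a IH.
  rewrite -yop_ypow (_ : (fun _ => _) = fun s => yop (ypow a (u s))).
    exact: pseries_is_derive_yop.
  by apply/funext => s; rewrite yop_ypow.
rewrite -yVop_ypow (_ : (fun _ => _) = fun s => yVop (ypow a (u s))).
  exact: pseries_is_derive_yVop.
by apply/funext => s; rewrite yVop_ypow.
Qed.

Lemma pseries_is_deriveM (u v : C -> P) t du dv :
  pseries_is_derive u t du -> pseries_is_derive v t dv ->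
  pseries_is_derive (fun s => u s * v s) t (du * v t + u t * dv).
Proof.
move=> hu hv; have [[N hN] du_] := hu; have [[M hM] dv_] := hv.
split; first by exists (N + M) => s k; apply: pmul_bound; [exact: hN | exact: hM].
move=> k; rewrite pcoefD.
have [N' hN'] := pseries_bound du; have [M' hM'] := pseries_bound dv.
pose B := Num.max N N'; pose B' := Num.max M M'.
have u0 s j : B < j -> u s j = 0 by move=> hj; apply: hN; rewrite /B in hj; lia.
have du0 j : B < j -> du j = 0 by move=> hj; apply: hN'; rewrite /B in hj; lia.
have v0 s j : B' < j -> v s j = 0 by move=> hj; apply: hM; rewrite /B' in hj; lia.
have dv0 j : B' < j -> dv j = 0 by move=> hj; apply: hM'; rewrite /B' in hj; lia.
(* For a < lo the series y^a v has no term in y^k, and for a > B the coefficient of y^a in u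
   vanishes. *)
pose lo := k - B'; pose m := (absz (B - lo)%R).+1.
have hlo : lo <= k - B' by [].
have hm : B < lo + m%:Z by rewrite /m; lia.
rewrite -[du * v t]/(pmul du (v t)) -[u t * dv]/(pmul (u t) dv).
rewrite (pmulE du0 (v0 t) hlo hm) (pmulE (u0 t) dv0 hlo hm) -big_split /=.
rewrite (_ : (fun _ => _) = fun s => \sum_(i < m) u s (lo + i%:Z) * ypow (lo + i%:Z) (v s) k).
  apply: crossed_is_derive_sum => i _; apply: crossed_is_deriveM => //.
  by have [_] := pseries_is_derive_ypow (lo + i%:Z) hv; exact.
apply/funext => s; rewrite -[LHS]/(pmul (u s) (v s) k).
by rewrite (pmulE (u0 s) (v0 s) hlo hm).
Qed.

Lemma pseries_is_derive_crossedP (f : C -> A) t df : crossed_is_derive f t df ->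
  pseries_is_derive (fun s => crossedP tau kappa (f s)) t (crossedP tau kappa df).
Proof.
move=> h; split.
  by exists 0 => s k hk /=; rewrite gt_eqF.
by move=> k /=; case: eqP => // _; exact: crossed_is_derive_cst.
Qed.

Definition mxseries_is_derive a b (S : C -> 'M[P]_(a, b)) t (dS : 'M[P]_(a, b)) :=
  forall i j, pseries_is_derive (fun s => S s i j) t (dS i j).

Section Mx.
Variables (a b : nat).
Implicit Types (S T : C -> 'M[P]_(a, b)).

Lemma mxseries_is_derive_cst (S : 'M[P]_(a, b)) t : mxseries_is_derive (fun=> S) t 0.
Proof. by move=> i j; rewrite mxE; exact: pseries_is_derive_cst. Qed.

Lemma mxseries_is_deriveD S T t dS dT :
  mxseries_is_derive S t dS -> mxseries_is_derive T t dT ->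
  mxseries_is_derive (fun s => S s + T s) t (dS + dT).
Proof.
move=> hS hT i j; rewrite mxE (_ : (fun _ => _) = fun s => S s i j + T s i j).
  exact: pseries_is_deriveD.
by apply/funext => s; rewrite mxE.
Qed.

Lemma mxseries_is_deriveN S t dS :
  mxseries_is_derive S t dS -> mxseries_is_derive (fun s => - S s) t (- dS).
Proof.
move=> hS i j; rewrite mxE (_ : (fun _ => _) = fun s => - S s i j).
  exact: pseries_is_deriveN.
by apply/funext => s; rewrite mxE.
Qed.

End Mx.

Lemma mxseries_is_deriveM a b c (S : C -> 'M[P]_(a, b)) (T : C -> 'M[P]_(b, c)) t dS dT :
  mxseries_is_derive S t dS -> mxseries_is_derive T t dT ->
  mxseries_is_derive (fun s => S s *m T s) t (dS *m T t + S t *m dT).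
Proof.
move=> hS hT i j; rewrite !mxE -big_split /=.
rewrite (_ : (fun _ => _) = fun s => \sum_k S s i k * T s k j).
  by apply: pseries_is_derive_sum => k _; exact: pseries_is_deriveM.
by apply/funext => s; rewrite mxE.
Qed.

Lemma mxseries_is_derive_mulr a b c (S : C -> 'M[P]_(a, b)) (T : 'M[P]_(b, c)) t dS :
  mxseries_is_derive S t dS -> mxseries_is_derive (fun s => S s *m T) t (dS *m T).
Proof.
by move=> h; have := mxseries_is_deriveM h (mxseries_is_derive_cst T t); rewrite mulmx0 addr0.
Qed.

Lemma mxseries_is_derive_mull a b c (S : 'M[P]_(a, b)) (T : C -> 'M[P]_(b, c)) t dT :
  mxseries_is_derive T t dT -> mxseries_is_derive (fun s => S *m T s) t (S *m dT).
Proof.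
by move=> h; have := mxseries_is_deriveM (mxseries_is_derive_cst S t) h; rewrite mul0mx add0r.
Qed.

Lemma mxseries_is_derive_constP a b (w : C -> 'M[C]_(a, b)) t dw : mx_is_derive w t dw ->
  mxseries_is_derive (fun s => map_mx (constP hmu tau kappa) (w s)) t
    (map_mx (constP hmu tau kappa) dw).
Proof.
move=> h i j; rewrite mxE (_ : (fun _ => _) = fun s => constP hmu tau kappa (w s i j)).
  apply: pseries_is_derive_crossedP; apply: crossed_is_deriveC.
  exact: rat_is_derive_ratC.
by apply/funext => s; rewrite mxE.
Qed.

Lemma mxseries_is_derive_ratP a b (w : C -> 'M[K]_(a, b)) t (dw : 'M[K]_(a, b)) :
  (forall i j, rat_is_derive (fun s => w s i j) t (dw i j)) ->
  mxseries_is_derive (fun s => map_mx (Defs.ratP hmu tau kappa) (w s)) t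
    (map_mx (Defs.ratP hmu tau kappa) dw).
Proof.
move=> h i j; rewrite mxE (_ : (fun _ => _) = fun s => Defs.ratP hmu tau kappa (w s i j)).
  by apply: pseries_is_derive_crossedP; exact: crossed_is_deriveC.
by apply/funext => s; rewrite mxE.
Qed.

(** Passes from the uniform notion, which products require, to the coefficientwise one of the claim.
    Agreement near t suffices, as [dressingV] is identified with an explicit series only under the
    moment map equation. *)
Lemma series_is_derive_near d (S T : C -> 'M[P]_d) t dS :
  (\forall s \near t, S s = T s) -> mxseries_is_derive S t dS -> series_is_derive T t dS.
Proof.
move=> ST h a b k r; have [_ /(_ k r)] := h a b; apply: rat_is_derive_near.
by near=> s; rewrite (near ST s).
Unshelve. all: by end_near. Qed.

End CrossedDerive.

(** * The crossed product and its series *)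

Section CrossedAlgebra.
Variables (F : fieldType) (n : nat) (mu : F).
Variable hmu : n.+1.-primitive_root mu.
Variables (tau : F) (kappa : 'I_n.+1 -> F).
Local Notation A := (crossed hmu).
Local Notation K := {fraction {poly F}}.
Local Notation td := (dunkl_td hmu tau kappa).

Lemma expf_mu_neq0 k : mu ^+ k != 0. Proof. by rewrite expf_neq0 ?(mu_neq0 hmu). Qed.

Lemma ratCD (c c' : F) : ratC (c + c') = ratC c + ratC c'.
Proof. by rewrite /ratC polyCD tofracD. Qed.

Lemma ratCN (c : F) : ratC (- c) = - ratC c.
Proof. by rewrite /ratC polyCN tofracN. Qed.

Lemma expr_mu_ordS_mul (i : 'I_n.+1) k : mu ^+ (ordS i * k) = mu ^+ (i * k) * mu ^+ k.
Proof. by rewrite exprM /= (prim_expr_mod hmu) -exprM mulSnr exprD. Qed.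

(** Up to the constant 1/m the coefficients of [eps i] form a character of the group, so a shift of
    the argument becomes a factor. *)
Lemma eps_subr (i r p : 'I_n.+1) :
  eps hmu i (r - p) = ratC (mu ^+ (i * p)) * eps hmu i r.
Proof.
rewrite !ffunE -ratCM; congr ratC; rewrite mulrCA; congr (_ * _).
have -> : mu ^+ (i * r) = mu ^+ (i * p) * mu ^+ (i * (r - p)%R).
  by rewrite ![(i * _)%N]mulnC !exprM -exprMn -(muD hmu) [p + _]addrC subrK.
by rewrite invfM mulrA mulfV ?expf_mu_neq0 // mul1r.
Qed.

Lemma crossedG_eps (p i : 'I_n.+1) :
  crossedG hmu p * eps hmu i = crossedC hmu (ratC (mu ^+ (i * p))) * eps hmu i.
Proof.
apply/ffunP => r; rewrite crossedC_mulE crossedME (bigD1 p) //= big1 ?addr0.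
  by rewrite ffunE eqxx mul1r eps_subr (rat_actM hmu) !ffunE !(rat_act_ratC hmu).
by move=> q /negbTE qp; rewrite ffunE qp mul0r.
Qed.

Lemma eps_crossedG (p i : 'I_n.+1) :
  eps hmu i * crossedG hmu p = crossedG hmu p * eps hmu i.
Proof.
rewrite crossedG_eps; apply/ffunP => r; rewrite crossedC_mulE crossedME (bigD1 (r - p)) //= big1.
  by rewrite addr0 [X in rat_act _ _ X]ffunE subKr eqxx (rat_act1 hmu) mulr1 eps_subr.
move=> q qr; rewrite [X in rat_act _ _ X]ffunE ifF ?(rat_act0 hmu) ?mulr0 //.
by apply: contra_neqF qr => /eqP <-; rewrite subKr.
Qed.

(** Orthogonality of characters: a geometric sum whose ratio mu^(j - i) is an m-th root of unity,
    and differs from 1 unless i = j. *)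
Lemma sum_prim_root (i j : 'I_n.+1) :
  \sum_(p < n.+1) n.+1%:R^-1 * mu ^- (i * p) * mu ^+ (j * p) = (i == j)%:R.
Proof.
have m0 : n.+1%:R != 0 :> F by apply: prim_root_natf_neq0 hmu.
rewrite (eq_bigr (fun p : 'I_n.+1 => n.+1%:R^-1 * (mu ^+ j / mu ^+ i) ^+ p)); last first.
  by move=> p _; rewrite -mulrA exprMn exprVn -!exprM [_ * mu ^- _]mulrC.
rewrite -big_distrr /=; case: eqVneq => [->|ij].
  rewrite (eq_bigr (fun=> 1)); first by rewrite sumr_const card_ord mulVf.
  by move=> p _; rewrite mulfV ?expr1n ?expf_mu_neq0.
have z1 : mu ^+ j / mu ^+ i != 1.
  rewrite -subr_eq0 -(inj_eq (mulIf (expf_mu_neq0 i))) mul0r mulrBl divfK ?expf_mu_neq0 //.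
  rewrite mul1r subr_eq0 (eq_prim_root_expr hmu) !modn_small ?ltn_ord //.
  by rewrite eq_sym.
have := subrX1 (mu ^+ j / mu ^+ i) n.+1.
rewrite exprMn exprVn -!exprM ![(_ * n.+1)%N]mulnC !exprM (prim_expr_order hmu) !expr1n.
rewrite divr1 subrr => /esym/eqP; rewrite mulf_eq0 subr_eq0 (negbTE z1) /= => /eqP ->.
by rewrite mulr0.
Qed.

Lemma eps_mul (i j : 'I_n.+1) : eps hmu i * eps hmu j = if i == j then eps hmu j else 0.
Proof.
apply/ffunP => r; rewrite crossedME.
rewrite (eq_bigr (fun p : 'I_n.+1 =>
  ratC (n.+1%:R^-1 * mu ^- (i * p) * mu ^+ (j * p)) * eps hmu j r)); last first.
  move=> p _; rewrite eps_subr (rat_actM hmu) (rat_act_ratC hmu) mulrA.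
  by rewrite [in RHS]ratCM [X in X * _ * _]ffunE [X in rat_act _ _ X]ffunE (rat_act_ratC hmu) ffunE.
rewrite -big_distrl -ratC_sum sum_prim_root /=.
by case: eqP => _; rewrite ?ratC1 ?ratC0 ?mul1r // mul0r ffunE.
Qed.

Lemma eps_ratX (i : 'I_n.+1) :
  eps hmu i * crossedC hmu (ratX F) = crossedC hmu (ratX F) * eps hmu (ordS i).
Proof.
apply/ffunP => r; rewrite mul_crossedCE crossedC_mulE (rat_act_ratX hmu) mulrA.
rewrite [RHS]mulrC; congr (_ * _); rewrite !ffunE -ratCM; congr ratC.
by rewrite -mulrA; congr (_ * _); rewrite expr_mu_ordS_mul invfM mulrC.
Qed.

Lemma thetaV_eps (i : 'I_n.+1) : td_thetaV td (eps hmu i) = eps hmu (ordS i).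
Proof.
apply/ffunP => r; rewrite !ffunE -ratCM; congr ratC; rewrite mulrCA; congr (_ * _).
by rewrite exprVn -invfM; congr (_^-1); rewrite expr_mu_ordS_mul mulrC.
Qed.

Lemma dunklD_eps (i : 'I_n.+1) : td_D td (eps hmu i) = 0.
Proof.
rewrite /= /dunklD big1 => [|r _]; last by rewrite eps_crossedG subrr mulr0.
rewrite subr0 (_ : ddx _ = 0) ?mulr0 //.
by apply/ffunP => r; rewrite !ffunE ratderivC.
Qed.

Lemma thetaV_crossedC (a : K) : td_thetaV td (crossedC hmu a) = crossedC hmu a.
Proof.
apply/ffunP => r; rewrite !ffunE; case: eqP => [->|_]; last by rewrite mulr0.
by rewrite expr0 ratC1 mul1r.
Qed.

Lemma dunklD_ratC (c : F) : td_D td (crossedC hmu (ratC c)) = 0.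
Proof.
rewrite /= /dunklD big1 => [|r _]; last by rewrite crossedC_ratC_comm subrr mulr0.
rewrite subr0 (_ : ddx _ = 0) ?mulr0 //.
by apply/ffunP => r; rewrite !ffunE; case: eqP => _; rewrite -?ratC0 ratderivC.
Qed.

Lemma crossedCM (a b : K) : crossedC hmu (a * b) = crossedC hmu a * crossedC hmu b.
Proof. by apply/ffunP => r; rewrite crossedC_mulE !ffunE; case: eqP; rewrite ?mulr0. Qed.

Lemma crossedCD (a b : K) : crossedC hmu (a + b) = crossedC hmu a + crossedC hmu b.
Proof. by apply/ffunP => r; rewrite !ffunE; case: eqP; rewrite ?addr0. Qed.

Lemma crossedCN (a : K) : crossedC hmu (- a) = - crossedC hmu a.
Proof. by apply/ffunP => r; rewrite !ffunE; case: eqP; rewrite ?oppr0. Qed.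

Lemma crossedC_sum (I : finType) (G : I -> K) :
  crossedC hmu (\sum_i G i) = \sum_i crossedC hmu (G i).
Proof.
apply: (big_morph _ crossedCD).
by apply/ffunP => r; rewrite !ffunE; case: eqP.
Qed.

Lemma ddx_ratX : ddx (crossedC hmu (ratX F)) = 1 :> A.
Proof.
apply/ffunP => r; rewrite !ffunE; case: eqP => _; last by rewrite -ratC0 ratderivC.
rewrite /ratX -[FracField.tofrac 'X]divr1 -tofrac1 ratderivE ?oner_neq0 //.
by rewrite derivX -polyC1 derivC mulr0 subr0 polyC1 mulr1 expr1n tofrac1 divr1.
Qed.

Lemma crossedG_ratX r : crossedG hmu r * crossedC hmu (ratX F) =
  crossedC hmu (ratC (mu ^- r)) * crossedC hmu (ratX F) * crossedG hmu r.
Proof.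
apply/ffunP => p; rewrite mul_crossedCE -crossedCM crossedC_mulE !ffunE.
by case: eqP => [->|_]; rewrite ?mul0r ?mulr0 // mul1r mulr1 (rat_act_ratX hmu).
Qed.

(* Since [x y - y x = - D(x)], the commutator of [x] and [y] acts as [lambda_i] on [eps_i]. *)
Lemma dunklD_ratX_eps (i : 'I_n.+1) :
  td_D td (crossedC hmu (ratX F)) * eps hmu i =
  - (crossedC hmu (ratC (n.+1%:R * (kappa (ord_pred i) - kappa i) - tau)) * eps hmu i).
Proof.
have m0 : n.+1%:R != 0 :> F by apply: prim_root_natf_neq0 hmu.
have X0 : ratX F != 0 by rewrite tofrac_eq0 polyX_eq0.
pose c (r : 'I_n.+1) := \sum_i kappa i * mu ^- (i * r).
rewrite /= /dunklD ddx_ratX mulr1 mulrBl big_distrl /=.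
pose G (r : 'I_n.+1) : A := crossedC hmu (ratC (c r * (mu ^- r - 1) * mu ^+ (i * r))).
have -> : \sum_(r | r != 0) crossedC hmu (cparam hmu kappa r / ratX F) *
    (crossedG hmu r * crossedC hmu (ratX F) - crossedC hmu (ratX F) * crossedG hmu r) * eps hmu i
  = \sum_r G r * eps hmu i.
  (* The term r = 0 may be added to the sum, its factor [mu ^- 0 - 1] being zero. *)
  rewrite [RHS](bigD1 0) //= [G 0]/G expr0 invr1 subrr mulr0 mul0r ratC0.
  rewrite (_ : crossedC hmu 0 = 0) ?mul0r ?add0r; last by rewrite /crossedC; apply/ffunP => r;
    rewrite !ffunE if_same.
  apply: eq_bigr => r _; rewrite crossedG_ratX cparamE -/(c r) -!mulrA.
  have -> : crossedC hmu (ratC (mu ^- r)) * (crossedC hmu (ratX F) * crossedG hmu r) -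
    crossedC hmu (ratX F) * crossedG hmu r =
    crossedC hmu (ratX F) * (crossedC hmu (ratC (mu ^- r - 1)) * crossedG hmu r).
    rewrite ratCD ratCN ratC1 crossedCD crossedCN mulrDl mulNr mul1r mulrBr.
    by rewrite !mulrA crossedC_ratC_comm.
  rewrite -!mulrA crossedG_eps /G !mulrA -!crossedCM; congr (crossedC hmu _ * _).
  by rewrite divfK // -!ratCM.
rewrite -big_distrl -crossedC_sum -ratC_sum -mulrBl -mulNr; congr (_ * _).
rewrite -!crossedCN -crossedCD -!ratCN -!ratCD; congr (crossedC hmu (ratC _)).
rewrite opprB; congr (_ - _).
have e (l j : 'I_n.+1) : \sum_(r < n.+1) mu ^- (l * r) * mu ^+ (j * r) = n.+1%:R * (l == j)%:R :> F.
  rewrite -sum_prim_root big_distrr /=; apply: eq_bigr => p _.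
  by rewrite !mulrA mulfV // mul1r.
(* The factor [mu ^- r - 1] splits each term into one with index [ordS l] and one with index [l].
   Orthogonality keeps l = i - 1 in the first and l = i in the second, whence the difference of two
   kappas. *)
rewrite (eq_bigr (fun r : 'I_n.+1 =>
  \sum_l kappa l * (mu ^- (ordS l * r) * mu ^+ (i * r) - mu ^- (l * r) * mu ^+ (i * r))));
    last first.
  move=> r _; rewrite /c !big_distrl /=; apply: eq_bigr => l _.
  by rewrite -!mulrA; congr (_ * _); rewrite expr_mu_ordS_mul invfM;
    move: (mu ^- r) (mu ^- _) (mu ^+ _) => x y z; ring.
rewrite exchange_big /= (eq_bigr (fun l => kappa l * (n.+1%:R * (ordS l == i)%:R - n.+1%:R * (l
  == i)%:R))).
  rewrite (eq_bigr (fun l => n.+1%:R * ((if l == ord_pred i then kappa l else 0)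
     - (if l == i then kappa l else 0)))).
    by rewrite -big_distrr /= sumrB -!big_mkcond !big_pred1_eq.
  move=> l _; rewrite -mulrBr mulrCA; congr (_ * _).
  rewrite -[X in ordS l == X]ord_predK (inj_eq (@ordS_inj _)).
  by do 2?case: ifP => _; rewrite mulrBr ?mulr1 ?mulr0.
by move=> l _; rewrite -big_distrr /= sumrB (e (ordS l)) (e l).
Qed.

End CrossedAlgebra.

(** * Signs of exponents and central coefficients in twisted series *)

Section SeriesAlgebra.
Variables (A : nzRingType) (td : twisted_derivation A).
Local Notation P := (Defs.pseries td).
Implicit Types (u v : P) (f g : A).

Lemma pcoefM u v k : (u * v) k = pmul u v k. Proof. by []. Qed.

Definition pnonneg u : Prop := forall k : int, k < 0 -> u k = 0.
Definition pneg u : Prop := forall k : int, -1 < k -> u k = 0.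

Lemma pnonnegD u v : pnonneg u -> pnonneg v -> pnonneg (u + v).
Proof. by move=> hu hv k hk; rewrite pcoefD hu ?hv ?addr0. Qed.

Lemma pnonnegN u : pnonneg u -> pnonneg (- u).
Proof. by move=> hu k hk; rewrite /= hu ?oppr0. Qed.

Lemma pnonneg_sum (I : Type) (r : seq I) (Q : pred I) (u : I -> P) :
  (forall i, Q i -> pnonneg (u i)) -> pnonneg (\sum_(i <- r | Q i) u i).
Proof. by move=> h; elim/big_rec: _ => // i v Qi hv; apply: pnonnegD => //; exact: h. Qed.

Lemma pnonneg_pmono f (a : nat) : pnonneg (pmono td f a).
Proof. by move=> k hk /=; rewrite lt_eqF // (lt_le_trans hk). Qed.

(** Only non-negative powers of y act on [v], and left multiplication by y creates no negative
    powers; it is y^-1 that would produce a negative tail. *)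
Lemma pnonnegM u v : pnonneg u -> pnonneg v -> pnonneg (u * v).
Proof.
move=> hu hv k hk; have [N hN] := pseries_bound u; have [M hM] := pseries_bound v.
pose lo := k - M; pose m := (absz (N - lo)%R).+1.
rewrite pcoefM (pmulE hN hM (lo := lo) (n := m)) ?/m //; last by lia.
apply: big1 => i _; have [l0|] := ltP (lo + i%:Z) 0; first by rewrite hu ?mul0r.
case: (lo + i%:Z) => // a _; rewrite (_ : ypow _ _ _ = 0) ?mulr0 //=.
suff : pnonneg (iter a (@yop _ td) v) by apply.
elim: a => //= a IH l hl /=; rewrite !IH ?raddf0 ?addr0 //; lia.
Qed.

Lemma ppos_decomp u v w : u = v - w -> pnonneg v -> pneg w -> ppos u = v.
Proof.
move=> -> hv hw; apply: pseriesP => k /=.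
case: leP => hk; last by rewrite hv.
by rewrite hw ?oppr0 ?addr0 //; lia.
Qed.

Lemma pmono_crossed f g : pmono td (f * g) 0 = pmono td f 0 * pmono td g 0.
Proof.
by apply: pseriesP => k; rewrite pcoefM pmul_mono /=; case: eqP; rewrite ?mulr0.
Qed.

Lemma pmonoD f g a : pmono td (f + g) a = pmono td f a + pmono td g a.
Proof. by apply: pseriesP => k; rewrite pcoefD /=; case: eqP; rewrite ?addr0. Qed.

Lemma pmonoN f a : pmono td (- f) a = - pmono td f a.
Proof. by apply: pseriesP => k /=; case: eqP; rewrite ?oppr0. Qed.

Lemma ymulE u k : (pmono td 1 1 * u) k = td_thetaV td (u (k - 1)) + td_D td (u k).
Proof. by rewrite pcoefM pmul_mono mul1r. Qed.

Lemma mulyE u k : (u * pmono td 1 1) k = u (k - 1).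
Proof.
rewrite pcoefM /= (@fsum_seqE _ _ _ [:: k - 1]) //.
  by rewrite big_seq1 ypow_mono1 pmonoE subrK eqxx mulr1.
move=> b; rewrite inE => kb; rewrite ypow_mono1 pmonoE ifF ?mulr0 //.
by apply: contra_neqF kb => /eqP ->; rewrite addrK.
Qed.

Lemma y_pmono f : pmono td 1 1 * pmono td f 0 =
  pmono td (td_thetaV td f) 0 * pmono td 1 1 + pmono td (td_D td f) 0.
Proof.
apply: pseriesP => k; rewrite pcoefD ymulE mulyE !pmonoE.
by congr (_ + _); case: ifP; rewrite ?raddf0.
Qed.

Section Central.
Variable f : A.
Hypotheses (fC : forall g, f * g = g * f) (fth : td_thetaV td f = f) (fD : td_D td f = 0).

Lemma yop_lscale u : yop (lscale f u) = lscale f (yop u).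
Proof.
apply: pseriesP => k /=; rewrite rmorphM fth td_leibniz fth fD mul0r addr0.
by rewrite mulrDr.
Qed.

Lemma ypow_lscale a u : ypow a (lscale f u) = lscale f (ypow a u).
Proof.
elim/int_indS: a u => // a IH u; first by rewrite -!yop_ypow IH yop_lscale.
rewrite -!yVop_ypow IH; apply: (can_inj (@yopK _ td)).
by apply: (can_inj (@yVopK _ td)); rewrite yVopK yop_lscale yVopK.
Qed.

(** Such an [f] commutes with y, hence with y^-1 and with every series. This is applied to the
    complex constants. *)
Lemma pmono_central u : pmono td f 0 * u = u * pmono td f 0.
Proof.
have e : pmono td f 0 = lscale f (pmono td 1 0).
  by apply: pseriesP => j /=; case: eqP; rewrite ?mulr1 ?mulr0.
have E b : ypow b (pmono td f 0) = lscale f (pmono td 1 b).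
  by rewrite e ypow_lscale ypow_mono1 addr0.
apply: pseriesP => k; rewrite !pcoefM pmul_mono /=.
rewrite (@fsum_seqE _ _ _ [:: k]) => [|//|b].
  by rewrite big_seq1 E /= eqxx mulr1 fC.
by rewrite inE => kb; rewrite E /= eq_sym (negbTE kb) !mulr0.
Qed.

End Central.
End SeriesAlgebra.

(** * Constants, x, y and the idempotents in the ring P *)

Section DunklSeries.
Variables (C : numClosedFieldType) (n : nat) (mu : C).
Variable hmu : n.+1.-primitive_root mu.
Variables (tau : C) (kappa : 'I_n.+1 -> C).
Local Notation A := (crossed hmu).
Local Notation K := {fraction {poly C}}.
Local Notation td := (dunkl_td hmu tau kappa).
Local Notation P := (Defs.pseries td).
Local Notation cP := (constP hmu tau kappa).
Local Notation rP := (Defs.ratP hmu tau kappa).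
Local Notation y := (yP hmu tau kappa).
Local Notation e := (epsP hmu tau kappa).
Local Notation x := (rP (ratX C)).

Lemma ratP_zmod : zmod_morphism rP.
Proof. by move=> a b; rewrite /Defs.ratP /crossedP crossedCD crossedCN pmonoD pmonoN. Qed.

Lemma ratP_monoid : monoid_morphism rP.
Proof. by split=> // a b; rewrite /Defs.ratP /crossedP crossedCM pmono_crossed. Qed.

HB.instance Definition _ := GRing.isZmodMorphism.Build K P rP ratP_zmod.
HB.instance Definition _ := GRing.isMonoidMorphism.Build K P rP ratP_monoid.

Lemma ratC_zmod : zmod_morphism (@ratC C).
Proof. by move=> a b; rewrite ratCD ratCN. Qed.

Lemma ratC_monoid : monoid_morphism (@ratC C).
Proof. by split=> [|a b]; rewrite ?ratC1 ?ratCM. Qed.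

HB.instance Definition _ := GRing.isZmodMorphism.Build C K (@ratC C) ratC_zmod.
HB.instance Definition _ := GRing.isMonoidMorphism.Build C K (@ratC C) ratC_monoid.

Lemma constP_zmod : zmod_morphism cP.
Proof. by move=> a b; rewrite /constP !rmorphB. Qed.

Lemma constP_monoid : monoid_morphism cP.
Proof. by split=> [|a b]; rewrite /constP ?rmorph1 // !rmorphM. Qed.

HB.instance Definition _ := GRing.isZmodMorphism.Build C P cP constP_zmod.
HB.instance Definition _ := GRing.isMonoidMorphism.Build C P cP constP_monoid.

Lemma constP_comm c (u : P) : cP c * u = u * cP c.
Proof.
apply: pmono_central; first exact: crossedC_ratC_comm.
  exact: thetaV_crossedC.
exact: dunklD_ratC.
Qed.

Lemma epsP_mul i j : e i * e j = if i == j then e j else 0.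
Proof.
rewrite /epsP /crossedP -pmono_crossed eps_mul; case: ifP => // _.
by apply: pseriesP => k; rewrite pmonoE if_same.
Qed.

Lemma epsP_x i : e i * x = x * e (ordS i).
Proof. by rewrite /epsP /Defs.ratP /crossedP -!pmono_crossed eps_ratX. Qed.

Lemma y_epsP i : y * e i = e (ordS i) * y.
Proof.
rewrite /yP /epsP /crossedP y_pmono thetaV_eps dunklD_eps [X in _ + X](_ : _ = 0) ?addr0 //.
by apply: pseriesP => k; rewrite pmonoE if_same.
Qed.

Lemma xy_epsP i : (x * y - y * x) * e i = cP (lambda tau kappa i) * e i.
Proof.
have -> : x * y - y * x = - crossedP tau kappa (td_D td (crossedC hmu (ratX C))).
  by rewrite /yP /Defs.ratP /crossedP y_pmono thetaV_crossedC opprD addrA subrr add0r.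
rewrite mulNr /constP /Defs.ratP /epsP /crossedP -!pmono_crossed dunklD_ratX_eps.
by rewrite pmonoN opprK.
Qed.

Lemma pnonneg_crossedP (f : A) : pnonneg (crossedP tau kappa f).
Proof. exact: pnonneg_pmono. Qed.

Lemma pnonneg_yX k : pnonneg (y ^+ k).
Proof.
elim: k => [|k IH]; first exact: pnonneg_pmono.
by rewrite exprS; apply: pnonnegM => //; exact: pnonneg_pmono.
Qed.

End DunklSeries.

(** * Quiver data as graded matrices *)

Section Grading.
Variables (C : numClosedFieldType) (n d : nat).
Variables (tau : C) (kappa : 'I_n.+1 -> C) (alpha : 'I_n.+1 -> nat).
Local Notation V := (\sum_(i < n.+1) alpha i)%N.
Local Notation deg := (@tagnat.sig1 n.+1 alpha).
Implicit Types (q : sph_data C d alpha).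

(** [deg a] is the vertex i whose block V_i contains the index [a]. The grading is used below in
    this form, as vanishing of the entries between all other degrees. *)
Lemma totX_graded q a b : totX q a b != 0 -> deg a = ordS (deg b).
Proof. by rewrite mxE; case: (tagnat.sig1 _ =P _) => // _; rewrite mxE eqxx. Qed.

Lemma totY_graded q a b : totY q a b != 0 -> deg b = ordS (deg a).
Proof. by rewrite mxE; case: (tagnat.sig1 b =P _) => // _; rewrite mxE eqxx. Qed.

Lemma totv_graded q a j : totv q a j != 0 -> deg a = 0.
Proof. by rewrite mxE; case: (tagnat.sig1 _ =P _) => // _; rewrite mxE eqxx. Qed.

Lemma totw_graded q j a : totw q j a != 0 -> deg a = 0.
Proof. by rewrite mxE; case: (tagnat.sig1 _ =P _) => // _; rewrite mxE eqxx. Qed.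

Lemma mul_totYX q : totY q *m totX q = \mxdiag_i (sphY q i *m sphX q i).
Proof.
rewrite mul_mxblock; apply/eq_mxblockP => i j.
case: eqVneq => [->|ij].
  rewrite (bigD1 (ordS j)) //= !eqxx !conform_mx_id big1 ?addr0 // => k /negbTE ->.
  by rewrite mul0mx.
rewrite big1 // => k _; case: eqP => [->|]; last by rewrite mul0mx.
by rewrite (inj_eq (@ordS_inj _)) (negbTE ij) mulmx0.
Qed.

Lemma mul_totXY q :
  totX q *m totY q = \mxdiag_i (conform_mx 0 (sphX q (ord_pred i) *m sphY q (ord_pred i))).
Proof.
rewrite mul_mxblock; apply/eq_mxblockP => i j.
case: eqVneq => [->|ij].
  (* With j written as a successor, [ordSK] makes the dimensions in [conform_mx] agree without
     transport along an equality of indices. *)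
  have [k ->] : exists k, j = ordS k by exists (ord_pred j); rewrite ord_predK.
  rewrite (bigD1 k) //= ordSK !eqxx !conform_mx_id big1 ?addr0 // => l lk.
  by rewrite (inj_eq (@ordS_inj _)) eq_sym (negbTE lk) mul0mx.
rewrite big1 // => k _; case: eqP => [ik|]; last by rewrite mul0mx.
by have /negbTE-> : j != ordS k by [rewrite -ik eq_sym]; rewrite mulmx0.
Qed.

Lemma mul_totvw q :
  totv q *m totw q = \mxdiag_i (if i == 0 then conform_mx 0 (sphv q *m sphw q) else 0).
Proof.
rewrite mul_mxcol_mxrow; apply/eq_mxblockP => i j.
case: (eqVneq i j) => [->|ij].
  by rewrite conform_mx_id; case: (eqVneq j 0) => [->|_]; rewrite ?conform_mx_id // mul0mx.
case: (eqVneq i 0) => [i0|_]; last by rewrite mul0mx.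
by case: (eqVneq j 0) => [j0|_]; [rewrite i0 j0 eqxx in ij | rewrite mulmx0].
Qed.

(** The equations at the m vertices are the diagonal blocks of this one; its other blocks vanish by
    the grading. *)
Lemma sph_varietyP q : sph_variety tau kappa q <->
  totY q *m totX q - totX q *m totY q - totv q *m totw q =
  \mxdiag_i (lambda tau kappa i)%:M.
Proof.
rewrite mul_totYX mul_totXY mul_totvw -!mxdiagB; exact: eq_mxdiagP.
Qed.

Lemma mxdiag_scalarE (l : 'I_n.+1 -> C) a b :
  (\mxdiag_i (l i)%:M : 'M[C]_V) a b = if a == b then l (deg a) else 0.
Proof.
set M := mxdiag _; pose Rk := @tagnat.Rank _ alpha.
have ea : a = Rk _ (tagnat.sig2 a) by rewrite [RHS]tagnat.sig2K.
have eb : b = Rk _ (tagnat.sig2 b) by rewrite [RHS]tagnat.sig2K.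
transitivity (submxblock M (deg a) (deg b) (tagnat.sig2 a) (tagnat.sig2 b)).
  by rewrite [RHS]mxE; congr (fun_of_matrix M _ _).
rewrite mxblockK.
have -> : (a == b) = (deg a == deg b) && (val (tagnat.sig2 a) == val (tagnat.sig2 b)).
  by rewrite [in LHS]ea [in LHS]eb -val_eqE; exact: tagnat.eq_Rank.
move: (tagnat.sig2 a) (tagnat.sig2 b); move: (deg a) (deg b) => i j k h.
case: (eqVneq i j) => [ij|_] /=; last by rewrite mxE.
by subst j; rewrite conform_mx_id mxE val_eqE; case: eqP.
Qed.

(** The flows are integrated for matrices on the whole of V; this leads back to quiver data. *)
Lemma sph_data_of_graded (X Y : 'M[C]_V) (v : 'M[C]_(V, d)) (w : 'M[C]_(d, V)) :
  (forall a b, X a b != 0 -> deg a = ordS (deg b)) ->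
  (forall a b, Y a b != 0 -> deg b = ordS (deg a)) ->
  (forall a j, v a j != 0 -> deg a = 0) ->
  (forall j a, w j a != 0 -> deg a = 0) ->
  exists q, [/\ totX q = X, totY q = Y, totv q = v & totw q = w].
Proof.
move=> hX hY hv hw.
exists (SphData (fun i => submxblock X (ordS i) i) (fun i => submxblock Y i (ordS i))
  (submxcol v 0) (submxrow w 0)); split.
- rewrite -[RHS]submxblockK; apply/eq_mxblock => i j.
  case: eqVneq => [->|ij]; first by rewrite conform_mx_id.
  apply/matrixP => k l; rewrite !mxE; apply/esym/eqP; apply: contra_neqT ij => /hX.
  by rewrite !tagnat.Rank1K.
- rewrite -[RHS]submxblockK; apply/eq_mxblock => i j.
  case: eqVneq => [->|ij]; first by rewrite conform_mx_id.
  apply/matrixP => k l; rewrite !mxE; apply/esym/eqP; apply: contra_neqT ij => /hY.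
  by rewrite !tagnat.Rank1K.
- rewrite -[RHS]submxcolK; apply/eq_mxcol => i.
  case: eqVneq => [->|i0]; first by rewrite conform_mx_id.
  apply/matrixP => k l; rewrite !mxE; apply/esym/eqP; apply: contra_neqT i0 => /hv.
  by rewrite !tagnat.Rank1K.
rewrite -[RHS]submxrowK; apply/eq_mxrow => i.
case: eqVneq => [->|i0]; first by rewrite conform_mx_id.
apply/matrixP => k l; rewrite !mxE; apply/esym/eqP; apply: contra_neqT i0 => /hw.
by rewrite !tagnat.Rank1K.
Qed.

(** A point of [Csph] is a whole orbit, so an initial representative is only known to be a gauge
    transform of a solution of the moment map equation. *)
Lemma gauge_variety q g : (forall i, g i \in unitmx) ->
  sph_variety tau kappa q -> sph_variety tau kappa (gauge g q).
Proof.
move=> hg hq i; have := congr1 (fun Z => g i *m Z *m invmx (g i)) (hq i).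
rewrite mul_mx_scalar -scalemxAl mulmxV // scalemx1 => <-.
rewrite !mulmxBr !mulmxBl /=; congr (_ - _ - _).
- by rewrite !mulmxA mulmxKV.
- have [k ->] : exists k, i = ordS k by exists (ord_pred i); rewrite ord_predK.
  by rewrite ordSK !conform_mx_id !mulmxA mulmxKV.
by case: eqVneq => [->|_]; rewrite ?conform_mx_id ?mulmx0 ?mul0mx // !mulmxA.
Qed.

End Grading.

(** * The dressing matrix and its inverse *)

Section DressingIdentities.
Variables (R : nzRingType) (m d : nat).
Variables (A A' B B' Pi : 'M[R]_m) (v : 'M[R]_(m, d)) (w : 'M[R]_(d, m)).
Hypotheses (AA' : A *m A' = 1%:M) (A'A : A' *m A = 1%:M).
Hypotheses (BB' : B *m B' = 1%:M) (B'B : B' *m B = 1%:M).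
Hypothesis moment_rel : (B *m A - A *m B) *m Pi = v *m w.
Hypothesis Pi_v : Pi *m v = v.
Hypotheses (ABPi : A *m B *m Pi = Pi *m A *m B) (BAPi : B *m A *m Pi = Pi *m B *m A).

Let M := 1%:M - w *m A' *m B' *m v.
Let M' := 1%:M + w *m B' *m A' *m v.

(** [Pi] commutes with A B, hence with the inverse B' A', and fixes v. *)
Lemma Pi_BAv : Pi *m B' *m A' *m v = B' *m A' *m v.
Proof.
have e : A *m B *m (Pi *m B' *m A') = Pi.
  by rewrite !mulmxA ABPi -!mulmxA (mulmxA B) BB' mul1mx AA' mulmx1.
have -> : Pi *m B' *m A' *m v = B' *m A' *m (A *m B *m (Pi *m B' *m A')) *m v.
  by rewrite -!mulmxA (mulmxA A' A) A'A mul1mx (mulmxA B' B) B'B mul1mx.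
by rewrite e -!mulmxA Pi_v.
Qed.

Lemma Pi_ABv : Pi *m A' *m B' *m v = A' *m B' *m v.
Proof.
have e : B *m A *m (Pi *m A' *m B') = Pi.
  by rewrite !mulmxA BAPi -!mulmxA (mulmxA A) AA' mul1mx BB' mulmx1.
have -> : Pi *m A' *m B' *m v = A' *m B' *m (B *m A *m (Pi *m A' *m B')) *m v.
  by rewrite -!mulmxA (mulmxA B' B) B'B mul1mx (mulmxA A' A) A'A mul1mx.
by rewrite e -!mulmxA Pi_v.
Qed.

(** The product v w inside is the commutator of B and A times [Pi], which B' A' v absorbs. Between
    A' B' and B' A' the commutator telescopes to B' A' - A' B', so M' exchanges the order of the two
    inverses. *)
Lemma ABv_M' : A' *m B' *m v *m M' = B' *m A' *m v.
Proof.
rewrite mulmxDr mulmx1 !mulmxA.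
have -> : A' *m B' *m v *m w *m B' *m A' *m v =
    A' *m B' *m (B *m A - A *m B) *m (Pi *m B' *m A' *m v).
  by rewrite !mulmxA -[_ *m v *m w]mulmxA -moment_rel !mulmxA.
rewrite Pi_BAv mulmxBr mulmxBl !mulmxA.
rewrite -[A' *m B' *m B]mulmxA B'B mulmx1 A'A mul1mx.
rewrite -[A' *m B' *m A *m B *m B']mulmxA BB' mulmx1.
by rewrite -[A' *m B' *m A *m A']mulmxA AA' mulmx1 addrC subrK.
Qed.

Lemma dressing_mulV : M *m M' = 1%:M.
Proof.
rewrite mulmxBl mul1mx.
have -> : w *m A' *m B' *m v *m M' = w *m (A' *m B' *m v *m M') by rewrite !mulmxA.
by rewrite ABv_M' /M' !mulmxA addrK.
Qed.

(** The same telescoping with the inverses in the other order; here it is B A that has to commute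
    with [Pi]. *)
Lemma dressing_mulVl : M' *m M = 1%:M.
Proof.
rewrite mulmxDl mul1mx mulmxBr mulmx1 !mulmxA.
have -> : w *m B' *m A' *m v *m w *m A' *m B' *m v =
    w *m B' *m A' *m (B *m A - A *m B) *m (Pi *m A' *m B' *m v).
  by rewrite !mulmxA -[_ *m v *m w]mulmxA -moment_rel !mulmxA.
rewrite Pi_ABv mulmxBr mulmxBl !mulmxA.
rewrite -[w *m B' *m A' *m B *m A *m A']mulmxA AA' mulmx1.
rewrite -[w *m B' *m A' *m B *m B']mulmxA BB' mulmx1.
rewrite -[w *m B' *m A' *m A]mulmxA A'A mulmx1 -[w *m B' *m B]mulmxA B'B mulmx1.
by rewrite subKr /M subrK.
Qed.

(** [yN] and [yNm] stand for the scalar matrices y^N of the two sizes, [YN] for Y^N, [S] for the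
    quotient of Y^N - y^N by B, and [Xd] for the time derivative of X. *)
Variables (E yN : 'M[R]_d) (YN yNm S Xd Z : 'M[R]_m).
Hypotheses (v_yN : v *m yN = yNm *m v) (w_yN : w *m yNm = yN *m w) (E_yN : E *m yN = yN *m E).
Hypotheses (YN_BS : YN - yNm = B *m S) (YN_SB : YN - yNm = S *m B).
Hypothesis Xd_rel : Xd *m Pi + S *m v *m E *m w = Z *m B.

(** The Leibniz rule for M, with E w Y^N, - A' Xd A' and - Y^N v E as derivatives of w, A' and v,
    and with B' constant. *)
Let dM := - (E *m w *m YN *m A' *m B' *m v) + w *m A' *m Xd *m A' *m B' *m v
  + w *m A' *m B' *m YN *m v *m E.

(* When [v], [w], [E], [S], [A'] and [Z] have no negative powers of [y], neither does the right-hand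
   side, while [dM *m M'] has only negative ones: this computes the positive part of [L^N
     R_beta]. *)
Lemma dressing_flow : dM *m M' + M *m yN *m E *m M' =
  yN *m E + w *m A' *m S *m v *m E - E *m w *m S *m A' *m v + w *m A' *m Z *m A' *m v.
Proof.
(* Move y^N to the left of v and write it as Y^N - B S. The B meets B', leaving a term without B',
   while the Y^N term is the opposite of the last term of [dM]. *)
have hM : M *m yN *m E = yN *m E - w *m A' *m B' *m YN *m v *m E + w *m A' *m S *m v *m E.
  rewrite mulmxBl mul1mx mulmxBl -addrA; congr (_ + _).
  rewrite -[_ *m v *m yN]mulmxA v_yN mulmxA -[yNm](subKr YN) YN_BS mulmxBr !mulmxA.
  by rewrite -[w *m A' *m B' *m B]mulmxA B'B mulmx1 !mulmxBl opprB addrC.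
rewrite -mulmxDl hM.
rewrite (_ : dM + _ = yN *m E - E *m w *m YN *m (A' *m B' *m v)
   + w *m A' *m Xd *m (A' *m B' *m v) + w *m A' *m S *m v *m E); last first.
  rewrite /dM !mulmxA; move: (w *m A' *m B' *m YN *m v *m E) (yN *m E) (E *m w *m YN *m A' *m B'
    *m v)
   (w *m A' *m Xd *m A' *m B' *m v) (w *m A' *m S *m v *m E) => a1 a2 a3 a4 a5.
  rewrite [a2 - a1]addrC 2!addrA addrK; congr (_ + a5).
  by rewrite addrAC [- a3 + _]addrC.
have assoc3 (T : 'M[R]_(d, m)) : T *m (A' *m B' *m v) *m M' = T *m (B' *m A' *m v).
  by rewrite -mulmxA ABv_M'.
rewrite !mulmxDl mulNmx !assoc3.
(* Here y^N stands to the right of w and is written as Y^N - S B, so that B meets the B' following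
   it. *)
have -> : yN *m E *m M' = yN *m E + E *m w *m YN *m (B' *m A' *m v) - E *m w *m S *m A' *m v.
  rewrite mulmxDr mulmx1 !mulmxA -addrA; congr (_ + _).
  rewrite -E_yN -[E *m yN *m w]mulmxA -w_yN -[yNm](subKr YN) YN_SB !mulmxA.
  rewrite mulmxBr !mulmxBl !mulmxA; congr (_ - _).
  by rewrite -[E *m w *m S *m B *m B']mulmxA BB' mulmx1.
have -> : w *m A' *m S *m v *m E *m M' = w *m A' *m S *m v *m E
   + w *m A' *m S *m v *m E *m w *m (B' *m A' *m v).
  by rewrite mulmxDr mulmx1 !mulmxA.
(* Writing B' A' v as Pi B' A' v makes [Xd_rel] applicable; the B on its right-hand side then
   cancels B'. *)
have <- : w *m A' *m Xd *m (B' *m A' *m v) + w *m A' *m S *m v *m E *m w *m (B' *m A' *m v)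
   = w *m A' *m Z *m A' *m v.
  rewrite -{1}Pi_BAv.
  have -> : w *m A' *m Z *m A' *m v = w *m A' *m (Z *m B) *m (B' *m A' *m v).
    by rewrite !mulmxA -[w *m A' *m Z *m B *m B']mulmxA BB' mulmx1.
  by rewrite -Xd_rel mulmxDr mulmxDl !mulmxA.
set b := B' *m A' *m v; move: (w *m A' *m Xd *m b)
  (w *m A' *m S *m v *m E) (E *m w *m S *m A' *m v) (E *m w *m YN *m b) (yN *m E).
move=> a1 a3 a4 a5 a6; move: (a3 *m w *m b) => a2.
by rewrite (addrAC _ (- a4)) addrK addrACA (addrAC a6).
Qed.

End DressingIdentities.

(** * Degree bounds for matrices of series *)

Section SeriesMatrices.
Variables (A : nzRingType) (td : twisted_derivation A).
Local Notation P := (Defs.pseries td).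

Lemma pcoef_sum (I : Type) (r : seq I) (Q : pred I) (u : I -> P) k :
  (\sum_(i <- r | Q i) u i) k = \sum_(i <- r | Q i) u i k.
Proof. by elim/big_rec2: _ => // i a v _ <-. Qed.

Definition mxdeg_le a b (N : int) (M : 'M[P]_(a, b)) : Prop :=
  forall i j (k : int), N < k -> M i j k = 0.

Definition mxnonneg a b (M : 'M[P]_(a, b)) : Prop := forall i j, pnonneg (M i j).

Lemma mxdeg_le_mul a b c N N' (M : 'M[P]_(a, b)) (M' : 'M[P]_(b, c)) :
  mxdeg_le N M -> mxdeg_le N' M' -> mxdeg_le (N + N') (M *m M').
Proof.
move=> h h' i j k hk; rewrite mxE pcoef_sum big1 // => l _.
by rewrite pcoefM (pmul_bound (h i l) (h' l j)).
Qed.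

Lemma mxdeg_leD a b N (M M' : 'M[P]_(a, b)) :
  mxdeg_le N M -> mxdeg_le N M' -> mxdeg_le N (M + M').
Proof. by move=> h h' i j k hk; rewrite mxE pcoefD h ?h' ?addr0. Qed.

Lemma mxdeg_leN a b N (M : 'M[P]_(a, b)) : mxdeg_le N M -> mxdeg_le N (- M).
Proof. by move=> h i j k hk; rewrite mxE /= h ?oppr0. Qed.

Lemma mxdeg_leW a b N N' (M : 'M[P]_(a, b)) : N <= N' -> mxdeg_le N M -> mxdeg_le N' M.
Proof. by move=> NN' h i j k hk; rewrite h //; lia. Qed.

Lemma mxdeg_le_scalar a N (u : P) : (forall k, N < k -> u k = 0) -> mxdeg_le N (u%:M : 'M[P]_a).
Proof.
move=> h i j k hk; rewrite mxE; case: (i == j); last by rewrite mulr0n.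
by rewrite mulr1n h.
Qed.

Lemma mxdeg_le_mxser a b N (f : nat -> 'M[A]_(a, b)) : mxdeg_le N (mxser td N f).
Proof. by move=> i j k hk; rewrite mxE /= leNgt hk. Qed.

Lemma mxdeg_le_ser a b N (M : 'M[P]_(a, b)) : mxdeg_le N M -> exists f, M = mxser td N f.
Proof.
move=> h; exists (fun k => \matrix_(i, j) M i j (N - k%:Z)).
apply/matrixP => i j; rewrite mxE; apply: pseriesP => k /=.
case: leP => [hk|/h //]; rewrite mxE; congr (pcoef _ _); lia.
Qed.

Lemma mxnonneg_mul a b c (M : 'M[P]_(a, b)) (M' : 'M[P]_(b, c)) :
  mxnonneg M -> mxnonneg M' -> mxnonneg (M *m M').
Proof.
by move=> h h' i j; rewrite mxE; apply: pnonneg_sum => l _; exact: pnonnegM.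
Qed.

Lemma mxnonnegD a b (M M' : 'M[P]_(a, b)) : mxnonneg M -> mxnonneg M' -> mxnonneg (M + M').
Proof. by move=> h h' i j; rewrite mxE; exact: pnonnegD. Qed.

Lemma mxnonnegN a b (M : 'M[P]_(a, b)) : mxnonneg M -> mxnonneg (- M).
Proof. by move=> h i j; rewrite mxE; exact: pnonnegN. Qed.

Lemma mxnonneg_sum (I : Type) (r : seq I) (Q : pred I) a b (M : I -> 'M[P]_(a, b)) :
  (forall i, Q i -> mxnonneg (M i)) -> mxnonneg (\sum_(i <- r | Q i) M i).
Proof.
move=> h; elim/big_rec: _ => [i j|i N Qi hN]; first by rewrite mxE.
by apply: mxnonnegD => //; exact: h.
Qed.

Lemma mxnonneg_scalar a (u : P) : pnonneg u -> mxnonneg (u%:M : 'M[P]_a).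
Proof.
move=> h i j; rewrite mxE; case: (i == j); last by rewrite mulr0n.
by rewrite mulr1n.
Qed.

Lemma map_ppos_decomp a b (M N Q : 'M[P]_(a, b)) : M = N - Q -> mxnonneg N ->
  mxdeg_le (-1) Q -> map_mx (@ppos _ _) M = N.
Proof.
move=> -> hN hQ; apply/matrixP => i j; rewrite 3!mxE.
exact: ppos_decomp (hN i j) (hQ i j).
Qed.

End SeriesMatrices.

Lemma mx_pcoefB (A : nzRingType) (td : twisted_derivation A) a b (M N : 'M[Defs.pseries td]_(a,
  b)) i j k :
  (M - N) i j k = M i j k - N i j k.
Proof. by rewrite !mxE. Qed.

(** P is not commutative: scalar matrices on the right and on the left act differently, and both
    kinds of product occur. *)
Lemma mul_mx_scalarE (R : nzRingType) a b (M : 'M[R]_(a, b)) (c : R) i j :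
  (M *m c%:M) i j = M i j * c.
Proof.
rewrite mxE (bigD1 j) //= big1 ?addr0 => [|k kj]; rewrite mxE ?eqxx ?mulr1n //.
by rewrite (negbTE kj) mulr0n mulr0.
Qed.

Lemma mul_scalar_mxE (R : nzRingType) a b (M : 'M[R]_(a, b)) (c : R) i j :
  (c%:M *m M) i j = c * M i j.
Proof. by rewrite mul_scalar_mx mxE. Qed.

(** * The dressing matrix over P as an instance of the abstract identities *)

Section Dressing.
Variables (C : numClosedFieldType) (n d : nat) (mu : C).
Variable hmu : n.+1.-primitive_root mu.
Variables (tau : C) (kappa : 'I_n.+1 -> C) (alpha : 'I_n.+1 -> nat).
Local Notation A := (crossed hmu).
Local Notation K := {fraction {poly C}}.
Local Notation td := (dunkl_td hmu tau kappa).
Local Notation P := (Defs.pseries td).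
Local Notation V := (\sum_(i < n.+1) alpha i)%N.
Local Notation deg := (@tagnat.sig1 n.+1 alpha).
Local Notation cP := (constP hmu tau kappa).
Local Notation rP := (Defs.ratP hmu tau kappa).
Local Notation y := (yP hmu tau kappa).
Local Notation e := (epsP hmu tau kappa).
Local Notation x := (rP (ratX C)).

Lemma map_constP_scalar a b (M : 'M[C]_(a, b)) (u : P) :
  map_mx cP M *m u%:M = u%:M *m map_mx cP M.
Proof.
by apply/matrixP => i j; rewrite mul_mx_scalarE mul_scalar_mxE mxE constP_comm.
Qed.

Lemma yX_epsP k i : y ^+ k * e i = e (iter k (@ordS _) i) * y ^+ k.
Proof.
elim: k i => [|k IH] i; first by rewrite mulr1 mul1r.
by rewrite exprS -mulrA IH mulrA y_epsP -mulrA.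
Qed.

Lemma val_iter_ordS k (i : 'I_n.+1) : iter k (@ordS _) i = ((i + k) %% n.+1)%N :> nat.
Proof.
elim: k => [|k IH] /=; first by rewrite addn0 modn_small.
by rewrite IH addnS -addn1 modnDml addn1.
Qed.

(** Each y raises the index of the idempotent by one modulo m; this is where exponents divisible by
    m are required. *)
Lemma yX_epsP0 j : y ^+ (n.+1 * j) * e 0 = e 0 * y ^+ (n.+1 * j).
Proof.
have h : iter (n.+1 * j) (@ordS n.+1) 0 = 0.
  by apply/ord_inj; rewrite val_iter_ordS add0n modnMr.
by rewrite yX_epsP h.
Qed.

(* [gradmx f] is [\sum_i eps_(f i) \otimes 1_(V_i)]. *)
Definition gradmx (f : 'I_n.+1 -> 'I_n.+1) : 'M[P]_V :=
  \matrix_(a, b) (if a == b then e (f (deg a)) else 0).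

Lemma gradmxE f : gradmx f = diag_mx (\row_a e (f (deg a))).
Proof. by apply/matrixP => a b; rewrite !mxE; case: eqP => [->|_]; rewrite ?mulr1n ?mulr0n. Qed.

Lemma mul_gradmxl a (f : 'I_n.+1 -> 'I_n.+1) (M : 'M[P]_(V, a)) i j :
  (gradmx f *m M) i j = e (f (deg i)) * M i j.
Proof. by rewrite gradmxE mul_diag_mx !mxE. Qed.

Lemma mul_gradmxr a (f : 'I_n.+1 -> 'I_n.+1) (M : 'M[P]_(a, V)) i j :
  (M *m gradmx f) i j = M i j * e (f (deg j)).
Proof. by rewrite gradmxE mul_mx_diag !mxE. Qed.

Section Point.
Variable q : sph_data C d alpha.

Let X := map_mx cP (totX q).
Let Y := map_mx cP (totY q).
Let v := map_mx cP (totv q).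
Let w := map_mx cP (totw q).

Definition Xx : 'M[P]_V := X - x%:M.
Definition Yy : 'M[P]_V := Y - y%:M.
Definition iXx : 'M[P]_V := map_mx rP (invXx q).
Definition iYy : 'M[P]_V := invYy hmu tau kappa q.
(** Absorbing the two outer factors [eps 0] into v and w gives M the shape treated by the abstract
    identities. *)
Definition vhat : 'M[P]_(V, d) := v *m (e 0)%:M.
Definition what : 'M[P]_(d, V) := (e 0)%:M *m w.

Lemma dressingE : dressing hmu tau kappa q = 1%:M - what *m iXx *m iYy *m vhat.
Proof. by rewrite /what /vhat /v /w /iXx /iYy /dressing !mulmxA. Qed.

(** Up to sign this is the characteristic matrix of X, whose determinant is monic and hence nonzero
    in C(x). *)
Lemma invXx_unit : map_mx (@ratC C) (totX q) - (ratX C)%:M \in unitmx.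
Proof.
rewrite unitmxE unitfE.
have -> : map_mx (@ratC C) (totX q) - (ratX C)%:M =
   map_mx (@FracField.tofrac {poly C}) (- char_poly_mx (totX q)).
  by apply/matrixP => i j; rewrite !mxE opprB rmorphB rmorphMn.
rewrite det_map_mx tofrac_eq0 -scaleN1r detZ mulf_neq0 ?expf_neq0 ?oppr_eq0 ?oner_neq0 //.
exact/monic_neq0/char_poly_monic.
Qed.

Lemma XxE : Xx = map_mx rP (map_mx (@ratC C) (totX q) - (ratX C)%:M).
Proof. by apply/matrixP => i j; rewrite !mxE rmorphB rmorphMn. Qed.

Lemma Xx_iXx : Xx *m iXx = 1%:M.
Proof. by rewrite XxE -map_mxM mulmxV ?invXx_unit // map_mx1. Qed.

Lemma iXx_Xx : iXx *m Xx = 1%:M.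
Proof. by rewrite XxE -map_mxM mulVmx ?invXx_unit // map_mx1. Qed.

Lemma iYyE i j (k : int) : iYy i j k =
  if k <= -1 then - crossedC hmu (ratC ((totY q ^+ absz (-1 - k)%R) i j)) else 0.
Proof. by rewrite !mxE /=; case: ifP => _; rewrite ?oppr0 // mxE. Qed.

Lemma crossedC_ratC_sum (I : finType) (G : I -> C) :
  crossedC hmu (ratC (\sum_i G i)) = \sum_i crossedC hmu (ratC (G i)).
Proof. by rewrite ratC_sum crossedC_sum. Qed.

Lemma Y_iYyE i j (k : int) : (Y *m iYy) i j k =
  if k <= -1 then - crossedC hmu (ratC ((totY q ^+ (absz (-1 - k)%R).+1) i j)) else 0.
Proof.
rewrite mxE pcoef_sum; case: ifP => hk; last first.
  rewrite big1 // => l _; rewrite mxE pcoefM pmul_mono [ypow _ _ _]/=.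
  by rewrite iYyE hk mulr0.
rewrite exprS mxE crossedC_ratC_sum -sumrN; apply: eq_bigr => l _.
by rewrite mxE pcoefM pmul_mono [ypow _ _ _]/= iYyE hk mulrN ratCM crossedCM.
Qed.

Lemma iYy_Y : iYy *m Y = Y *m iYy.
Proof.
apply/matrixP => i j; apply: pseriesP => k; rewrite Y_iYyE mxE pcoef_sum.
case: ifP => hk.
  rewrite exprSr mxE crossedC_ratC_sum -sumrN; apply: eq_bigr => l _.
  rewrite [Y _ _]mxE -constP_comm pcoefM pmul_mono [ypow _ _ _]/= iYyE hk mulrN.
  by rewrite -crossedC_ratC_comm ratCM crossedCM crossedC_ratC_comm.
rewrite big1 // => l _; rewrite [Y _ _]mxE -constP_comm pcoefM pmul_mono [ypow _ _ _]/=.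
by rewrite iYyE hk mulr0.
Qed.

(** The coefficients of (Y - y)^-1 are complex constants, which y neither twists nor
    differentiates. *)
Lemma iYy_y : iYy *m y%:M = y%:M *m iYy.
Proof.
apply/matrixP => i j; rewrite mul_mx_scalarE mul_scalar_mxE; apply: pseriesP => k.
have hth : td_thetaV td (iYy i j (k - 1)) = iYy i j (k - 1).
  by rewrite iYyE; case: ifP => _; [rewrite -crossedCN thetaV_crossedC | exact: raddf0].
have hD : td_D td (iYy i j k) = 0.
  by rewrite iYyE; case: ifP => _; [rewrite -crossedCN -ratCN dunklD_ratC | exact: raddf0].
by move: (iYy i j) hth hD => u hth hD; rewrite [RHS]ymulE mulyE hth hD addr0.
Qed.

Lemma mx1_pcoef (i j : 'I_V) k : (1%:M : 'M[P]_V) i j k =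
  if k == 0 then crossedC hmu (ratC ((1%:M : 'M[C]_V) i j)) else 0.
Proof.
rewrite ![1%:M _ _]mxE; case: (i == j); rewrite ?mulr1n ?mulr0n ?ratC1 ?ratC0 //.
by rewrite [crossedC hmu 0](_ : _ = 0) ?if_same //; apply/ffunP => r; rewrite !ffunE if_same.
Qed.

Lemma Yy_iYy : Yy *m iYy = 1%:M.
Proof.
rewrite mulmxBl -iYy_y; apply/matrixP => i j; apply: pseriesP => k.
rewrite mx_pcoefB Y_iYyE (mul_mx_scalarE iYy) mulyE iYyE mx1_pcoef.
(* For k <= -1 both terms equal - Y^(-k) and cancel. For k = 0 only the term shifted by y is
   present, and it gives 1. *)
have [k0|k0] := leP k (-1).
  rewrite ifT; last by lia.
  rewrite ifF; last by apply/eqP; lia.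
  by rewrite (_ : absz (-1 - (k - 1))%R = (absz (-1 - k)%R).+1) ?subrr //; lia.
case: eqP => [->|kn0]; first by rewrite /= opprK add0r.
by rewrite ifF ?subrr //; lia.
Qed.

Lemma iYy_Yy : iYy *m Yy = 1%:M.
Proof. by rewrite mulmxBr iYy_y iYy_Y -mulmxBl Yy_iYy. Qed.

Lemma Xx_ij a b : Xx a b = cP (totX q a b) - x *+ (a == b).
Proof. by rewrite /Xx /X; move: (totX q) => T; rewrite !mxE. Qed.

Lemma Yy_ij a b : Yy a b = cP (totY q a b) - y *+ (a == b).
Proof. by rewrite /Yy /Y; move: (totY q) => T; rewrite !mxE. Qed.

(** Both parts of X - x shift alike: X moves the degree in V by one, and x moves the index of the
    idempotent by one. That [f] commutes with [ordS] makes the two shifts agree. *)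
Lemma Xx_gradmx f g : (forall i, f (ordS i) = ordS (f i)) -> (forall i, f i = ordS (g i)) ->
  Xx *m gradmx f = gradmx g *m Xx.
Proof.
move=> fS fg; apply/matrixP => a b; rewrite mul_gradmxl mul_gradmxr Xx_ij mulrBl mulrBr.
rewrite constP_comm; congr (_ - _).
  have [->|/totX_graded h] := eqVneq (totX q a b) 0; first by rewrite !rmorph0 !mulr0.
  have -> // : f (deg b) = g (deg a) by apply: (@ordS_inj n.+1); rewrite -fg h fS.
case: (eqVneq a b) => [->|_]; last by rewrite mulr0n mulr0 mul0r.
by rewrite mulr1n epsP_x fg.
Qed.

Lemma Yy_gradmx f g : (forall i, f (ordS i) = ordS (f i)) -> (forall i, g i = ordS (f i)) ->
  Yy *m gradmx f = gradmx g *m Yy.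
Proof.
move=> fS gf; apply/matrixP => a b; rewrite mul_gradmxl mul_gradmxr Yy_ij mulrBl mulrBr.
rewrite constP_comm; congr (_ - _).
  have [->|/totY_graded h] := eqVneq (totY q a b) 0; first by rewrite !rmorph0 !mulr0.
  have -> // : f (deg b) = g (deg a) by rewrite gf h fS.
case: (eqVneq a b) => [->|_]; last by rewrite mulr0n mulr0 mul0r.
by rewrite mulr1n y_epsP gf.
Qed.

Let Pi := gradmx id.

(** Passing Y - y raises the indices of the idempotents by one, and passing X - x lowers them
    again. *)
Lemma XYPi : Xx *m Yy *m Pi = Pi *m Xx *m Yy.
Proof.
rewrite -mulmxA (@Yy_gradmx id (@ordS _)) // mulmxA (@Xx_gradmx (@ordS _) id) //.
Qed.

Lemma YXPi : Yy *m Xx *m Pi = Pi *m Yy *m Xx.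
Proof.
rewrite -mulmxA (@Xx_gradmx id (@ord_pred _)) //; last by move=> i; rewrite ord_predK.
rewrite mulmxA (@Yy_gradmx (@ord_pred _) id) // => i; rewrite ?ordSK ?ord_predK //.
Qed.

Lemma epsP_idem i : e i * e i = e i.
Proof. by rewrite epsP_mul eqxx. Qed.

Lemma Pi_vhat : Pi *m vhat = vhat.
Proof.
apply/matrixP => a b; rewrite mul_gradmxl !mul_mx_scalarE mxE.
have [->|/totv_graded h] := eqVneq (totv q a b) 0; first by rewrite rmorph0 mul0r mulr0.
by rewrite h constP_comm mulrA epsP_idem.
Qed.

(** w vanishes off V_0, where [Pi] is eps_0; the eps_0 between v and w can therefore be carried to
    the right as [Pi]. *)
Lemma vhat_what : vhat *m what = map_mx cP (totv q *m totw q) *m Pi.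
Proof.
rewrite /vhat /what !mulmxA -[_ *m _%:M *m _%:M]mulmxA -scalar_mxM epsP_idem.
apply/matrixP => a b; rewrite mul_gradmxr -mulmxA -map_constP_scalar mulmxA -map_mxM.
rewrite mul_mx_scalarE.
have [h|h] := eqVneq ((totv q *m totw q) a b) 0; first by rewrite mxE h rmorph0 !mul0r.
suff -> : deg b = 0 by [].
apply/eqP; apply: contra_neqT h => h; rewrite mxE big1 // => l _.
have [->|/totw_graded hw] := eqVneq (totw q l b) 0; first by rewrite mulr0.
by rewrite hw eqxx in h.
Qed.

Hypothesis hq : sph_variety tau kappa q.

(** Mixed terms cancel since constants commute with x and y, leaving [Y, X] - [x, y]. The lambda_i
    of the moment map equation are cancelled by those of [x, y] on eps_i. *)
Lemma YyXx_rel : (Yy *m Xx - Xx *m Yy) *m Pi = vhat *m what.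
Proof.
have -> : Yy *m Xx - Xx *m Yy =
    map_mx cP (totY q *m totX q - totX q *m totY q) - (x * y - y * x)%:M.
  have zid (Z : zmodType) (a b c f g h : Z) :
      a - b - (c - g) - (f - c - (b - h)) = a - f - (h - g).
    by rewrite !opprB addrACA !subrKA [LHS]addrACA [RHS]addrACA [- h - f]addrC.
  have mid (a b c f : 'M[P]_V) : (a - b) *m (c - f) = a *m c - a *m f - (b *m c - b *m f).
    by rewrite mulmxBl !mulmxBr.
  have -> : Yy *m Xx = Y *m X - Y *m x%:M - (y%:M *m X - y%:M *m x%:M) by exact: mid.
  have -> : Xx *m Yy = X *m Y - X *m y%:M - (x%:M *m Y - x%:M *m y%:M) by exact: mid.
  rewrite -(map_constP_scalar (totX q)) -(map_constP_scalar (totY q)) zid.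
  have -> : (x * y - y * x)%:M = (x * y)%:M - (y * x)%:M :> 'M[P]_V by exact: raddfB.
  by rewrite map_mxB !map_mxM -!scalar_mxM.
have hL : totY q *m totX q - totX q *m totY q =
    totv q *m totw q + \mxdiag_i (lambda tau kappa i)%:M.
  by move/sph_varietyP: hq => <-; rewrite [RHS]addrC subrK.
rewrite hL vhat_what map_mxD mulmxBl mulmxDl -addrA -[RHS]addr0; congr (_ + _).
apply/matrixP => a b; rewrite mxE [X in _ + X]mxE !mul_gradmxr.
have -> : map_mx cP (\mxdiag_i (lambda tau kappa i)%:M : 'M[C]_V) a b =
   if a == b then cP (lambda tau kappa (deg a)) else 0.
  by rewrite mxE mxdiag_scalarE; case: ifP => _; rewrite ?rmorph0.
rewrite [_%:M _ _]mxE [RHS]mxE; case: (eqVneq a b) => [->|_]; last by rewrite mulr0n !mul0r subr0.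
by rewrite mulr1n xy_epsP subrr.
Qed.

Definition dressinginv : 'M[P]_d := 1%:M + what *m iYy *m iXx *m vhat.

Lemma mx_inverse_dressinginv : mx_inverse (dressing hmu tau kappa q) dressinginv.
Proof.
rewrite /mx_inverse dressingE; split.
  exact: (dressing_mulV Xx_iXx iXx_Xx Yy_iYy iYy_Yy YyXx_rel Pi_vhat XYPi).
exact: (dressing_mulVl Xx_iXx iXx_Xx Yy_iYy iYy_Yy YyXx_rel Pi_vhat YXPi).
Qed.

Lemma dressingV_unique N : mx_inverse (dressing hmu tau kappa q) N -> N = dressinginv.
Proof.
move=> [_ h]; have [h' _] := mx_inverse_dressinginv.
by rewrite -[LHS]mulmx1 -h' mulmxA h mul1mx.
Qed.

(** [dressingV] is some chosen inverse; two-sided inverses being unique, it is the explicit one. *)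
Lemma dressingVE : dressingV hmu tau kappa q = dressinginv.
Proof.
apply: dressingV_unique; rewrite /dressingV.
exact: (xgetPex 0 (ex_intro _ _ mx_inverse_dressinginv)).
Qed.

Lemma mx_inverse_dressingV : mx_inverse (dressing hmu tau kappa q) (dressingV hmu tau kappa q).
Proof. by rewrite dressingVE; exact: mx_inverse_dressinginv. Qed.

End Point.
End Dressing.

(** * The Lax pair *)

Section LaxPair.
Variables (C : numClosedFieldType) (n d : nat) (mu : C).
Variable hmu : n.+1.-primitive_root mu.
Variables (tau : C) (kappa : 'I_n.+1 -> C) (alpha : 'I_n.+1 -> nat).
Local Notation A := (crossed hmu).
Local Notation K := {fraction {poly C}}.
Local Notation td := (dunkl_td hmu tau kappa).
Local Notation P := (Defs.pseries td).
Local Notation V := (\sum_(i < n.+1) alpha i)%N.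
Local Notation deg := (@tagnat.sig1 n.+1 alpha).
Local Notation cP := (constP hmu tau kappa).
Local Notation rP := (Defs.ratP hmu tau kappa).
Local Notation y := (yP hmu tau kappa).
Local Notation e := (epsP hmu tau kappa).
Local Notation iXx := (iXx hmu tau kappa).
Local Notation iYy := (iYy hmu tau kappa).
Local Notation Xx := (Xx hmu tau kappa).
Local Notation Yy := (Yy hmu tau kappa).
Local Notation vhat := (vhat hmu tau kappa).
Local Notation what := (what hmu tau kappa).
Local Notation dressinginv := (dressinginv hmu tau kappa).
Local Notation dressing := (dressing hmu tau kappa).
Local Notation dressingV := (dressingV hmu tau kappa).

Lemma delta_scalar_comm a (b : 'I_a) (u : P) :
  delta_mx b b *m u%:M = u%:M *m delta_mx b b :> 'M[P]_a.
Proof.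
by apply/matrixP => i j; rewrite mul_mx_scalarE mul_scalar_mxE mxE commr_nat.
Qed.

Lemma scalar_mxX a (u : P) k : (u%:M : 'M[P]_a) ^+ k = (u ^+ k)%:M.
Proof.
by elim: k => [|k IH]; rewrite ?expr0 // !exprS IH -mulmxE -scalar_mxM.
Qed.

Lemma mxdeg_le_crossedP a b (M : 'M[P]_(a, b)) (f : 'I_a -> 'I_b -> A) :
  (forall i j, M i j = crossedP tau kappa (f i j)) -> mxdeg_le 0 M.
Proof. by move=> h i j k hk; rewrite h /= gt_eqF. Qed.

Lemma mxdeg_le_constP a b (M : 'M[C]_(a, b)) : mxdeg_le 0 (map_mx cP M).
Proof. by apply: mxdeg_le_crossedP => i j; rewrite mxE. Qed.

Lemma mxdeg_le_ratP a b (M : 'M[K]_(a, b)) : mxdeg_le 0 (map_mx rP M).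
Proof. by apply: mxdeg_le_crossedP => i j; rewrite mxE. Qed.

Lemma mxdeg_le_epsP a i : mxdeg_le 0 ((e i)%:M : 'M[P]_a).
Proof. by apply: mxdeg_le_scalar => k hk /=; rewrite gt_eqF. Qed.

Lemma mxdeg_le_yP a : mxdeg_le 1 (y%:M : 'M[P]_a).
Proof. by apply: mxdeg_le_scalar => k hk /=; rewrite gt_eqF. Qed.

Lemma mxdeg_le_delta a b : mxdeg_le 0 (delta_mx b b : 'M[P]_a).
Proof. by rewrite -(map_delta_mx cP); exact: mxdeg_le_constP. Qed.

Lemma mxnonneg_constP a b (M : 'M[C]_(a, b)) : mxnonneg (map_mx cP M).
Proof. by move=> i j; rewrite mxE; exact: pnonneg_crossedP. Qed.

Lemma mxnonneg_ratP a b (M : 'M[K]_(a, b)) : mxnonneg (map_mx rP M).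
Proof. by move=> i j; rewrite mxE; exact: pnonneg_crossedP. Qed.

Section Static.
Variable q : sph_data C d alpha.

Lemma mxdeg_le_iYy : mxdeg_le (-1) (iYy q).
Proof. by apply: mxdeg_leN; exact: mxdeg_le_mxser. Qed.

Lemma mxdeg_le_what : mxdeg_le 0 (what q).
Proof. by apply: (@mxdeg_le_mul _ _ _ _ _ 0 0); [exact: mxdeg_le_epsP | exact: mxdeg_le_constP].
  Qed.

Lemma mxdeg_le_vhat : mxdeg_le 0 (vhat q).
Proof. by apply: (@mxdeg_le_mul _ _ _ _ _ 0 0); [exact: mxdeg_le_constP | exact: mxdeg_le_epsP].
  Qed.

Lemma mxdeg_le_iXx : mxdeg_le 0 (iXx q). Proof. exact: mxdeg_le_ratP. Qed.

Lemma mxdeg_le_dressing_part : mxdeg_le (-1) (what q *m iXx q *m iYy q *m vhat q).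
Proof.
apply: (@mxdeg_le_mul _ _ _ _ _ (-1) 0); last exact: mxdeg_le_vhat.
apply: (@mxdeg_le_mul _ _ _ _ _ 0 (-1)); last exact: mxdeg_le_iYy.
by apply: (@mxdeg_le_mul _ _ _ _ _ 0 0); [exact: mxdeg_le_what | exact: mxdeg_le_iXx].
Qed.

Lemma mxdeg_le_dressinginv_part : mxdeg_le (-1) (what q *m iYy q *m iXx q *m vhat q).
Proof.
apply: (@mxdeg_le_mul _ _ _ _ _ (-1) 0); last exact: mxdeg_le_vhat.
apply: (@mxdeg_le_mul _ _ _ _ _ (-1) 0); last exact: mxdeg_le_iXx.
by apply: (@mxdeg_le_mul _ _ _ _ _ 0 (-1)); [exact: mxdeg_le_what | exact: mxdeg_le_iYy].
Qed.

Lemma mxdeg_le1 a : mxdeg_le 0 (1%:M : 'M[P]_a).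
Proof. by apply: mxdeg_le_scalar => k hk /=; rewrite gt_eqF. Qed.

Lemma mxdeg_le_dressinginv : mxdeg_le 0 (dressinginv q).
Proof.
apply: mxdeg_leD; first exact: mxdeg_le1.
exact/(mxdeg_leW _ mxdeg_le_dressinginv_part).
Qed.

Lemma whatE : what q = (e 0)%:M *m map_mx cP (totw q). Proof. by []. Qed.

Lemma vhatE : vhat q = map_mx cP (totv q) *m (e 0)%:M. Proof. by []. Qed.

Lemma epsP_what i : (e i)%:M *m what q = if i == 0 then what q else 0.
Proof.
rewrite /what mulmxA -scalar_mxM epsP_mul; case: ifP => // _.
by rewrite raddf0 mul0mx.
Qed.

Lemma vhat_epsP i : vhat q *m (e i)%:M = if i == 0 then vhat q else 0.
Proof.
rewrite /vhat -mulmxA -scalar_mxM epsP_mul eq_sym; case: eqP => [->//|_].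
by rewrite raddf0 mulmx0.
Qed.

End Static.

Section Static.
Variable q : sph_data C d alpha.

Lemma dressing_epsP i : (e i)%:M *m dressing q = dressing q *m (e i)%:M.
Proof.
rewrite dressingE; have := epsP_what q i; have := vhat_epsP q i.
move: (what q) (vhat q) (iXx q) (iYy q) => w v A' B' hv hw.
rewrite mulmxBr mulmxBl mulmx1 mul1mx !mulmxA hw -(mulmxA _ v) hv.
by case: ifP => // _; rewrite !mul0mx mulmx0.
Qed.

Hypothesis hq : sph_variety tau kappa q.
Let M := dressing q.
Let N := dressingV q.
Let MN : M *m N = 1%:M. Proof. by case: (mx_inverse_dressingV hmu hq). Qed.
Let NM : N *m M = 1%:M. Proof. by case: (mx_inverse_dressingV hmu hq). Qed.

Lemma dressingV_epsP i : (e i)%:M *m N = N *m (e i)%:M.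
Proof.
transitivity (N *m ((e i)%:M *m M) *m N); last by rewrite -!mulmxA MN mulmx1.
by rewrite dressing_epsP !mulmxA NM mul1mx.
Qed.

Lemma mul_conj_dressing (S T : 'M[P]_d) : M *m S *m N *m (M *m T *m N) = M *m (S *m T) *m N.
Proof. by rewrite !mulmxA -[M *m S *m N *m M]mulmxA NM mulmx1. Qed.

Lemma laxL_exp k : laxL hmu tau kappa q ^+ k = M *m (y ^+ k)%:M *m N.
Proof.
elim: k => [|k IH]; first by rewrite !expr0 mulmx1 MN.
by rewrite exprS IH -mulmxE mul_conj_dressing -scalar_mxM exprS.
Qed.

(** The difference is [M, S] M^-1. The identity part of M drops out of the commutator, and the rest
    of M has order at most -1. The cases S = y and S = E_gamma give the leading terms of L and
    R_gamma. *)
Lemma conj_dressing_deg (k : int) (S : 'M[P]_d) : mxdeg_le k S ->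
  mxdeg_le (k - 1) (M *m S *m N - S).
Proof.
move=> hS; have -> : M *m S *m N - S = (M *m S - S *m M) *m N.
  by move: (M) (N) MN => M0 N0 h; rewrite mulmxBl -[S *m M0 *m N0]mulmxA h mulmx1.
rewrite -[k - 1]addr0; apply: mxdeg_le_mul; last first.
  by rewrite /N (dressingVE hmu hq); exact: mxdeg_le_dressinginv.
rewrite /M dressingE; move: (mxdeg_le_dressing_part q).
move: (what q *m iXx q *m iYy q *m vhat q) => W hW.
have -> : (1%:M - W) *m S - S *m (1%:M - W) = S *m W - W *m S.
  by rewrite mulmxBl mulmxBr mul1mx mulmx1 opprB addrC subrKA.
apply: mxdeg_leD; first exact: mxdeg_le_mul.
by apply: mxdeg_leN; rewrite [k - 1]addrC; exact: mxdeg_le_mul.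
Qed.

Lemma sph_lax_pair_dressing :
  sph_lax_pair (laxL hmu tau kappa q) (laxR hmu tau kappa q).
Proof.
split.
- have /mxdeg_le_ser [f hf] := conj_dressing_deg (mxdeg_le_yP (a:=d)).
  by exists f; rewrite -[0]/(1 - 1 : int) -hf addrC subrK.
- move=> g; have /mxdeg_le_ser [f hf] := conj_dressing_deg (mxdeg_le_delta g).
  by exists f; rewrite -[-1]/(0 - 1 : int) -hf addrC subrK.
- split.
  + move=> g; apply/eqP; rewrite subr_eq0; apply/eqP.
    rewrite [LHS](mul_conj_dressing y%:M (delta_mx g g)).
    by rewrite [RHS](mul_conj_dressing (delta_mx g g) y%:M) delta_scalar_comm.
  + move=> g b; rewrite [LHS](mul_conj_dressing (delta_mx g g) (delta_mx b b)) mul_delta_mx_cond.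
    by case: eqP => [->|_]; rewrite ?mulr1n // mulr0n mulmx0 mul0mx.
  rewrite /laxR -mulmx_suml -mulmx_sumr (_ : \sum_i _ = 1%:M) ?mulmx1 //.
  by rewrite mx1_sum_delta.
- move=> i; rewrite /laxL -/M -/N !mulmxA dressing_epsP -!mulmxA -dressingV_epsP.
  rewrite [(e i)%:M *m _]mulmxA [y%:M *m (_ *m N)]mulmxA -!scalar_mxM.
  by rewrite y_epsP ord_predK.
move=> i g; rewrite /laxR -/M -/N !mulmxA dressing_epsP -!mulmxA -dressingV_epsP.
by rewrite [(e i)%:M *m (_ *m N)]mulmxA [delta_mx _ _ *m (_ *m N)]mulmxA delta_scalar_comm.
Qed.

End Static.
End LaxPair.

(** * The Lax equations *)

Section RatMatrixDerive.
Variable C : numClosedFieldType.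
Local Notation K := {fraction {poly C}}.

Definition ex_rat_derive (f : C -> K) (t : C) := exists df, rat_is_derive f t df.

Lemma ex_rat_deriveM (f g : C -> K) t :
  ex_rat_derive f t -> ex_rat_derive g t -> ex_rat_derive (fun s => f s * g s) t.
Proof. by move=> [df hf] [dg hg]; exists (df * g t + f t * dg); exact: rat_is_deriveM. Qed.

Lemma ex_rat_derive_sum (I : Type) (r : seq I) (f : I -> C -> K) t :
  (forall i, ex_rat_derive (f i) t) -> ex_rat_derive (fun s => \sum_(i <- r) f i s) t.
Proof.
move=> /choice [df hf]; exists (\sum_(i <- r) df i).
by apply: rat_is_derive_sum => i _; exact: hf.
Qed.

Lemma ex_rat_derive_det k (F : C -> 'M[K]_k) t :
  (forall i j, ex_rat_derive (fun s => F s i j) t) -> ex_rat_derive (fun s => \det (F s)) t.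
Proof.
move=> h; rewrite /determinant; apply: ex_rat_derive_sum => s.
apply: ex_rat_deriveM; first by exists 0; exact: rat_is_derive_cst.
by apply: rat_is_derive_prod => i; exact: h.
Qed.

(** By Cramer's rule the entries are minors divided by a determinant that does not vanish. *)
Lemma ex_rat_derive_invmx k (F : C -> 'M[K]_k) t :
  (forall s, F s \in unitmx) ->
  (forall i j, ex_rat_derive (fun s => F s i j) t) ->
  forall i j, ex_rat_derive (fun s => invmx (F s) i j) t.
Proof.
move=> hu h i j.
rewrite (_ : (fun _ => _) = fun s => (\det (F s))^-1 * ((-1) ^+ (j + i) * \det (row' j (col' i (F
  s))))).
  apply: ex_rat_deriveM.
    have [df hf] := ex_rat_derive_det h.
    by apply: ex_rat_is_deriveV hf _; rewrite -unitfE -unitmxE.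
  apply: ex_rat_deriveM; first by exists 0; exact: rat_is_derive_cst.
  apply: ex_rat_derive_det => k1 k2; rewrite (_ : (fun _ => _) = fun s => F s (lift j k1) (lift i
    k2)) //.
  by apply/funext => s; rewrite !mxE.
by apply/funext => s; rewrite /invmx hu !mxE.
Qed.

Lemma mx_is_deriveM a b c (S : C -> 'M[C]_(a, b)) (T : C -> 'M[C]_(b, c)) t dS dT :
  mx_is_derive S t dS -> mx_is_derive T t dT ->
  mx_is_derive (fun s => S s *m T s) t (dS *m T t + S t *m dT).
Proof.
move=> hS hT i j; rewrite !mxE -big_split /=.
rewrite (_ : (fun _ => _) = fun s => \sum_k S s i k * T s k j).
  by apply: is_derive_bigsum => k _; exact: is_derive_mul.
by apply/funext => s; rewrite mxE.
Qed.

Lemma mx_is_derive_cst a b (S : 'M[C]_(a, b)) t : mx_is_derive (fun=> S) t 0.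
Proof. by move=> i j; rewrite mxE; exact: is_derive_const. Qed.

Lemma mx_is_derive_exp0 a (S : C -> 'M[C]_a) t k :
  mx_is_derive S t 0 -> mx_is_derive (fun s => S s ^+ k) t 0.
Proof.
move=> h; elim: k => [|k IH]; first exact: mx_is_derive_cst.
have := mx_is_deriveM h IH; rewrite mul0mx mulmx0 addr0.
by congr mx_is_derive; apply/funext => s; rewrite exprS.
Qed.

End RatMatrixDerive.

Lemma dressing_leibniz (R : nzRingType) m d (w dw : 'M[R]_(d, m)) (A' B' dX YN : 'M[R]_m)
    (v : 'M[R]_(m, d)) (E : 'M[R]_d) :
  0 + - (((dw *m A' + w *m - (A' *m dX *m A')) *m B' + w *m A' *m 0) *m v
    + w *m A' *m B' *m - (YN *m v *m E)) =
  - (dw *m A' *m B' *m v) + w *m A' *m dX *m A' *m B' *m v + w *m A' *m B' *m YN *m v *m E.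
Proof.
by rewrite add0r mulmx0 addr0 !mulmxDl !mulmxN !mulNmx !opprD !opprK !mulmxA.
Qed.

(** Duplicates e and moves u and one copy of e to the left through E and v, so that v and w are each
    accompanied by their own idempotent. *)
Lemma scalar_idem_sandwich (R : nzRingType) m d (T : 'M[R]_m) (v : 'M[R]_(m, d))
    (E : 'M[R]_d) (w : 'M[R]_(d, m)) (u e : R) :
  (forall c, v *m c%:M = c%:M *m v) -> (forall c, E *m c%:M = c%:M *m E) -> e * e = e ->
  T *m v *m E *m ((u * e)%:M *m w) = T *m u%:M *m (v *m e%:M) *m E *m (e%:M *m w).
Proof.
move=> hv hE he.
have hv' c (Q : 'M[R]_(d, m)) : v *m (c%:M *m Q) = c%:M *m (v *m Q).
  by rewrite mulmxA hv -mulmxA.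
have hE' c (Q : 'M[R]_(d, m)) : E *m (c%:M *m Q) = c%:M *m (E *m Q).
  by rewrite mulmxA hE -mulmxA.
have sc p c c' (Q : 'M[R]_(p, m)) : c%:M *m (c'%:M *m Q) = (c * c')%:M *m Q.
  by rewrite mulmxA -scalar_mxM.
by rewrite -!mulmxA !hE' sc !hv' sc he.
Qed.

(** With [D] the derivative of [U] and [S] constant in time, the left-hand side is the derivative of
    U S U^-1. *)
Lemma conj_leibniz (R : nzRingType) a (D S U U' : 'M[R]_a) : U' *m U = 1%:M ->
  D *m S *m U' + U *m S *m - (U' *m D *m U') =
  D *m U' *m (U *m S *m U') - U *m S *m U' *m (D *m U').
Proof. by move=> h; rewrite mulmxN !mulmxA -[_ *m U' *m U]mulmxA h mulmx1. Qed.

(** * Time derivative of the dressing matrix along the flow *)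

Section LaxEquations.
Variables (C : numClosedFieldType) (n d : nat) (mu : C).
Variable hmu : n.+1.-primitive_root mu.
Variables (tau : C) (kappa : 'I_n.+1 -> C) (alpha : 'I_n.+1 -> nat).
Local Notation A := (crossed hmu).
Local Notation K := {fraction {poly C}}.
Local Notation td := (dunkl_td hmu tau kappa).
Local Notation P := (Defs.pseries td).
Local Notation V := (\sum_(i < n.+1) alpha i)%N.
Local Notation deg := (@tagnat.sig1 n.+1 alpha).
Local Notation cP := (constP hmu tau kappa).
Local Notation rP := (Defs.ratP hmu tau kappa).
Local Notation y := (yP hmu tau kappa).
Local Notation e := (epsP hmu tau kappa).
Local Notation iXx := (iXx hmu tau kappa).
Local Notation iYy := (iYy hmu tau kappa).
Local Notation Xx := (Xx hmu tau kappa).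
Local Notation Yy := (Yy hmu tau kappa).
Local Notation vhat := (vhat hmu tau kappa).
Local Notation what := (what hmu tau kappa).
Local Notation dressinginv := (dressinginv hmu tau kappa).
Local Notation dressing := (dressing hmu tau kappa).
Local Notation dressingV := (dressingV hmu tau kappa).

Lemma mxseries_is_derive_near_unique a b (S T : C -> 'M[P]_(a, b)) t dS dT :
  (\forall s \near t, S s = T s) ->
  mxseries_is_derive S t dS -> mxseries_is_derive T t dT -> dS = dT.
Proof.
move=> ST hS hT; apply/matrixP => i j; apply: pseriesP => k; apply/ffunP => r.
have [_ /(_ k r) h] := hS i j; have [_ /(_ k r) h'] := hT i j.
apply: rat_is_derive_unique h'; apply: rat_is_derive_near h.
by near=> s; rewrite (near ST s).
Unshelve. all: by end_near. Qed.

(** Obtained by differentiating S T = 1, so T has to be differentiable beforehand: Cramer's rule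
    ensures this for (X - x)^-1, the explicit formula for M^-1. *)
Lemma mxseries_is_derive_inv a (S T : C -> 'M[P]_a) t dS dT :
  (\forall s \near t, S s *m T s = 1%:M) -> T t *m S t = 1%:M ->
  mxseries_is_derive S t dS -> mxseries_is_derive T t dT ->
  dT = - (T t *m dS *m T t).
Proof.
move=> h h' hS hT.
have := mxseries_is_derive_near_unique h (mxseries_is_deriveM hS hT) (mxseries_is_derive_cst 1%:M
  t).
move=> /(congr1 (fun Q => T t *m Q)); rewrite mulmxDr mulmx0 !mulmxA h' mul1mx.
by move=> /eqP; rewrite addr_eq0 => /eqP ->; rewrite opprK.
Qed.

Section Flow.
Variables (j : nat) (beta : 'I_d) (q : C -> sph_data C d alpha) (t : C).
Hypothesis flow : sph_flow j beta q t.
Hypothesis near_variety : \forall s \near t, sph_variety tau kappa (q s).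

Let N := (n.+1 * j)%N.
Let E : 'M[P]_d := delta_mx beta beta.
Let dX := map_mx cP (- \sum_(a < N) totY (q t) ^+ a *m totv (q t) *m delta_mx beta beta
  *m totw (q t) *m totY (q t) ^+ (N - a - 1)).
Let YN := map_mx cP (totY (q t) ^+ N).

Lemma Xx_is_derive : mxseries_is_derive (fun s => Xx (q s)) t dX.
Proof.
have [hX _ _ _] := flow; rewrite -[dX]addr0.
apply: mxseries_is_deriveD; first exact: mxseries_is_derive_constP.
by rewrite -oppr0; apply: mxseries_is_deriveN; exact: mxseries_is_derive_cst.
Qed.

Lemma iXx_is_derive : mxseries_is_derive (fun s => iXx (q s)) t
  (- (iXx (q t) *m dX *m iXx (q t))).
Proof.
have [hX _ _ _] := flow.
have h i k : ex_rat_derive (fun s => (map_mx (@ratC C) (totX (q s)) - (ratX C)%:M) i k) t.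
  exists (ratC ((- \sum_(a < N) totY (q t) ^+ a *m totv (q t) *m delta_mx beta beta
    *m totw (q t) *m totY (q t) ^+ (N - a - 1)) i k) - 0).
  rewrite (_ : (fun _ => _) = fun s => ratC (totX (q s) i k) - (ratX C)%:M i k).
    apply: rat_is_deriveD; first exact/rat_is_derive_ratC/hX.
    by apply: rat_is_deriveN; exact: rat_is_derive_cst.
  by apply/funext => s; move: (totX (q s)) => T; rewrite !mxE.
have := ex_rat_derive_invmx (fun s => invXx_unit (q s)) h.
(* So far derivatives merely exist. Chosen ones are collected in a matrix, which
   [mxseries_is_derive_inv] then identifies. *)
move=> /(_ _ _)/cid hd.
pose D : 'M[K]_V := \matrix_(i, k) projT1 (hd i k).
have hD : mxseries_is_derive (fun s => iXx (q s)) t (map_mx rP D).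
  by apply: mxseries_is_derive_ratP => i k; rewrite mxE; exact: (projT2 (hd i k)).
rewrite -(mxseries_is_derive_inv _ _ Xx_is_derive hD) //.
  by near=> s; exact: Xx_iXx.
exact: iXx_Xx.
Unshelve. all: by end_near. Qed.

Lemma iYy_is_derive : mxseries_is_derive (fun s => iYy (q s)) t 0.
Proof.
have [_ hY _ _] := flow; rewrite -oppr0; apply: mxseries_is_deriveN => a b.
rewrite mxE; split.
  by exists (-1) => s k hk; exact: mxdeg_le_mxser hk.
move=> k; rewrite (_ : (fun _ => _) = fun s => if k <= -1 then
    crossedC hmu (ratC ((totY (q s) ^+ absz (-1 - k)%R) a b)) else 0); last first.
  by apply/funext => s; rewrite mxE /=; case: ifP => // _; rewrite mxE.
case: (k <= -1); last exact: crossed_is_derive_cst.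
have -> : (0 : P) k = crossedC hmu (ratC 0).
  by apply/ffunP => r; rewrite !ffunE ratC0 if_same.
apply: crossed_is_deriveC; apply: rat_is_derive_ratC.
by have := mx_is_derive_exp0 (absz (-1 - k)%R) hY; move=> /(_ a b); rewrite mxE.
Qed.

Lemma what_is_derive : mxseries_is_derive (fun s => what (q s)) t (E *m what (q t) *m YN).
Proof.
have [_ _ hw _] := flow.
have -> : E *m what (q t) *m YN = (e 0)%:M *m map_mx cP (delta_mx beta beta *m totw (q t) *m totY
  (q t) ^+ N).
  by rewrite 2!map_mxM map_delta_mx whatE !mulmxA delta_scalar_comm.
by apply: mxseries_is_derive_mull; exact: mxseries_is_derive_constP.
Qed.

Lemma vhat_is_derive : mxseries_is_derive (fun s => vhat (q s)) t (- (YN *m vhat (q t) *m E)).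
Proof.
have [_ _ _ hv] := flow.
have -> : - (YN *m vhat (q t) *m E) = map_mx cP (- (totY (q t) ^+ N *m totv (q t) *m delta_mx
  beta beta)) *m (e 0)%:M.
  by rewrite map_mxN 2!map_mxM map_delta_mx vhatE mulNmx -!mulmxA delta_scalar_comm.
by apply: mxseries_is_derive_mulr; exact: mxseries_is_derive_constP.
Qed.

Let w := what (q t).
Let A' := iXx (q t).
Let B' := iYy (q t).
Let v := vhat (q t).
Definition ddressing := - (E *m w *m YN *m A' *m B' *m v) + w *m A' *m dX *m A' *m B' *m v
  + w *m A' *m B' *m YN *m v *m E.

Lemma dressing_is_derive : mxseries_is_derive (fun s => dressing (q s)) t ddressing.
Proof.
have h := mxseries_is_deriveM (mxseries_is_deriveM (mxseries_is_deriveM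
  what_is_derive iXx_is_derive) iYy_is_derive) vhat_is_derive.
have := mxseries_is_deriveD (mxseries_is_derive_cst 1%:M t) (mxseries_is_deriveN h).
rewrite (_ : (fun s => 1%:M - _) = (fun s => dressing (q s))); last first.
  by apply/funext => s; rewrite dressingE.
by congr mxseries_is_derive; exact: dressing_leibniz.
Qed.

Hypothesis variety : sph_variety tau kappa (q t).
Let M := dressing (q t).
Let M' := dressingV (q t).
Let M'M : M' *m M = 1%:M. Proof. by case: (mx_inverse_dressingV hmu variety). Qed.

Lemma dressinginv_is_derive :
  mxseries_is_derive (fun s => dressinginv (q s)) t (- (M' *m ddressing *m M')).
Proof.
have h := mxseries_is_deriveD (mxseries_is_derive_cst 1%:M t) (mxseries_is_deriveM
  (mxseries_is_deriveM (mxseries_is_deriveM what_is_derive iYy_is_derive) iXx_is_derive)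
  vhat_is_derive).
rewrite [M'](dressingVE hmu variety) -(mxseries_is_derive_inv _ _ dressing_is_derive h) //.
  by near=> s; case: (mx_inverse_dressinginv hmu (near near_variety s _)).
by case: (mx_inverse_dressinginv hmu variety).
Unshelve. all: by end_near. Qed.

Lemma conj_is_derive (S : 'M[P]_d) :
  mxseries_is_derive (fun s => dressing (q s) *m S *m dressinginv (q s)) t
    (mxbracket (ddressing *m M') (M *m S *m M')).
Proof.
rewrite /mxbracket -(conj_leibniz ddressing S M'M) {1}/M' (dressingVE hmu variety).
exact: mxseries_is_deriveM (mxseries_is_derive_mulr S dressing_is_derive) dressinginv_is_derive.
Qed.

Let Yt := map_mx cP (totY (q t)).
Let wt := map_mx cP (totw (q t)).
Let vt := map_mx cP (totv (q t)).
Let Pi := gradmx hmu tau kappa alpha id.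

Lemma map_constP_exp (T : 'M[C]_V) k : map_mx cP (T ^+ k) = map_mx cP T ^+ k.
Proof.
elim: k => [|k IH]; first by rewrite !expr0 map_mx1.
by rewrite !exprS -!mulmxE map_mxM IH.
Qed.

Lemma Yt_yX k : GRing.comm Yt ((y ^+ k)%:M).
Proof. exact: map_constP_scalar. Qed.

(* Modulo the left ideal generated by [Y - y], powers of [Y] can be traded for powers of [y]. *)
Lemma what_Y_mod r : exists2 Z : 'M[P]_(d, V), mxnonneg Z &
  wt *m Yt ^+ r *m Pi - (y ^+ r * e 0)%:M *m wt = Z *m Yy (q t).
Proof.
elim: r => [|r [Z Z0 hZ]].
  exists 0; first by move=> i k l hl; rewrite mxE.
  rewrite expr0 mulmx1 mul0mx expr0 mul1r; apply/eqP; rewrite subr_eq0; apply/eqP.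
  apply/matrixP => a b; rewrite mul_gradmxr mul_scalar_mxE mxE constP_comm.
  have [->|/totw_graded h] := eqVneq (totw (q t) a b) 0; first by rewrite rmorph0 !mulr0.
  by rewrite h.
pose PiS := gradmx hmu tau kappa alpha (@ordS _).
(* The new difference is w Y^r (Y - y) Pi plus y times the old one, and (Y - y) Pi = PiS (Y - y). *)
exists (wt *m Yt ^+ r *m PiS + y%:M *m Z).
  apply: mxnonnegD; apply: mxnonneg_mul => //.
  - rewrite /Yt -map_constP_exp; apply: mxnonneg_mul; exact: mxnonneg_constP.
  - move=> i k; rewrite mxE; case: ifP => // _; exact: pnonneg_crossedP.
  - by apply: mxnonneg_scalar; exact: pnonneg_pmono.
rewrite mulmxDl -[_ *m PiS *m _]mulmxA -[y%:M *m Z *m _]mulmxA -hZ.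
rewrite -(Yy_gradmx hmu tau kappa (q t) (f := id)) // -/Pi.
have -> : Yy (q t) *m Pi = Yt *m Pi - y%:M *m Pi by rewrite -mulmxBl.
have -> : (y ^+ r.+1 * e 0)%:M *m wt = y%:M *m ((y ^+ r * e 0)%:M *m wt).
  by rewrite mulmxA -scalar_mxM mulrA -exprS.
have -> : wt *m Yt ^+ r.+1 *m Pi = wt *m Yt ^+ r *m (Yt *m Pi).
  by rewrite exprSr -mulmxE !mulmxA.
have h : y%:M *m (wt *m Yt ^+ r *m Pi) = wt *m Yt ^+ r *m (y%:M *m Pi).
  rewrite !mulmxA -(map_constP_scalar _ y) -/wt -[wt *m y%:M *m _]mulmxA.
  have := commrX r (commr_sym (Yt_yX 1)); rewrite expr1 /GRing.comm -mulmxE => ->.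
  by rewrite !mulmxA.
move: h; move: (wt *m Yt ^+ r) (Yt *m Pi) ((y ^+ r * e 0)%:M *m wt) => W YP U h.
by rewrite !mulmxBr -h addrA subrK.
Qed.

Let S : 'M[P]_V := \sum_(i < N) Yt ^+ (N.-1 - i) *m (y ^+ i)%:M.

Lemma Y_sub_y_left : YN - (y ^+ N)%:M = Yy (q t) *m S.
Proof.
rewrite /YN map_constP_exp -/Yt -scalar_mxX (subrXX_comm N (Yt_yX 1)).
by rewrite -mulmxE; congr (_ *m _); apply: eq_bigr => i _; rewrite scalar_mxX.
Qed.

Lemma Y_sub_y_right : YN - (y ^+ N)%:M = S *m Yy (q t).
Proof.
have c1 : GRing.comm Yt (y%:M) by exact: (Yt_yX 1).
suff h : GRing.comm (Yy (q t)) S by rewrite Y_sub_y_left; exact: h.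
have cY : GRing.comm (Yy (q t)) Yt.
  by apply/commr_sym; apply: commrB; first exact: commr_refl.
have cy : GRing.comm (Yy (q t)) y%:M.
  by apply/commr_sym; apply: commrB; [exact: commr_sym | exact: commr_refl].
by apply: commr_sum => i _; rewrite -scalar_mxX; apply: commrM; exact: commrX.
Qed.

Lemma mxnonneg_Yt k : mxnonneg (Yt ^+ k).
Proof. by rewrite /Yt -map_constP_exp; exact: mxnonneg_constP. Qed.

Lemma mxnonneg_yX a k : mxnonneg ((y ^+ k)%:M : 'M[P]_a).
Proof. by apply: mxnonneg_scalar; exact: pnonneg_yX. Qed.

Lemma mxnonneg_S : mxnonneg S.
Proof.
apply: mxnonneg_sum => i _; apply: mxnonneg_mul; first exact: mxnonneg_Yt.
exact: mxnonneg_yX.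
Qed.

(** The sum is reversed so that the left powers of Y are those occurring in [S]. *)
Lemma dXE : dX = - \sum_(i < N) Yt ^+ (N.-1 - i) *m vt *m E *m wt *m Yt ^+ i.
Proof.
rewrite /dX map_mxN raddf_sum /=; congr (- _); rewrite [LHS](reindex_inj rev_ord_inj) /=.
apply: eq_bigr => i _; rewrite 4!map_mxM 2!map_constP_exp map_delta_mx.
have -> : (N - (N - i.+1) - 1)%N = i by have := ltn_ord i; lia.
by have -> : (N - i.+1)%N = (N.-1 - i)%N by lia.
Qed.

(** Each term of dX Pi ends in w Y^i Pi, which is y^i eps_0 w up to a multiple of Y - y. The sum of
    the terms with y^i is the opposite of S v E w. *)
Lemma dX_mod : exists2 Z : 'M[P]_V, mxnonneg Z &
  dX *m Pi + S *m v *m E *m w = Z *m Yy (q t).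
Proof.
have /choice [Z hZ] : forall r, exists Z : 'M[P]_(d, V), mxnonneg Z /\
    wt *m Yt ^+ r *m Pi - (y ^+ r * e 0)%:M *m wt = Z *m Yy (q t).
  by move=> r; have [Z] := what_Y_mod r; exists Z.
exists (- \sum_(i < N) Yt ^+ (N.-1 - i) *m vt *m E *m Z i).
  apply/mxnonnegN/mxnonneg_sum => i _; apply: mxnonneg_mul; last by case: (hZ i).
  rewrite /E -(map_delta_mx cP); apply: mxnonneg_mul; last exact: mxnonneg_constP.
  by apply: mxnonneg_mul; [exact: mxnonneg_Yt | exact: mxnonneg_constP].
rewrite dXE /S mulNmx mulNmx !mulmx_suml.
have -> : \sum_(i < N) Yt ^+ (N.-1 - i) *m vt *m E *m Z i *m Yy (q t) =
    \sum_(i < N) Yt ^+ (N.-1 - i) *m vt *m E *m wt *m Yt ^+ i *m Pi -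
    \sum_(i < N) Yt ^+ (N.-1 - i) *m (y ^+ i)%:M *m v *m E *m w.
  rewrite -sumrB; apply: eq_bigr => i _; rewrite -mulmxA -(proj2 (hZ i)) mulmxBr.
  congr (_ - _); first by rewrite !mulmxA.
  apply: scalar_idem_sandwich; last exact: epsP_idem.
    by move=> c; exact: map_constP_scalar.
  by move=> c; exact: delta_scalar_comm.
by rewrite opprB addrC.
Qed.

Lemma lax_equations_at : lax_eqs j beta (fun s => laxL hmu tau kappa (q s))
   (fun s => laxR hmu tau kappa (q s)) t.
Proof.
have [Z Z0 hZ] := dX_mod.
have hv : v *m (y ^+ N)%:M = (y ^+ N)%:M *m v.
  rewrite /v vhatE -mulmxA -scalar_mxM -yX_epsP0 scalar_mxM !mulmxA.
  by rewrite map_constP_scalar.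
have hw : w *m (y ^+ N)%:M = (y ^+ N)%:M *m w.
  rewrite /w whatE -mulmxA map_constP_scalar !mulmxA -!scalar_mxM.
  by rewrite yX_epsP0.
(* The right-hand side of [dressing_flow], about to be recognised as (L^N R_beta)_+. *)
pose B := (y ^+ N)%:M *m E + w *m A' *m S *m v *m E - E *m w *m S *m A' *m v
  + w *m A' *m Z *m A' *m v.
have hB : ddressing *m M' + M *m (y ^+ N)%:M *m E *m M' = B.
  rewrite /M' (dressingVE hmu variety) /M dressingE.
  exact: (dressing_flow (Xx_iXx hmu tau kappa (q t)) (iXx_Xx hmu tau kappa (q t))
    (Yy_iYy hmu tau kappa (q t)) (iYy_Yy hmu tau kappa (q t)) (YyXx_rel hmu variety)
    (Pi_vhat hmu tau kappa (q t)) (XYPi hmu tau kappa (q t)) hv hw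
    (delta_scalar_comm _ _) Y_sub_y_left Y_sub_y_right hZ).
have B0 : mxnonneg B.
  have E0 : mxnonneg E by rewrite /E -(map_delta_mx cP); exact: mxnonneg_constP.
  have A0 : mxnonneg A' by exact: mxnonneg_ratP.
  have e0 a : mxnonneg ((e 0)%:M : 'M[P]_a) by apply: mxnonneg_scalar; exact: pnonneg_crossedP.
  have v0 : mxnonneg v by apply: mxnonneg_mul; [exact: mxnonneg_constP | exact: e0].
  have w0 : mxnonneg w by apply: mxnonneg_mul; [exact: e0 | exact: mxnonneg_constP].
  have S0 := mxnonneg_S.
  apply: mxnonnegD; last by do 4!(apply: mxnonneg_mul => //).
  apply: mxnonnegD; last by apply: mxnonnegN; do 4!(apply: mxnonneg_mul => //).
  apply: mxnonnegD; last by do 4!(apply: mxnonneg_mul => //).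
  by apply: mxnonneg_mul => //; exact: mxnonneg_yX.
(* Every term of [ddressing] has one factor B' of order -1 among factors of order 0. *)
have hdeg : mxdeg_le (-1) (ddressing *m M').
  have M'0 : mxdeg_le 0 M' by rewrite /M' (dressingVE hmu variety); exact: mxdeg_le_dressinginv.
  apply: (mxdeg_le_mul (N := -1) (N' := 0)) M'0.
  have E0 : mxdeg_le 0 E by exact: mxdeg_le_delta.
  have w0 : mxdeg_le 0 w by exact: mxdeg_le_what.
  have v0 : mxdeg_le 0 v by exact: mxdeg_le_vhat.
  have A0 : mxdeg_le 0 A' by exact: mxdeg_le_iXx.
  have B0' : mxdeg_le (-1) B' by exact: mxdeg_le_iYy.
  have Y0 : mxdeg_le 0 YN by exact: mxdeg_le_constP.
  have X0 : mxdeg_le 0 dX by exact: mxdeg_le_constP.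
  have m00 a b c (T : 'M[P]_(a, b)) (T' : 'M[P]_(b, c)) : mxdeg_le 0 T -> mxdeg_le 0 T' ->
    mxdeg_le 0 (T *m T') by exact: (mxdeg_le_mul (N := 0) (N' := 0)).
  have m10 a b c (T : 'M[P]_(a, b)) (T' : 'M[P]_(b, c)) : mxdeg_le (-1) T -> mxdeg_le 0 T' ->
    mxdeg_le (-1) (T *m T') by exact: (mxdeg_le_mul (N := -1) (N' := 0)).
  have m01 a b c (T : 'M[P]_(a, b)) (T' : 'M[P]_(b, c)) : mxdeg_le 0 T -> mxdeg_le (-1) T' ->
    mxdeg_le (-1) (T *m T') by exact: (mxdeg_le_mul (N := 0) (N' := -1)).
  apply: mxdeg_leD; last first.
    by apply/m10 => //; apply/m10 => //; apply/m10 => //; apply/m01 => //; exact/m00.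
  apply: mxdeg_leD.
    apply: mxdeg_leN; apply/m10 => //; apply/m01 => //; apply/m00 => //; apply/m00 => //.
    exact/m00.
  by apply/m10 => //; apply/m01 => //; apply/m00 => //; apply/m00 => //; exact/m00.
have hLR : laxL hmu tau kappa (q t) ^+ N *m laxR hmu tau kappa (q t) beta = M *m ((y ^+ N)%:M *m
  E) *m M'.
  rewrite (laxL_exp hmu variety) /laxR; exact: (mul_conj_dressing variety (y ^+ N)%:M E).
have Bp : map_mx (@ppos _ _) (laxL hmu tau kappa (q t) ^+ N *m laxR hmu tau kappa (q t) beta) = B.
  apply: (map_ppos_decomp (Q := ddressing *m M')) => //.
  by rewrite hLR -hB [X in X - _]addrC addrK !mulmxA.
(* B and dM M^-1 differ by M y^N E M^-1, which commutes with M T M^-1 as soon as y^N E commutes with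
   T. The cases T = y and T = E_gamma give both equations. *)
have main (T : 'M[P]_d) : (y ^+ N)%:M *m E *m T = T *m ((y ^+ N)%:M *m E) ->
    series_is_derive (fun s => dressing (q s) *m T *m dressingV (q s)) t
      (mxbracket B (M *m T *m M')).
  move=> hT; have -> : mxbracket B (M *m T *m M') = mxbracket (ddressing *m M') (M *m T *m M').
    rewrite /mxbracket -hB mulmxDl mulmxDr opprD addrACA.
    rewrite [X in _ + X](_ : _ = 0) ?addr0 //; apply/eqP; rewrite subr_eq0; apply/eqP.
    rewrite -[M *m (y ^+ N)%:M *m E]mulmxA.
    rewrite [LHS](mul_conj_dressing variety) [RHS](mul_conj_dressing variety).
    by rewrite hT.
  apply: series_is_derive_near (conj_is_derive T); near=> s.
  by rewrite (dressingVE hmu (near near_variety s _)).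
have Ey : (y ^+ N)%:M *m E *m y%:M = y%:M *m ((y ^+ N)%:M *m E).
  rewrite -mulmxA /E delta_scalar_comm mulmxA -scalar_mxM [RHS]mulmxA -scalar_mxM.
  by rewrite -exprS -exprSr.
have EE g : (y ^+ N)%:M *m E *m delta_mx g g = delta_mx g g *m ((y ^+ N)%:M *m E).
  rewrite [RHS]mulmxA (delta_scalar_comm g) -[RHS]mulmxA -[LHS]mulmxA.
  rewrite (_ : E *m _ = delta_mx g g *m E) // /E !mul_delta_mx_cond eq_sym.
  by case: eqP => [->|].
split=> [|g]; rewrite Bp; [exact: (main _ Ey) | exact: (main _ (EE g))].
Unshelve. all: by end_near. Qed.

End Flow.
End LaxEquations.

(** * The complex exponential *)

Section DeriveEpsDelta.
Variable K : numFieldType.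
Implicit Types (f : K -> K) (x df : K).

(** This form without quotients allows the real derivatives of exp, cos and sin to be combined into
    a complex one. *)
Lemma is_derive_epsdelta f x df : is_derive x 1 f df ->
  forall e, 0 < e -> exists2 r, 0 < r &
    forall h, `|h| < r -> `|f (h + x) - f x - df * h| <= e * `|h|.
Proof.
move=> hf e e0.
have h1 : ((fun h : K => h^-1 *: ((f \o shift x) (h *: (1 : K)) - f x)) @ 0^' --> df)%classic.
  have := @ex_derive _ _ _ _ _ _ _ hf; rewrite /derivable -(@derive_val _ _ _ _ _ _ _ hf).
  by [].
move/cvgrPdist_le: h1 => /(_ e e0); rewrite near_withinE => /nbhs_ballP [r /= r0 hr].
exists r => // h hh; have [->|h0] := eqVneq h 0.
  by rewrite add0r subrr mulr0 subr0 normr0 mulr0.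
have := hr h; rewrite /ball /= sub0r normrN => /(_ hh h0).
rewrite /shift /= /GRing.scale /= mulr1 => hle.
have -> : f (h + x) - f x - df * h = - ((df - h^-1 * (f (h + x) - f x)) * h).
  by rewrite mulrBl mulrAC mulVf // mul1r opprB.
by rewrite normrN normrM ler_wpM2r.
Qed.

Lemma epsdelta_is_derive f x df :
  (forall e, 0 < e -> exists2 r, 0 < r &
    forall h, `|h| < r -> `|f (h + x) - f x - df * h| <= e * `|h|) ->
  is_derive x 1 f df.
Proof.
move=> H.
have h1 : ((fun h : K => h^-1 *: ((f \o shift x) (h *: (1 : K)) - f x)) @ 0^' --> df)%classic.
  apply/cvgrPdist_le => e e0; rewrite near_withinE.
  have [r r0 hr] := H e e0; apply/nbhs_ballP; exists r => // h.
  rewrite /ball /= sub0r normrN => hh h0.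
  rewrite /shift /= /GRing.scale /= mulr1.
  have -> : df - h^-1 * (f (h + x) - f x) = - (h^-1 * (f (h + x) - f x - df * h)).
    move: (f (h + x) - f x) => D.
    by rewrite mulrBr opprB [h^-1 * (df * h)]mulrCA mulVf // mulr1.
  rewrite normrN normrM normfV -(ler_pM2l (_ : 0 < `|h|)) ?normr_gt0 // mulrA mulfV ?normr_eq0 //.
  by rewrite mul1r [_ * e]mulrC; exact: hr.
by split; [exact/cvg_ex/(ex_intro _ df) | exact: cvg_lim h1].
Qed.

End DeriveEpsDelta.

Section ComplexExp.
Variable R : realType.
Local Notation C := R[i].
Local Open Scope complex_scope.

Definition cexp (z : C) : C :=
  (expR (complex.Re z) * cos (complex.Im z)) +i* (expR (complex.Re z) * sin (complex.Im z)).

Lemma cexp0 : cexp 0 = 1.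
Proof. by rewrite /cexp /= expR0 cos0 sin0 mulr1 mulr0. Qed.

Lemma cexpD z w : cexp (z + w) = cexp z * cexp w.
Proof.
case: z w => [a b] [a' b']; rewrite /cexp /= expRD cosD sinD.
apply/eqP; rewrite eq_complex /=; apply/andP; split; apply/eqP; ring.
Qed.

Lemma norm_complex_le (a b : R) : `|a +i* b| <= (`|a| + `|b|)%:C.
Proof.
have -> : a +i* b = a%:C + 'i * b%:C by rewrite [LHS]complexE.
have hr (r : R) : `|r%:C| = (`|r|)%:C by rewrite normc_def /= expr0n addr0 sqrtr_sqr.
apply: le_trans (ler_normD _ _) _; rewrite normrM !hr rmorphD lerD2l.
by rewrite normc_def /= expr0n add0r expr1n sqrtr1 mul1r.
Qed.

Lemma Re_le_norm (z : C) : (`|complex.Re z|)%:C <= `|z|.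
Proof. by rewrite normc_def lecR -sqrtr_sqr ler_wsqrtr // lerDl sqr_ge0. Qed.

Lemma Im_le_norm (z : C) : (`|complex.Im z|)%:C <= `|z|.
Proof. by rewrite normc_def lecR -sqrtr_sqr ler_wsqrtr // lerDr sqr_ge0. Qed.

(* No normed module structure is inferred on [R[i]] itself, only on its numeric closed field
   structure. *)
Definition complexF : numClosedFieldType := R[i].

Lemma is_derive_cexp0 : is_derive (0 : complexF) 1 (cexp : complexF -> complexF) 1.
Proof.
apply: epsdelta_is_derive; rewrite /complexF => e0 e0_gt0.
(* A positive complex number is real. The constant 9 = 1 + 3 + 4 + 1 adds up the four bounds at the
   end. *)
have [e e_gt0 {e0 e0_gt0}->] : exists2 e : R, 0 < e & e0 = (e * 9)%:C.
  move: e0_gt0; rewrite ltcE /= => /andP[/eqP im re].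
  exists (complex.Re e0 / 9); first by rewrite divr_gt0.
  by rewrite divfK ?pnatr_eq0 //; case: e0 im re => a b /= -> _.
have hexp := is_derive_epsdelta (is_derive_expR (0 : R)).
have [r1 r1_gt0 h1] := is_derive_epsdelta (is_derive_expR (0 : R)) e_gt0.
have [r2 r2_gt0 h2] := is_derive_epsdelta (is_derive_cos (0 : R)) e_gt0.
have [r3 r3_gt0 h3] := is_derive_epsdelta (is_derive_sin (0 : R)) e_gt0.
(* The error constant 1 yields |e^a - 1| <= 2 |a|. The bounds e and 1 in [r] then give |sin b| <= 2
   e and |e^a| <= 3. *)
have [r4 r4_gt0 h4] := hexp 1 ltr01.
pose r := Num.min (Num.min r1 r2) (Num.min r3 (Num.min r4 (Num.min e 1))).
exists r%:C.
  by rewrite ltcR !lt_min r1_gt0 r2_gt0 r3_gt0 r4_gt0 e_gt0 ltr01.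
move=> h hh; rewrite addr0 cexp0 mul1r.
have := le_lt_trans (Re_le_norm h) hh; have := le_lt_trans (Im_le_norm h) hh.
have hRe := Re_le_norm h; have hIm := Im_le_norm h; move: hRe hIm.
case: h {hh} => a b /=; rewrite !ltcR !lt_min => hRe hIm.
move=> /andP[/andP[b1 b2] /and4P[b3 b4 be b5]] /andP[/andP[a1 a2] /and4P[a3 a4 ae a5]].
move: (h1 a a1) (h2 b b2) (h3 b b3) (h4 a a4).
rewrite expR0 cos0 sin0 !(addr0, oppr0, mul0r, mul1r).
set A := expR a; set c := cos b; set s := sin b => hA hc hs hA1.
have -> : cexp (a +i* b) - 1 - (a +i* b) = ((A - 1 - a) + A * (c - 1)) +i* ((A - 1) * s + (s - b)).
  apply/eqP; rewrite eq_complex /=; apply/andP; split; apply/eqP; rewrite /A /c /s; ring.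
apply: le_trans (norm_complex_le _ _) _.
have A3 : `|A - 1| <= 2 * `|a|.
  by rewrite -[A - 1](subrK a) (le_trans (ler_normD _ _)) // mulr_natl mulr2n lerD.
have s2 : `|s| <= 2 * e.
  rewrite -[s](subrK b) (le_trans (ler_normD _ _)) // mulr_natl mulr2n lerD ?(ltW be) //.
  by rewrite (le_trans hs) // ler_piMr // ltW.
have A4 : `|A| <= 3.
  rewrite -[A](subrK 1) (le_trans (ler_normD _ _)) // normr1.
  have -> : 3 = 2 + 1 :> R by ring.
  by rewrite lerD2r (le_trans A3) // ler_piMr // ltW.
move: hRe hIm; rewrite [Num.norm (a +i* b)]normc_def /=; set p := Num.sqrt _;
  rewrite !lecR => ap bp.
rewrite -rmorphM lecR.
have p0 : 0 <= p by exact: le_trans ap.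
have -> : e * 9 * p = (e * p + 3 * (e * p)) + (2 * p * (2 * e) + e * p) by ring.
apply: lerD; apply: le_trans (ler_normD _ _) _; apply: lerD; rewrite ?normrM.
- by rewrite (le_trans hA) // ler_wpM2l // ltW.
- by apply: ler_pM => //; rewrite (le_trans hc) // ler_wpM2l // ltW.
- by apply: ler_pM => //; rewrite (le_trans A3) // ler_wpM2l.
by rewrite (le_trans hs) // ler_wpM2l // ltW.
Qed.

(** The addition formula reduces this to the derivative at 0. *)
Lemma is_derive_cexp (a b t : complexF) :
  is_derive t 1 (fun s : complexF => cexp (a + s * b) : complexF) (b * cexp (a + t * b)).
Proof.
apply: epsdelta_is_derive; rewrite /complexF in a b t *; move=> e e0.
(* The added 1, here and in the radius, keeps the divisors positive when b = 0. *)
have c0 : 0 < `|cexp (a + t * b)| * `|b| + 1 by rewrite ltr_wpDl // mulr_ge0.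
have [r r0 hr] := is_derive_epsdelta is_derive_cexp0 (divr_gt0 e0 c0).
exists (r / (`|b| + 1)); first by rewrite divr_gt0 // ltr_wpDl.
move=> h; rewrite ltr_pdivlMr ?ltr_wpDl // => hh.
have hbr : `|h * b| < r.
  by rewrite normrM (le_lt_trans _ hh) // ler_wpM2l // lerDl.
have -> : cexp (a + (h + t) * b) - cexp (a + t * b) - b * cexp (a + t * b) * h =
    cexp (a + t * b) * (cexp (h * b + 0) - cexp 0 - 1 * (h * b)).
  by rewrite addr0 cexp0 mulrDl addrCA cexpD; ring.
rewrite normrM (le_trans (ler_wpM2l _ (hr _ hbr))) // normrM.
rewrite [leLHS](_ : _ = (`|cexp (a + t * b)| * `|b|) / (`|cexp (a + t * b)| * `|b| + 1) * (e *
  `|h|)); last by ring.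
by rewrite ler_piMl ?mulr_ge0 ?(ltW e0) // ler_pdivrMr // mul1r lerDl.
Qed.

End ComplexExp.

(** * Exponentials modulo a polynomial and of matrices *)

Section ExpPolynomial.
Variable C : numClosedFieldType.
Implicit Types (f g u : {poly C}) (t : C).

(** All that the construction of matrix exponentials asks of the scalar exponential. *)
Definition exp_like (ex : C -> C) : Prop :=
  [/\ ex 0 = 1, forall z, ex z * ex (- z) = 1 &
      forall a b t, is_derive t 1 (fun s => ex (a + s * b)) (b * ex (a + t * b))].

Definition trunc_exp (m : nat) : {poly C} := \poly_(k < m) (k`!%:R)^-1.

Lemma trunc_exp0 : trunc_exp 0 = 0.
Proof. by apply/polyP => k; rewrite coef_poly coef0. Qed.

Lemma trunc_expS m : trunc_exp m.+1 = trunc_exp m + (m`!%:R)^-1 *: 'X^m.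
Proof.
apply/polyP => k; rewrite coefD coefZ coefXn !coef_poly ltnS leq_eqVlt.
by case: eqVneq => [->|_]; rewrite ?ltnn ?mulr1 ?add0r //= mulr0 addr0.
Qed.

Lemma deriv_trunc_exp m : (trunc_exp m.+1)^`() = trunc_exp m.
Proof.
apply/polyP => k; rewrite coef_deriv !coef_poly ltnS; case: ifP => // _; last by rewrite mul0rn.
by rewrite factS natrM invfM -[LHS]mulr_natl mulrA mulfV ?mul1r // pnatr_eq0.
Qed.

Lemma dvdpXn_coef0 m (p : {poly C}) : (forall k, (k < m)%N -> p`_k = 0) -> 'X^m %| p.
Proof.
move=> h; rewrite -[p](poly_take_drop m) dvdp_addr ?dvdp_mull //.
rewrite (_ : take_poly m p = 0) ?dvdp0 //; apply/polyP => k.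
by rewrite coef_take_poly coef0; case: ifP => // /h.
Qed.

(** For m + 1 Taylor terms the product has constant term 1, and in its derivative everything cancels
    except multiples of the last power X^m. In characteristic 0 its coefficients from X to X^m
    therefore vanish. *)
Lemma trunc_expN m : 'X^m %| trunc_exp m * (trunc_exp m \Po - 'X) - 1.
Proof.
case: m => [|m]; first by rewrite expr0 dvd1p.
set p := trunc_exp m.+1 * _; apply: dvdpXn_coef0 => -[_|k].
  rewrite coefB coef1 /= coef0M -[X in _ * X]horner_coef0 horner_comp hornerN hornerX oppr0.
  by rewrite horner_coef0 coef_poly /= fact0 invr1 mulr1 subrr.
rewrite ltnS => km; rewrite coefB coef1 subr0.
have dp : p^`() = 'X^m * ((m`!%:R)^-1 *: ((-1) ^+ m * trunc_exp m.+1 - (trunc_exp m.+1 \Po - 'X))).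
  rewrite derivM deriv_comp derivN derivX mulrN1 deriv_trunc_exp.
  have -> : trunc_exp m = trunc_exp m.+1 - (m`!%:R)^-1 *: 'X^m by rewrite trunc_expS addrK.
  rewrite comp_polyB comp_polyZ comp_Xn_poly [(- 'X) ^+ m]exprNn.
  rewrite -!mul_polyC; ring.
have : (p^`())`_k = 0 by rewrite dp coefXnM km.
rewrite coef_deriv => /eqP; rewrite -mulr_natr mulf_eq0 pnatr_eq0 orbF.
by move/eqP.
Qed.

Lemma poly_is_derive_exp (u : C -> {poly C}) t du k : poly_is_derive u t du ->
  poly_is_derive (fun s => u s ^+ k) t (k%:R * du * u t ^+ k.-1).
Proof.
move=> hu; elim: k => [|k IH].
  by rewrite mul0r mul0r; exact: poly_is_derive_cst.
have := poly_is_deriveM hu IH; rewrite (_ : (fun s => u s * _) = (fun s => u s ^+ k.+1));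
  last first.
  by apply/funext => s; rewrite exprS.
by congr poly_is_derive; case: k {IH} => [|k] /=; rewrite ?expr0 ?mul0r ?mulr0 ?addr0 ?mul1r
  ?mulr1 // exprS; ring.
Qed.

Lemma poly_is_derive_comp_trunc_exp (u : C -> {poly C}) t du m : poly_is_derive u t du ->
  poly_is_derive (fun s => trunc_exp m.+1 \Po u s) t (du * (trunc_exp m \Po u t)).
Proof.
move=> hu; elim: m => [|m IH].
  rewrite trunc_exp0 comp_poly0 mulr0.
  rewrite (_ : (fun _ => _) = fun=> 1); first exact: poly_is_derive_cst.
  by apply/funext => s; rewrite trunc_expS trunc_exp0 add0r fact0 invr1 scale1r expr0 comp_polyC.
have := poly_is_deriveD IH (poly_is_deriveZ (m.+1`!%:R)^-1%:P (poly_is_derive_exp m.+1 hu)).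
rewrite (_ : (fun s => _ + _) = (fun s => trunc_exp m.+2 \Po u s)); last first.
  by apply/funext => s; rewrite [trunc_exp m.+2]trunc_expS comp_polyD comp_polyZ comp_Xn_poly
    mul_polyC.
congr poly_is_derive; rewrite [in RHS]trunc_expS comp_polyD comp_polyZ comp_Xn_poly mulrDr;
  congr (_ + _).
rewrite -mul_polyC factS natrM invfM polyCM -polyC_natr /=.
have e : (m.+1%:R^-1)%:P * (m.+1%:R)%:P = 1 :> {poly C} by rewrite -polyCM mulVf // pnatr_eq0.
by rewrite -[RHS]mul1r -e; ring.
Qed.

Variable ex : C -> C.
Hypothesis hex : exp_like ex.

(* [h f] plays the role of [exp f] modulo [chi]. *)
Definition exp_mod (chi : {poly C}) (h : {poly C} -> {poly C}) : Prop :=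
  [/\ chi %| h 0 - 1, forall f, chi %| h f * h (- f) - 1 &
      forall f g t, exists2 dh, poly_is_derive (fun s => h (f + s *: g)) t dh &
        chi %| dh - g * h (f + t *: g)].

Lemma dvdp_sub_horner (mu : C) f : ('X - mu%:P) %| f - (f.[mu])%:P.
Proof. by rewrite dvdp_XsubCl rootE !hornerE subrr. Qed.

(** Modulo (X - mu)^m the polynomial f - f(mu) is nilpotent, so exp f is e^(f(mu)) times a truncated
    exponential of f - f(mu). *)
Lemma exp_mod_local (mu : C) m : exists h, exp_mod (('X - mu%:P) ^+ m) h.
Proof.
have [e0 eN ed] := hex.
case: m => [|m].
  exists (fun=> 0); split=> [|f|f g t]; rewrite ?expr0 ?dvd1p //.
  by exists 0; rewrite ?dvd1p //; exact: poly_is_derive_cst.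
exists (fun f => (ex f.[mu])%:P * (trunc_exp m.+1 \Po (f - (f.[mu])%:P))); split=> [|f|f g t].
- rewrite horner0 e0 mul1r subr0 comp_poly0r coef_poly /= fact0 invr1 subrr dvdp0 //.
- set n := f - _; have -> : - f - ((- f).[mu])%:P = - n by rewrite hornerN polyCN /n opprB opprK
  addrC.
  rewrite hornerN mulrACA -polyCM eN mul1r.
  apply: dvdp_trans (_ : n ^+ m.+1 %| _); first by apply: dvdp_exp2r; exact: dvdp_sub_horner.
  have /dvdpP[q hq] := trunc_expN m.+1.
  apply/dvdpP; exists (q \Po n); rewrite -comp_Xn_poly -comp_polyM -hq comp_polyB comp_polyM.
  by rewrite -comp_polyA raddfN /= comp_polyX comp_polyC.
pose n0 := f - (f.[mu])%:P; pose n1 := g - (g.[mu])%:P.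
pose n s := n0 + s%:P * n1.
have nE s : f + s *: g - ((f + s *: g).[mu])%:P = n s.
  by rewrite /n /n0 /n1 hornerD hornerZ -mul_polyC polyCD polyCM; ring.
have hn : poly_is_derive n t n1.
  have := poly_is_deriveD (poly_is_derive_cst n0 t) (poly_is_deriveM
    (poly_is_deriveC (is_derive_id t 1)) (poly_is_derive_cst n1 t)).
  by rewrite add0r mulr0 addr0 polyC1 mul1r.
have hE := poly_is_derive_comp_trunc_exp m hn.
have hc := poly_is_deriveC (ed f.[mu] g.[mu] t).
have hh := poly_is_deriveM hc hE.
rewrite (_ : (fun s => _ * _) = (fun s => (ex (f + s *: g).[mu])%:P *
    (trunc_exp m.+1 \Po (f + s *: g - ((f + s *: g).[mu])%:P)))) in hh; last first.
  by apply/funext => s; rewrite nE hornerD hornerZ.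
eexists; first exact: hh.
rewrite nE hornerD hornerZ; set E := ex _.
(* Differentiation loses the last Taylor term. The resulting error contains [n1 * n t ^+ m], whose m
   + 1 factors are all divisible by X - mu. *)
have -> : trunc_exp m = trunc_exp m.+1 - (m`!%:R)^-1 *: 'X^m by rewrite trunc_expS addrK.
rewrite comp_polyB comp_polyZ comp_Xn_poly.
rewrite [X in _ %| X](_ : _ = - (E%:P * ((m`!%:R)^-1)%:P) * (n1 * n t ^+ m)); last first.
  by rewrite /n1 polyCM -mul_polyC; ring.
rewrite dvdp_mull // exprS dvdp_mul ?dvdp_sub_horner // dvdp_exp2r // -nE.
exact: dvdp_sub_horner.
Qed.

(** Chinese remainders: with u a + v b = 1, the sum of ha v b and hb u a is ha modulo a and hb
    modulo b. It is linear in ha and hb, hence differentiable with them. *)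
Lemma exp_mod_coprime a b ha hb : coprimep a b -> exp_mod a ha -> exp_mod b hb ->
  exists h, exp_mod (a * b) h.
Proof.
move=> cab [a0 aN ad] [b0 bN bd].
have /Bezout_eq1_coprimepP [[u v] /= uv] := cab.
pose h f := ha f * (v * b) + hb f * (u * a).
have hE f : h f = ha f + (hb f - ha f) * u * a.
  by rewrite -[ha f in X in _ = X + _]mulr1 -uv /h; ring.
have hE' f : h f = hb f + (ha f - hb f) * v * b.
  by rewrite -[hb f in X in _ = X + _]mulr1 -uv /h; ring.
exists h; split=> [|f|f g t].
- rewrite Gauss_dvdp //; apply/andP; split.
    by rewrite hE addrAC dvdp_addr // dvdp_mull.
  by rewrite hE' addrAC dvdp_addr // dvdp_mull.
- rewrite Gauss_dvdp //; apply/andP; split.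
    rewrite !hE; move: ((hb f - ha f) * u) ((hb (- f) - ha (- f)) * u) => p q.
    rewrite [X in _ %| X](_ : _ = (ha f * ha (- f) - 1) + (ha f * q + p * ha (- f) + p * a * q) *
      a); last by ring.
    by rewrite dvdp_addr ?aN // dvdp_mull.
  rewrite !hE'; move: ((ha f - hb f) * v) ((ha (- f) - hb (- f)) * v) => p q.
  rewrite [X in _ %| X](_ : _ = (hb f * hb (- f) - 1) + (hb f * q + p * hb (- f) + p * b * q) *
    b); last by ring.
  by rewrite dvdp_addr ?bN // dvdp_mull.
have [da hda hda'] := ad f g t; have [db hdb hdb'] := bd f g t.
have h1 := poly_is_deriveM hda (poly_is_derive_cst (v * b) t).
have h2 := poly_is_deriveM hdb (poly_is_derive_cst (u * a) t).
exists (da * (v * b) + db * (u * a)).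
  by have := poly_is_deriveD h1 h2; rewrite !mulr0 !addr0.
rewrite [X in _ %| X](_ : _ = (da - g * ha (f + t *: g)) * b * v + a * (db - g * hb (f + t *: g))
  * u); last first.
  by rewrite /h; ring.
by rewrite dvdp_add // dvdp_mulr // dvdp_mul.
Qed.

Lemma exp_mod_dvd a b h : a %| b -> exp_mod b h -> exp_mod a h.
Proof.
move=> ab [b0 bN bd]; split=> [|f|f g t]; first exact: dvdp_trans ab b0.
  exact: dvdp_trans ab (bN f).
by have [dh h1 h2] := bd f g t; exists dh => //; exact: dvdp_trans ab h2.
Qed.

(** Over an algebraically closed field chi splits, and powers of distinct linear factors are
    coprime. *)
Lemma exp_mod_exists (chi : {poly C}) : chi != 0 -> exists h, exp_mod chi h.
Proof.
move=> chi0; have [rs hrs] := closed_field_poly_normal chi.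
have hd : chi %| \prod_(z <- rs) ('X - z%:P).
  by rewrite {1}hrs dvdpZl ?lead_coef_eq0.
suff [h hh] : exists h, exp_mod (\prod_(z <- rs) ('X - z%:P)) h.
  by exists h; exact: exp_mod_dvd hd hh.
rewrite -prodr_undup_exp_count.
move: (undup_uniq rs); elim: (undup rs) => [_|z s IH /= /andP[zs /IH [h hh]]].
  rewrite big_nil; exists (fun=> 0); split=> [|f|f g t]; rewrite ?dvd1p //.
  by exists 0; rewrite ?dvd1p //; exact: poly_is_derive_cst.
rewrite big_cons; have [ha hha] := exp_mod_local z (count_mem z rs).
apply: exp_mod_coprime hha hh.
rewrite coprimep_expl // coprimep_sym coprimep_XsubC rootE horner_prod.
rewrite prodf_seq_neq0; apply/allP => w ws /=.
rewrite !hornerE expf_neq0 // subr_eq0; apply: contraNneq zs => ->; exact: ws.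
Qed.

End ExpPolynomial.

(** * Polynomials in a square matrix *)

Section MatrixEval.
Variable C : numClosedFieldType.
Implicit Types (p q : {poly C}).

(** A plain sum instead of [horner_mx], so as to include size 0, which occurs when all V_i are
    zero. *)
Definition mxeval k (A : 'M[C]_k) p : 'M[C]_k := \sum_(i < size p) p`_i *: A ^+ i.

Lemma mxeval_horner k (A : 'M[C]_k.+1) p : mxeval A p = horner_mx A p.
Proof.
rewrite -[p in RHS]coefK poly_def raddf_sum; apply: eq_bigr => i _ /=.
by rewrite linearZ rmorphXn /= horner_mx_X.
Qed.

Lemma mx0_eq (A B : 'M[C]_0) : A = B.
Proof. by rewrite (flatmx0 A) (flatmx0 B). Qed.

Lemma mxevalD k (A : 'M[C]_k) p q : mxeval A (p + q) = mxeval A p + mxeval A q.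
Proof.
by case: k A => [|k] A; [exact: mx0_eq | rewrite !mxeval_horner raddfD].
Qed.

Lemma mxevalN k (A : 'M[C]_k) p : mxeval A (- p) = - mxeval A p.
Proof.
by case: k A => [|k] A; [exact: mx0_eq | rewrite !mxeval_horner raddfN].
Qed.

Lemma mxevalM k (A : 'M[C]_k) p q : mxeval A (p * q) = mxeval A p *m mxeval A q.
Proof.
by case: k A => [|k] A; [exact: mx0_eq | rewrite !mxeval_horner rmorphM].
Qed.

Lemma mxeval1 k (A : 'M[C]_k) : mxeval A 1 = 1%:M.
Proof.
by case: k A => [|k] A; [exact: mx0_eq | rewrite !mxeval_horner rmorph1].
Qed.

Lemma mxevalX k (A : 'M[C]_k) j : mxeval A 'X^j = A ^+ j.
Proof.
by case: k A => [|k] A; [exact: mx0_eq | rewrite !mxeval_horner rmorphXn /= horner_mx_X].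
Qed.

Lemma mxeval_eq0 k (A : 'M[C]_k) p : char_poly A %| p -> mxeval A p = 0.
Proof.
case: k A => [|k] A; first by move=> _; exact: mx0_eq.
move=> /dvdpP [q ->]; rewrite mxeval_horner rmorphM /= Cayley_Hamilton mulr0 //.
Qed.

Lemma mxeval_eq k (A : 'M[C]_k) p q : char_poly A %| p - q -> mxeval A p = mxeval A q.
Proof.
by move=> /mxeval_eq0; rewrite mxevalD mxevalN => /eqP; rewrite subr_eq0 => /eqP.
Qed.

Lemma sum_coef_widen (V : lmodType C) (G : nat -> V) p N : (size p <= N)%N ->
  \sum_(i < size p) p`_i *: G i = \sum_(i < N) p`_i *: G i.
Proof.
move=> h; rewrite (big_ord_widen N (fun i => p`_i *: G i) h) big_mkcond /=.
apply: eq_bigr => i _; case: ltnP => // hi.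
by rewrite nth_default ?scale0r.
Qed.

Lemma mx_is_derive_near a b (S T : C -> 'M[C]_(a, b)) t dS :
  (\forall s \near t, S s = T s) -> mx_is_derive S t dS -> mx_is_derive T t dS.
Proof.
move=> h hS i j; apply: is_derive_near (hS i j).
by near=> s; rewrite (near h s).
Unshelve. all: by end_near. Qed.

(** The bound on the degrees near t in [poly_is_derive] lets all the sums run over one fixed
    range. *)
Lemma mx_is_derive_coef_sum a b (G : nat -> 'M[C]_(a, b)) (p : C -> {poly C}) t dp :
  poly_is_derive p t dp ->
  mx_is_derive (fun s => \sum_(i < size (p s)) (p s)`_i *: G i) t
    (\sum_(i < size dp) dp`_i *: G i).
Proof.
move=> [[N hN] hp]; pose N' := maxn N (size dp).
rewrite (sum_coef_widen G (leq_maxr N (size dp))) -/N'.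
apply: (mx_is_derive_near (S := fun s => \sum_(i < N') (p s)`_i *: G i)).
  by near=> s; rewrite (sum_coef_widen G (N := N')) // leq_max (near hN s).
move=> i j; rewrite summxE.
rewrite (_ : (fun _ => _) = fun s => \sum_(k < N') (p s)`_k * G k i j); last first.
  by apply/funext => s; rewrite summxE; apply: eq_bigr => k _; rewrite mxE.
apply: is_derive_bigsum => k _; rewrite mxE.
by have := is_derive_mul (hp k) (is_derive_const (G k i j) t); rewrite mulr0 addr0.
Unshelve. all: by end_near. Qed.

End MatrixEval.

(** * Exponentials of block triangular matrices *)

Section BlockEval.
Variables (C : numClosedFieldType) (k m : nat) (Y Z : 'M[C]_k).
Implicit Types (p q : {poly C}).

(** The directional derivative of Y^N along Z. For N = m j and Z = v E_beta w its opposite is the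
    velocity of X. *)
Definition divdiff N : 'M[C]_k := \sum_(a < N) Y ^+ a *m Z *m Y ^+ (N - a - 1).

Lemma divdiffS N : divdiff N.+1 = Y *m divdiff N + Z *m Y ^+ N.
Proof.
rewrite /divdiff big_ord_recl expr0 mul1mx subn0 subn1 addrC; congr (_ + _).
rewrite mulmx_sumr; apply: eq_bigr => i _.
by rewrite /bump /= exprS -mulmxE !mulmxA subSS.
Qed.

Let T : 'M[C]_(k + k) := block_mx Y Z 0 Y.

(* Off the diagonal of a power of [T] stands the divided difference of that power. *)
Lemma block_exp N : T ^+ N = block_mx (Y ^+ N) (divdiff N) 0 (Y ^+ N).
Proof.
elim: N => [|N IH].
  by rewrite !expr0 /divdiff big_ord0 -scalar_mx_block.
rewrite exprS IH -mulmxE mulmx_block !mul0mx !mulmx0 !addr0 add0r divdiffS.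
by rewrite mulmxE -exprS.
Qed.

(** With [evZ], the two blocks of p(T^m); the m-th power is there because the flows involve only the
    powers Y^(m j). *)
Definition evY p : 'M[C]_k := \sum_(i < size p) p`_i *: Y ^+ (m * i).
Definition evZ p : 'M[C]_k := \sum_(i < size p) p`_i *: divdiff (m * i).

Lemma mxeval_block p : mxeval (T ^+ m) p = block_mx (evY p) (evZ p) 0 (evY p).
Proof.
rewrite /mxeval /evY /evZ.
have e (r : nat -> C) N : \sum_(i < N) r i *: (T ^+ m) ^+ i =
  block_mx (\sum_(i < N) r i *: Y ^+ (m * i)) (\sum_(i < N) r i *: divdiff (m * i)) 0
    (\sum_(i < N) r i *: Y ^+ (m * i)).
  elim: N => [|N IH]; first by rewrite !big_ord0 block_mx0.
  by rewrite !big_ord_recr /= IH -exprM block_exp scale_block_mx add_block_mx scaler0 addr0.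
exact: e.
Qed.

(** This and the next rules are those of polynomials in T^m, read off block by block; for [evZ] they
    give a Leibniz rule. *)
Lemma evY_M p q : evY (p * q) = evY p *m evY q.
Proof.
have := mxeval_block (p * q); rewrite mxevalM !mxeval_block mulmx_block.
by move=> /eq_block_mx [<- _ _ _]; rewrite mulmx0 addr0.
Qed.

Lemma evZ_M p q : evZ (p * q) = evY p *m evZ q + evZ p *m evY q.
Proof.
have := mxeval_block (p * q); rewrite mxevalM !mxeval_block mulmx_block.
by move=> /eq_block_mx [_ <- _ _].
Qed.

Lemma evY_X j : evY 'X^j = Y ^+ (m * j).
Proof.
have := mxeval_block 'X^j; rewrite mxevalX -exprM block_exp.
by move=> /eq_block_mx [<- _ _ _].
Qed.

Lemma evZ_X j : evZ 'X^j = divdiff (m * j).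
Proof.
have := mxeval_block 'X^j; rewrite mxevalX -exprM block_exp.
by move=> /eq_block_mx [_ <- _ _].
Qed.

Lemma evY_N p : evY (- p) = - evY p.
Proof.
have := mxeval_block (- p); rewrite mxevalN !mxeval_block opp_block_mx.
by move=> /eq_block_mx [<- _ _ _].
Qed.

Lemma evY_comm p : Y *m evY p = evY p *m Y.
Proof.
rewrite mulmx_sumr mulmx_suml; apply: eq_bigr => i _.
by rewrite -scalemxAr -scalemxAl mulmxE -exprS -exprSr.
Qed.

(** The upper right block of the fact that T commutes with p(T^m). It will preserve the moment map
    equation. *)
Lemma evZ_comm p : Y *m evZ p + Z *m evY p = evY p *m Z + evZ p *m Y.
Proof.
have h : T *m mxeval (T ^+ m) p = mxeval (T ^+ m) p *m T.
  rewrite mulmx_sumr mulmx_suml; apply: eq_bigr => i _.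
  by rewrite -scalemxAr -scalemxAl mulmxE -exprM -exprS -exprSr.
move: h; rewrite mxeval_block !mulmx_block => /eq_block_mx [_ + _ _].
by [].
Qed.

Variable ex : C -> C.
Hypothesis hex : exp_like ex.

(** The interpolation is modulo the characteristic polynomial of T^m, since modulo that of Y^m alone
    the upper right block would in general not be determined. *)
Lemma exp_block_exists : exists h : {poly C} -> {poly C},
  [/\ evY (h 0) = 1%:M, evZ (h 0) = 0, forall f, evY (h f) *m evY (h (- f)) = 1%:M,
      forall f g t, mx_is_derive (fun s => evY (h (f + s *: g))) t (evY g *m evY (h (f + t *: g)))
    & forall f g t, mx_is_derive (fun s => evZ (h (f + s *: g))) t
        (evY g *m evZ (h (f + t *: g)) + evZ g *m evY (h (f + t *: g)))].
Proof.
have [h [h0 hN hd]] := exp_mod_exists hex (monic_neq0 (char_poly_monic (T ^+ m))).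
exists h.
have one : mxeval (T ^+ m) 1 = block_mx 1%:M 0 0 1%:M by rewrite mxeval1 scalar_mx_block.
split.
- by have := mxeval_eq h0; rewrite one mxeval_block => /eq_block_mx [-> _ _ _].
- by have := mxeval_eq h0; rewrite one mxeval_block => /eq_block_mx [_ -> _ _].
- by move=> f; have := mxeval_eq (hN f); rewrite one mxeval_block evY_M => /eq_block_mx [-> _ _ _].
- move=> f g t; have [dh hdh hdv] := hd f g t.
  have := mx_is_derive_coef_sum (fun i => Y ^+ (m * i)) hdh; rewrite -/(evY dh).
  have := mxeval_eq hdv; rewrite !mxeval_block => /eq_block_mx [-> _ _ _].
  by rewrite evY_M.
move=> f g t; have [dh hdh hdv] := hd f g t.
have := mx_is_derive_coef_sum (fun i => divdiff (m * i)) hdh; rewrite -/(evZ dh).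
have := mxeval_eq hdv; rewrite !mxeval_block => /eq_block_mx [_ -> _ _].
by rewrite evZ_M.
Qed.

End BlockEval.

(** * Integration of the flows *)

Lemma sum_single (I : finType) (G : nmodType) (b : I) (M : I -> G) :
  (forall c, c != b -> M c = 0) -> \sum_c M c = M b.
Proof. by move=> h; rewrite (bigD1 b) //= big1 ?addr0. Qed.

Section Solution.
Variables (C : numClosedFieldType) (n d : nat).
Variable alpha : 'I_n.+1 -> nat.
Local Notation V := (\sum_(i < n.+1) alpha i)%N.
Local Notation deg := (@tagnat.sig1 n.+1 alpha).
Local Notation time := {fsfun nat * 'I_d -> C with 0}.

(** T_b with X in place of Y^m; the finite support of the times makes it a polynomial. *)
Definition time_poly (b : 'I_d) (t : time) : {poly C} :=
  \sum_(k <- finsupp t) (if k.2 == b then t k *: 'X^(k.1) else 0).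

Lemma time_poly0 b : time_poly b [fsfun] = 0.
Proof. by rewrite /time_poly finsupp0 big_seq_fset0. Qed.

Lemma time_poly_incl b (t : time) (S : {fset nat * 'I_d}) : (finsupp t `<=` S)%fset ->
  time_poly b t = \sum_(k <- S) (if k.2 == b then t k *: 'X^(k.1) else 0).
Proof.
move=> h; rewrite /time_poly (big_fset_incl _ h) // => k _.
by rewrite memNfinsupp => /eqP ->; rewrite scale0r if_same.
Qed.

(** T_b is affine in each single time, the form in which the exponentials are differentiated. *)
Lemma time_poly_with b (t : time) j g s : time_poly b [fsfun t with (j, g) |-> s] =
  time_poly b [fsfun t with (j, g) |-> 0] + s *: (if g == b then 'X^j else 0).
Proof.
(* One index set for all values of the changed time, since the value 0 removes [(j, g)] from the
   support. *)
pose S := ((j, g) |` finsupp t)%fset.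
have hS s' : (finsupp [fsfun t with (j, g) |-> s'] `<=` S)%fset.
  apply/fsubsetP => k; rewrite mem_finsupp fsfun_withE /S in_fset1U.
  by case: (k =P (j, g)) => //= _; rewrite mem_finsupp.
have jS : (j, g) \in S by rewrite fset1U1.
rewrite !(time_poly_incl _ (hS _)) !(big_fsetD1 _ jS) /= !fsfun_withE eqxx.
rewrite scale0r if_same add0r addrC; congr (_ + _); last by case: eqP; rewrite ?scaler0.
apply: eq_fbigr => k; rewrite !inE /= => /andP[/negbTE kj _] _.
by rewrite !fsfun_withE kj.
Qed.

Definition homog (phi : 'I_n.+1 -> 'I_n.+1) (M : 'M[C]_V) : Prop :=
  forall a b, M a b != 0 -> deg a = phi (deg b).

Lemma homogM phi psi M N : homog phi M -> homog psi N -> homog (phi \o psi) (M *m N).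
Proof.
move=> hM hN a b; apply: contra_neqP => hab; rewrite mxE big1 // => l _.
have [->|/hM h] := eqVneq (M a l) 0; first by rewrite mul0r.
have [->|/hN h'] := eqVneq (N l b) 0; first by rewrite mulr0.
by case: hab; rewrite h h'.
Qed.

Lemma homogD phi M N : homog phi M -> homog phi N -> homog phi (M + N).
Proof.
move=> hM hN a b; rewrite mxE; have [->|/hM //] := eqVneq (M a b) 0.
by rewrite add0r => /hN.
Qed.

Lemma homogZ phi c M : homog phi M -> homog phi (c *: M).
Proof. by move=> hM a b; rewrite mxE mulf_eq0 negb_or => /andP[_ /hM]. Qed.

Lemma homogN phi M : homog phi M -> homog phi (- M).
Proof. by move=> hM a b; rewrite mxE oppr_eq0; exact: hM. Qed.

Lemma homog_sum (I : Type) (r : seq I) (Q : pred I) phi (M : I -> 'M[C]_V) :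
  (forall i, Q i -> homog phi (M i)) -> homog phi (\sum_(i <- r | Q i) M i).
Proof.
move=> h; elim/big_rec: _ => [a b|i N Qi hN]; first by rewrite mxE eqxx.
by apply: homogD => //; exact: h.
Qed.

Lemma homogX k phi M : homog phi M -> homog (iter k phi) (M ^+ k).
Proof.
move=> hM; elim: k => [|k IH].
  by move=> a b; rewrite expr0 mxE; case: (eqVneq a b) => [->|]; rewrite ?eqxx.
by rewrite exprS; exact: homogM.
Qed.

Lemma iter_ord_pred_period k (i : 'I_n.+1) : iter (n.+1 * k) (@ord_pred _) i = i.
Proof.
have e l (z : 'I_n.+1) : iter l (@ord_pred n.+1) (iter l (@ordS n.+1) z) = z.
  by elim: l z => // l IH z; rewrite iterSr iterS ordSK IH.
have h (z : 'I_n.+1) : iter (n.+1 * k) (@ordS n.+1) z = z.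
  by apply/ord_inj; rewrite val_iter_ordS addnC mulnC modnMDl modn_small.
by rewrite -{1}(h i) e.
Qed.

Section Point.
Variable q0 : sph_data C d alpha.
Let E b : 'M[C]_d := delta_mx b b.
Let X0 := totX q0.
Let Y := totY q0.
Let v0 := totv q0.
Let w0 := totw q0.
Let Z b := v0 *m E b *m w0.

Lemma homog_totY : homog (@ord_pred _) Y.
Proof. by move=> a b /totY_graded ->; rewrite ordSK. Qed.

Lemma homog_evY p : homog id (evY n.+1 Y p).
Proof.
apply: homog_sum => i _; apply: homogZ => a b /(homogX homog_totY) ->.
exact: iter_ord_pred_period.
Qed.

Lemma homog_Z b : homog id (Z b).
Proof.
move=> a c; apply: contra_neqP => hac; rewrite mxE big1 // => l _.
have [->|/totw_graded h'] := eqVneq (w0 l c) 0; first by rewrite mulr0.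
rewrite mxE [X in X * _]big1 ?mul0r // => l' _.
have [->|/totv_graded h] := eqVneq (v0 a l') 0; first by rewrite mul0r.
by case: hac; rewrite h h'.
Qed.

(** Every term contains m i - 1 factors Y and so lowers the degree by m i - 1, which modulo m raises
    it by one. *)
Lemma homog_evZ b p : homog (@ordS _) (evZ n.+1 Y (Z b) p).
Proof.
apply: homog_sum => i _; apply: homogZ; apply: homog_sum => a _ c c' h.
have -> : deg c = iter (a + (n.+1 * i - a - 1)) (@ord_pred _) (deg c').
  rewrite iterD; exact: (homogM (homogM (homogX (k:=a) homog_totY) (homog_Z (b:=b)))
    (homogX (k := (n.+1 * i - a - 1)%N) homog_totY) h).
set k := (a + _)%N.
have ek : k.+1 = (n.+1 * i)%N by rewrite /k; have := ltn_ord a; lia.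
by apply: (can_inj (@ord_predK n.+1)); rewrite ordSK -iterS ek iter_ord_pred_period.
Qed.

Variable h : 'I_d -> {poly C} -> {poly C}.
Hypothesis h_exp : forall b,
  [/\ evY n.+1 Y (h b 0) = 1%:M, evZ n.+1 Y (Z b) (h b 0) = 0,
      forall f, evY n.+1 Y (h b f) *m evY n.+1 Y (h b (- f)) = 1%:M,
      forall f g t, mx_is_derive (fun s => evY n.+1 Y (h b (f + s *: g))) t
        (evY n.+1 Y g *m evY n.+1 Y (h b (f + t *: g)))
    & forall f g t, mx_is_derive (fun s => evZ n.+1 Y (Z b) (h b (f + s *: g))) t
        (evY n.+1 Y g *m evZ n.+1 Y (Z b) (h b (f + t *: g))
         + evZ n.+1 Y (Z b) g *m evY n.+1 Y (h b (f + t *: g)))].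

(** With f b = T_b, these three are e^(T_b), e^(-T_b) and Psi_b. *)
Let Pp b (f : 'I_d -> {poly C}) := evY n.+1 Y (h b (f b)).
Let Pm b (f : 'I_d -> {poly C}) := evY n.+1 Y (h b (- f b)).
Let Ps b (f : 'I_d -> {poly C}) := evZ n.+1 Y (Z b) (h b (f b)).

Definition solX f : 'M[C]_V := X0 - \sum_b Pm b f *m Ps b f.
Definition solv f : 'M[C]_(V, d) := \sum_b Pm b f *m v0 *m E b.
Definition solw f : 'M[C]_(d, V) := \sum_b E b *m w0 *m Pp b f.

Lemma sum_E : \sum_b E b = 1%:M. Proof. by rewrite mx1_sum_delta. Qed.

Lemma E_mul b c : E b *m E c = if b == c then E b else 0.
Proof. by rewrite mul_delta_mx_cond; case: eqP => [->|_]; rewrite ?mulr1n ?mulr0n. Qed.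

Lemma solv_E b f : solv f *m E b = Pm b f *m v0 *m E b.
Proof.
rewrite mulmx_suml [LHS](sum_single (b := b)) => [|c /negbTE cb]; rewrite -mulmxA E_mul ?eqxx //.
by rewrite cb mulmx0.
Qed.

Lemma E_solw b f : E b *m solw f = E b *m w0 *m Pp b f.
Proof.
rewrite mulmx_sumr [LHS](sum_single (b := b)) => [|c /negbTE cb]; rewrite !mulmxA E_mul ?eqxx //.
by rewrite eq_sym cb !mul0mx.
Qed.

Lemma solv_E_solw b f : solv f *m E b *m solw f = Pm b f *m Z b *m Pp b f.
Proof.
have -> : solv f *m E b *m solw f = (solv f *m E b) *m (E b *m solw f).
  by rewrite !mulmxA -[_ *m E b *m E b]mulmxA E_mul eqxx.
by rewrite solv_E E_solw !mulmxA -[_ *m E b *m E b]mulmxA E_mul eqxx.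
Qed.

Lemma solvw f : solv f *m solw f = \sum_b Pm b f *m Z b *m Pp b f.
Proof.
have -> : solv f *m solw f = \sum_b solv f *m E b *m solw f.
  by rewrite -mulmx_suml -mulmx_sumr sum_E mulmx1.
by apply: eq_bigr => b _; rewrite solv_E_solw.
Qed.

Lemma Pm_Pp b f : Pm b f *m Pp b f = 1%:M.
Proof. by have [_ _ hi _ _] := h_exp b; rewrite -[X in _ *m evY _ _ (h b X)]opprK hi. Qed.

Lemma sol0 : [/\ solX (fun=> 0) = X0, solv (fun=> 0) = v0 & solw (fun=> 0) = w0].
Proof.
split.
- rewrite /solX [X in _ - X]big1 ?subr0 // => b _; have [_ z _ _ _] := h_exp b.
  by rewrite /Ps z mulmx0.
- rewrite -[RHS]mulmx1 -sum_E mulmx_sumr; apply: eq_bigr => b _; have [z _ _ _ _] := h_exp b.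
  by rewrite /Pm oppr0 z mul1mx.
rewrite -[RHS]mul1mx -sum_E mulmx_suml; apply: eq_bigr => b _; have [z _ _ _ _] := h_exp b.
by rewrite /Pp z mulmx1.
Qed.

(** By [evZ_comm] the commutator of Y with e^(-T_b) Psi_b is Z_b - e^(-T_b) Z_b e^(T_b). Summed over
    b this is v_0 w_0 - v w, so the changes of [Y, X] and of v w compensate. *)
Lemma sol_moment f : Y *m solX f - solX f *m Y - solv f *m solw f = Y *m X0 - X0 *m Y - v0 *m w0.
Proof.
have hs b : Y *m (Pm b f *m Ps b f) - Pm b f *m Ps b f *m Y = Z b - Pm b f *m Z b *m Pp b f.
  have -> : Y *m (Pm b f *m Ps b f) = Pm b f *m (Y *m Ps b f) by rewrite mulmxA evY_comm -mulmxA.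
  have := evZ_comm n.+1 Y (Z b) (h b (f b)); rewrite -/(Pp b f) -/(Ps b f) => e.
  have -> : Y *m Ps b f = Pp b f *m Z b + Ps b f *m Y - Z b *m Pp b f by rewrite -e addrK.
  by rewrite mulmxBr mulmxDr !mulmxA Pm_Pp mul1mx addrAC addrK.
have hz : v0 *m w0 = \sum_b Z b.
  by rewrite -[v0 in LHS]mulmx1 -sum_E mulmx_sumr mulmx_suml.
rewrite /solX mulmxBr mulmxBl mulmx_sumr mulmx_suml solvw hz.
have -> : \sum_b Y *m (Pm b f *m Ps b f) = \sum_b Pm b f *m Ps b f *m Y +
    (\sum_b Z b - \sum_b Pm b f *m Z b *m Pp b f).
  rewrite -sumrB -big_split; apply: eq_bigr => b _.
  by rewrite -hs [RHS]addrC subrK.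
have zid (G : zmodType) (a c s z u : G) : a - (s + (z - u)) - (c - s) - u = a - c - z.
  by rewrite opprD addrA (opprB c) [X in X - u]addrAC subrKA -addrA -opprD subrK.
exact: zid.
Qed.

Lemma homog_solX f : homog (@ordS _) (solX f).
Proof.
apply: homogD; first by move=> a b; exact: totX_graded.
by apply/homogN/homog_sum => b _; apply: (homogM (phi := id));
  [exact: homog_evY | exact: homog_evZ].
Qed.

Lemma solv_graded f a b : solv f a b != 0 -> deg a = 0.
Proof.
apply: contra_neqP => ha; rewrite summxE big1 // => c _; rewrite -mulmxA mxE big1 // => l _.
have [->|/homog_evY hl] := eqVneq (Pm c f a l) 0; first by rewrite mul0r.
rewrite mxE [X in _ * X]big1 ?mulr0 // => l' _.
have [->|/totv_graded hv] := eqVneq (v0 l l') 0; first by rewrite mul0r.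
by case: ha; rewrite hl hv.
Qed.

Lemma solw_graded f b a : solw f b a != 0 -> deg a = 0.
Proof.
apply: contra_neqP => ha; rewrite summxE big1 // => c _; rewrite mxE big1 // => l _.
have [->|/homog_evY hl] := eqVneq (Pp c f l a) 0; first by rewrite mulr0.
rewrite mxE [X in X * _]big1 ?mul0r // => l' _.
have [->|/totw_graded hw] := eqVneq (w0 l' l) 0; first by rewrite mulr0.
by case: ha; rewrite -hw hl.
Qed.

Lemma evY_swap p r : evY n.+1 Y p *m evY n.+1 Y r = evY n.+1 Y r *m evY n.+1 Y p.
Proof. by rewrite -!(evY_M _ _ (0 : 'M[C]_V)) mulrC. Qed.

Section Direction.
Variables (c : 'I_d -> {poly C}) (j : nat) (g : 'I_d) (t : C).
Let N := (n.+1 * j)%N.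
(** Along the time t_(j,g) only T_g moves, with velocity X^j. *)
Let dir b : {poly C} := if g == b then 'X^j else 0.
Let f s b := c b + s *: dir b.

Let evY_dir b : evY n.+1 Y (dir b) = if g == b then Y ^+ N else 0.
Proof.
rewrite /dir; case: ifP => _; first by rewrite (evY_X _ _ (0 : 'M[C]_V)).
by rewrite /evY size_poly0 big_ord0.
Qed.

Let evZ_dir b : evZ n.+1 Y (Z b) (dir b) = if g == b then divdiff Y (Z b) N else 0.
Proof.
rewrite /dir; case: ifP => _; first by rewrite evZ_X.
by rewrite /evZ size_poly0 big_ord0.
Qed.

Lemma Pp_is_derive b : mx_is_derive (fun s => Pp b (f s)) t
  (evY n.+1 Y (dir b) *m Pp b (f t)).
Proof. by have [_ _ _ hd _] := h_exp b; exact: hd. Qed.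

Lemma Pm_is_derive b : mx_is_derive (fun s => Pm b (f s)) t
  (- evY n.+1 Y (dir b) *m Pm b (f t)).
Proof.
have [_ _ _ hd _] := h_exp b; have := hd (- c b) (- dir b) t.
rewrite (evY_N _ _ (0 : 'M[C]_V)) /Pm.
have e s : - f s b = - c b + s *: - dir b by rewrite /f opprD scalerN.
by rewrite e (_ : (fun s => evY _ _ (h b (_ + _))) = (fun s => evY n.+1 Y (h b (- f s b)))) //;
  apply/funext => s; rewrite e.
Qed.

Lemma Ps_is_derive b : mx_is_derive (fun s => Ps b (f s)) t
  (evY n.+1 Y (dir b) *m Ps b (f t) + evZ n.+1 Y (Z b) (dir b) *m Pp b (f t)).
Proof. by have [_ _ _ _ hd] := h_exp b; exact: hd. Qed.

Lemma mx_is_derive_sum (I : finType) a b (F : I -> C -> 'M[C]_(a, b)) dF :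
  (forall i, mx_is_derive (F i) t (dF i)) ->
  mx_is_derive (fun s => \sum_i F i s) t (\sum_i dF i).
Proof.
move=> hF i k; rewrite summxE (_ : (fun _ => _) = fun s => \sum_l F l s i k).
  by apply: is_derive_bigsum => l _; exact: hF.
by apply/funext => s; rewrite summxE.
Qed.

Lemma mx_is_deriveMr a b e (F : C -> 'M[C]_(a, b)) (G : 'M[C]_(b, e)) dF :
  mx_is_derive F t dF -> mx_is_derive (fun s => F s *m G) t (dF *m G).
Proof. by move=> hF; have := mx_is_deriveM hF (mx_is_derive_cst G t); rewrite mulmx0 addr0. Qed.

Lemma mx_is_deriveMl a b e (F : 'M[C]_(a, b)) (G : C -> 'M[C]_(b, e)) dG :
  mx_is_derive G t dG -> mx_is_derive (fun s => F *m G s) t (F *m dG).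
Proof. by move=> hG; have := mx_is_deriveM (mx_is_derive_cst F t) hG; rewrite mul0mx add0r. Qed.

Lemma solv_is_derive : mx_is_derive (fun s => solv (f s)) t (- (Y ^+ N *m solv (f t) *m E g)).
Proof.
have := mx_is_derive_sum (fun b => mx_is_deriveMr (E b) (mx_is_deriveMr v0 (Pm_is_derive b))).
congr mx_is_derive; rewrite -[Y ^+ N *m _ *m _]mulmxA solv_E [LHS](sum_single (b := g)) => [|b bg].
  by rewrite evY_dir eqxx !mulNmx !mulmxA.
by rewrite evY_dir eq_sym (negbTE bg) oppr0 !mul0mx.
Qed.

Lemma solw_is_derive : mx_is_derive (fun s => solw (f s)) t (E g *m solw (f t) *m Y ^+ N).
Proof.
have := mx_is_derive_sum (fun b => mx_is_deriveMl (E b *m w0) (Pp_is_derive b)).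
congr mx_is_derive; rewrite E_solw [LHS](sum_single (b := g)) => [|b bg].
  by rewrite evY_dir eqxx -(evY_X _ _ (0 : 'M[C]_V)) evY_swap mulmxA.
by rewrite evY_dir eq_sym (negbTE bg) mul0mx mulmx0.
Qed.

(** In the derivative of e^(-T_g) Psi_g the two terms with Y^N cancel, leaving the divided
    difference between e^(-T_g) and e^(T_g). These commute with Y and turn Z_g into v E_g w. *)
Lemma solX_is_derive : mx_is_derive (fun s => solX (f s)) t
  (- \sum_(a < N) Y ^+ a *m solv (f t) *m E g *m solw (f t) *m Y ^+ (N - a - 1)).
Proof.
have hs := mx_is_derive_sum (fun b => mx_is_deriveM (Pm_is_derive b) (Ps_is_derive b)).
move=> a b; have hsab := hs a b.
have := is_derive_add (is_derive_const (X0 a b) t) (is_derive_mul (is_derive_const (-1) t) hsab).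
rewrite mul0r add0r add0r mulN1r.
rewrite (_ : (fun s => _ + _) = (fun s => solX (f s) a b)); last first.
  by apply/funext => s; rewrite !mxE mulN1r.
congr (is_derive _ _ _ _); rewrite [RHS]mxE; congr (- fun_of_matrix _ a b).
rewrite [LHS](sum_single (b := g)) => [|e eg]; last first.
  by rewrite evY_dir evZ_dir eq_sym (negbTE eg) oppr0 !mul0mx addr0 mulmx0 addr0.
rewrite evY_dir evZ_dir eqxx mulmxDr -(evY_X n.+1 Y (0 : 'M[C]_V)) !mulmxA.
rewrite [Pm g _ *m evY _ _ _]evY_swap mulNmx mulNmx addrA addNr add0r.
rewrite /divdiff [X in X *m _ = _]mulmx_sumr [LHS]mulmx_suml; apply: eq_bigr => i _.
have -> : Y ^+ i *m solv (f t) *m E g *m solw (f t) = Y ^+ i *m (solv (f t) *m E g *m solw (f t)).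
  by rewrite !mulmxA.
rewrite solv_E_solw.
have hY k p : Y ^+ k *m evY n.+1 Y p = evY n.+1 Y p *m Y ^+ k.
  elim: k => [|k IH]; first by rewrite expr0 mul1mx mulmx1.
  by rewrite exprS -mulmxE -mulmxA IH !mulmxA evY_comm.
by rewrite !mulmxA hY -!mulmxA hY.
Qed.

End Direction.
End Point.
End Solution.

Lemma sph_flows_integrable (C : numClosedFieldType) (n d : nat) (tau : C)
    (kappa : 'I_n.+1 -> C) (alpha : 'I_n.+1 -> nat) (ex : C -> C) (q0 : sph_data C d alpha) :
  exp_like ex -> sph_variety tau kappa q0 ->
  exists q : {fsfun nat * 'I_d -> C with 0} -> sph_data C d alpha,
    [/\ q [fsfun] = q0, forall t, sph_variety tau kappa (q t) &
        forall t j beta s, sph_flow j beta (fun s => q [fsfun t with (j, beta) |-> s]) s].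
Proof.
move=> hex hq0.
have /choice [h hh] := fun b : 'I_d =>
  exp_block_exists n.+1 (totY q0) (totv q0 *m delta_mx b b *m totw q0) hex.
pose f (t : {fsfun nat * 'I_d -> C with 0}) := fun b : 'I_d => time_poly b t.
have /choice [Q hQ] : forall t, exists q, [/\ totX q = solX q0 h (f t), totY q = totY q0,
    totv q = solv q0 h (f t) & totw q = solw q0 h (f t)].
  move=> t; apply: sph_data_of_graded.
  - exact: homog_solX.
  - exact: totY_graded.
  - exact: solv_graded.
  exact: solw_graded.
(* [Q] is specified only through its total matrices; at time 0 it is replaced by [q0] itself to meet
   the initial condition literally. *)
pose q t := if t == [fsfun] then q0 else Q t.
have hq t : [/\ totX (q t) = solX q0 h (f t), totY (q t) = totY q0,
    totv (q t) = solv q0 h (f t) & totw (q t) = solw q0 h (f t)].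
  rewrite /q; case: eqP => [->|_]; last exact: hQ.
  have -> : f [fsfun] = fun=> 0 by apply/funext => b; rewrite /f time_poly0.
  by have [-> -> ->] := sol0 hh.
have hX t : totX (q t) = solX q0 h (f t) by case: (hq t).
have hY t : totY (q t) = totY q0 by case: (hq t).
have hv t : totv (q t) = solv q0 h (f t) by case: (hq t).
have hw t : totw (q t) = solw q0 h (f t) by case: (hq t).
exists q; split; first by rewrite /q eqxx.
  move=> t; apply/sph_varietyP; rewrite hX hY hv hw.
  by rewrite (sol_moment hh); exact/sph_varietyP.
move=> t j b s0.
pose c b' := time_poly b' [fsfun t with (j, b) |-> 0].
have hf s : f [fsfun t with (j, b) |-> s] = fun b' => c b' + s *: (if b == b' then 'X^j else 0).
  by apply/funext => b'; rewrite /f time_poly_with.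
rewrite /sph_flow hY hv hw; split.
- rewrite (_ : (fun s => _) = fun s => solX q0 h (f [fsfun t with (j, b) |-> s])); last first.
    by apply/funext => s; exact: hX.
  rewrite hf (_ : (fun s => _) = fun s => solX q0 h (fun b' => c b' + s *: (if b == b' then 'X^j
    else 0))).
    exact: solX_is_derive.
  by apply/funext => s; rewrite hf.
- rewrite (_ : (fun s => _) = fun=> totY q0); first exact: mx_is_derive_cst.
  by apply/funext => s; exact: hY.
- rewrite (_ : (fun s => _) = fun s => solw q0 h (f [fsfun t with (j, b) |-> s])); last first.
    by apply/funext => s; exact: hw.
  rewrite hf (_ : (fun s => _) = fun s => solw q0 h (fun b' => c b' + s *: (if b == b' then 'X^j
    else 0))).
    exact: solw_is_derive.
  by apply/funext => s; rewrite hf.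
rewrite (_ : (fun s => _) = fun s => solv q0 h (f [fsfun t with (j, b) |-> s])); last first.
  by apply/funext => s; exact: hv.
rewrite hf (_ : (fun s => _) = fun s => solv q0 h (fun b' => c b' + s *: (if b == b' then 'X^j
  else 0))).
  exact: solv_is_derive.
by apply/funext => s; rewrite hf.
Qed.

Lemma exp_like_cexp (R : realType) : exp_like (@cexp R : complexF R -> complexF R).
Proof.
split; first exact: cexp0.
  by move=> z; rewrite -[LHS]cexpD subrr cexp0.
by move=> a b t; exact: is_derive_cexp.
Qed.

(** The first part works on an open set of times because M^-1 is differentiated along with M. In the
    second all times are present, with finite support, and each equation is tested along one of
    them. *)
Theorem theorem6p9 (R : realType) (n d : nat) (mu : R[i])
  (hmu : n.+1.-primitive_root mu) (tau : R[i]) (kappa : 'I_n.+1 -> R[i])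
  (alpha : 'I_n.+1 -> nat) :
  (0 < d)%N -> tau != 0 -> regular (lambda tau kappa) ->
  (forall (j : nat) (beta : 'I_d) (U : set R[i]) (q : R[i] -> sph_data R[i] d alpha),
     open (U : set R[i]^o) ->
     (forall t, U t -> sph_variety tau kappa (q t)) ->
     (forall t, U t -> sph_flow j beta q t) ->
     forall t, U t ->
       [/\ mx_inverse (dressing hmu tau kappa (q t)) (dressingV hmu tau kappa (q t)),
           sph_lax_pair (laxL hmu tau kappa (q t)) (laxR hmu tau kappa (q t))
         & lax_eqs j beta (fun s => laxL hmu tau kappa (q s))
             (fun s => laxR hmu tau kappa (q s)) t])
  /\
  (forall (p : set (sph_data R[i] d alpha)), Csph tau kappa p ->
   forall q0, p q0 ->
   exists q : {fsfun nat * 'I_d -> R[i] with 0} -> sph_data R[i] d alpha,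
     q [fsfun] = q0 /\
     forall t,
       [/\ sph_variety tau kappa (q t),
           forall j beta,
             sph_flow j beta (fun s => q [fsfun t with (j, beta) |-> s]) (t (j, beta)),
           mx_inverse (dressing hmu tau kappa (q t)) (dressingV hmu tau kappa (q t)),
           sph_lax_pair (laxL hmu tau kappa (q t)) (laxR hmu tau kappa (q t))
         & forall j beta,
             lax_eqs j beta
               (fun s => laxL hmu tau kappa (q [fsfun t with (j, beta) |-> s]))
               (fun s => laxR hmu tau kappa (q [fsfun t with (j, beta) |-> s]))
               (t (j, beta))]).
Proof.
move=> _ _ _; split.
  move=> j beta U q oU hU hflow t Ut; split.
  - exact: (mx_inverse_dressingV hmu (hU t Ut)).
  - exact: (sph_lax_pair_dressing hmu (hU t Ut)).
  apply: (lax_equations_at hmu (hflow t Ut)) => //; last exact: hU.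
  by apply: filterS hU _; exact: open_nbhs_nbhs.
move=> p [q1 hq1 ->] q0 [g hg ->].
have hq0 := gauge_variety hg hq1.
have [q [qz hq hflow]] := sph_flows_integrable (exp_like_cexp R) hq0.
exists q; split; first exact: qz.
move=> t; split.
- exact: hq.
- by move=> j beta; exact: hflow.
- exact: (mx_inverse_dressingV hmu (hq t)).
- exact: (sph_lax_pair_dressing hmu (hq t)).
move=> j beta.
have hvar : \forall s \near (t (j, beta) : complexF R),
    sph_variety tau kappa (q [fsfun t with (j, beta) |-> s]) by near=> s; exact: hq.
exact: (lax_equations_at hmu (hflow t j beta (t (j, beta))) hvar (hq _)).
Unshelve. all: by end_near. Qed.
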